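(* Let $\chi$ be a primitive Dirichlet character and let $\rho_\chi = \beta_\chi + i\gamma_\chi$ be a zero of the Dirichlet $L$-function $L(s,\chi)$. Then for every $\varepsilon > 0$ there is a constant $c = c(\rho_\chi,\varepsilon,\chi) > 0$ such that for all sufficiently large real $X$, \[ \int_{0}^{1} \Big| \sum_{n \leqslant X} \lambda(n)\, e(n\alpha) \Big|\, d\alpha \;\geq\; c\, X^{\beta_\chi/2-\varepsilon}. \]
   Context: $\lambda$ denotes the Liouville function, $\lambda(n) = (-1)^{\Omega(n)}$ where $\Omega(n)$ is the number of prime factors of $n$ counted with multiplicity. $e(x) := e^{2\pi i x}$. *)

(* Defs.v *)
From mathcomp Require Import all_boot.
From Stdlib Require Import Reals ZArith.
From Coquelicot Require Import Coquelicot.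

Open Scope R_scope.

Definition Cexp (z : C) : C :=
  (exp (Re z) * cos (Im z), exp (Re z) * sin (Im z)).

Definition e (x : R) : C := Cexp (RtoC (2 * PI * x) * Ci)%C.

Definition bigOmega (n : nat) : nat := (\sum_(p <- primes n) logn p n)%N.

Definition liouville (n : nat) : R := (-1) ^ bigOmega n.

(* The sum over the integers 1 <= n <= X; it is empty when X < 1. *)
Definition liouville_sum (X alpha : R) : C :=
  @sum_n_m C_AbelianMonoid
    (fun n : nat => RtoC (liouville n) * e (INR n * alpha))%C
    1 (Z.to_nat (Int_part X)).

(* A character modulo q is viewed as a q-periodic function on the integers,
   extended by zero to the integers that are not coprime to q. *)
Record dirichlet_character (q : Z) (chi : Z -> C) : Prop := {
  dc_modulus : (0 < q)%Z;
  dc_periodic : forall a : Z, chi (a + q)%Z = chi a;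
  dc_mult : forall a b : Z, chi (a * b)%Z = (chi a * chi b)%C;
  dc_support : forall a : Z, chi a <> RtoC 0 <-> Z.gcd a q = 1%Z
}.

Definition induces (chi' : Z -> C) (q : Z) (chi : Z -> C) : Prop :=
  forall a : Z, Z.gcd a q = 1%Z -> chi a = chi' a.

(* The modulus q = 1 is allowed: the trivial character is then primitive, and
   its L-function is the Riemann zeta function. *)
Definition primitive_character (q : Z) (chi : Z -> C) : Prop :=
  dirichlet_character q chi /\
  ~ exists (d : Z) (chi' : Z -> C),
      (d | q)%Z /\ (d < q)%Z /\ dirichlet_character d chi' /\
      induces chi' q chi.

Definition principal_character (q : Z) (chi : Z -> C) : Prop :=
  forall a : Z, Z.gcd a q = 1%Z -> chi a = RtoC 1.

Definition analytic_at (f : C -> C) (z0 : C) : Prop :=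
  exists (a : nat -> C) (r : R), 0 < r /\
    forall z : C, Cmod (z - z0)%C < r ->
      @is_pseries C_AbsRing C_NormedModule a (z - z0)%C (f z).

(* The term chi(n) n^(-s), for n >= 1. *)
Definition dirichlet_term (chi : Z -> C) (s : C) (n : nat) : C :=
  (chi (Z.of_nat n) * Cexp (- s * RtoC (ln (INR n))))%C.

(* L(s, chi) is entire unless chi is principal, when s = 1 is a pole. *)
Definition L_domain (q : Z) (chi : Z -> C) (s : C) : Prop :=
  ~ (principal_character q chi /\ s = RtoC 1).

(* L is the analytic continuation of the Dirichlet series of chi.  Since
   L_domain is connected, this determines L on it; the value of L at the pole,
   if there is one, is arbitrary. *)
Record is_dirichlet_L (q : Z) (chi : Z -> C) (L : C -> C) : Prop := {
  dL_series : forall s : C, 1 < Re s ->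
    @is_series C_AbsRing C_NormedModule
      (fun k : nat => dirichlet_term chi s (S k)) (L s);
  dL_analytic : forall s : C, L_domain q chi s -> analytic_at L s
}.

(* Main.v *)
From HB Require Import structures.
From Stdlib Require Import Reals ZArith Lra Lia Psatz.
From Stdlib Require Import Classical ClassicalEpsilon.
From Coquelicot Require Import Coquelicot.
From mathcomp Require Import all_boot.
Require Import Defs.

(* Write N for the L1 norm and w(t) = sum_d chi(d) (d t)^(-rho) (1 - d t)_+.  As L(rho, chi) = 0,
   the sum over d is bounded, w has variation O(log) on [1/X, 1], and
   K(x) = sum_n w(n / X) e(n x) is O(log^2 X min(X, 1 / |sin (pi x)|)).  On the other hand
   (lambda chi) * chi is supported on squares, so that M(y) = sum_m lambda(m) chi(m) w(m / y) equals
   sum_k chi(k)^2 (k^2 / y)^(-rho) (1 - k^2 / y)_+, which is asymptotic to L(2 rho, chi^2) y^rho when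
   Re rho > 1/2.  Test the exponential sum against combinations of translates of K by the fractions
   a / p, with p prime, p <= P ~ sqrt X and 0 < a < p.  These are 1 / X-separated, so the test function
   is O(X log^3 X), while complete sums over a pick out multiples of p: up to signs one gets
   sum_p (p |M(X / p)| - |M(X)|), of order P^(2 - beta) X^beta up to logarithms because beta < 1.
   Hence N is at least X^(beta / 2) up to logarithms.
   If beta <= 1/2 the same argument for the trivial character with rho = 0 gives M(y) of order
   y^(1/2) and the exponent 1/4.  That beta < 1 is the non-vanishing of L on Re s >= 1. *)

(* MathComp rebinds the delimiting key [R] to its own ring scope. *)
Delimit Scope R_scope with R.
Open Scope R_scope.

(** * Finite sums and complex powers *)

HB.instance Definition _ :=
  Monoid.isComLaw.Build C (RtoC 0) Cplus Cplus_assoc Cplus_comm Cplus_0_l.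

(** At a zero, the partial sums of chi(d) d^(-rho) equal minus a tail of the series and so decay
    like j^(-beta). This decay keeps w(t) logarithmic. With merely bounded sums w(n / X) could be as
    large as (X / n)^beta, and the test function would be too large to be useful. The factor chi in
    the test function is expanded into additive characters modulo q. Each of them only translates K,
    so the cost is a factor q. For zeta the pole rules out bounded coefficient sums. The
    coefficients 1, -1, 1, -1, ... of (1 - 2^(1 - s)) zeta(s) take their place, and M(X) becomes
    M(X) - 2 M(X / 2); the new factor has no zero with Re s < 1. L is known only as a function
    analytic at each point of its domain. Its agreement with the Dirichlet series is therefore
    carried from Re s > 1 to rho along one segment that misses the point 1. Only a lower bound for
    the number of primes is available. Keeping the primes larger than half their own count retains
    at least half of them and bounds each of them below by about sqrt X / log X. *)

HB.instance Definition _ :=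
  Monoid.isComLaw.Build C (RtoC 1) Cmult Cmult_assoc Cmult_comm Cmult_1_l.
HB.instance Definition _ :=
  Monoid.isMulLaw.Build C (RtoC 0) Cmult Cmult_0_l Cmult_0_r.
HB.instance Definition _ :=
  Monoid.isAddLaw.Build C Cmult Cplus
    (fun x y z => Cmult_plus_distr_r x y z) (fun x y z => Cmult_plus_distr_l x y z).

Lemma Rplus_associative : associative Rplus.
Proof. by move=> x y z; ring. Qed.
Lemma Rmult_associative : associative Rmult.
Proof. by move=> x y z; ring. Qed.
HB.instance Definition _ :=
  Monoid.isComLaw.Build R 0 Rplus Rplus_associative Rplus_comm Rplus_0_l.
HB.instance Definition _ :=
  Monoid.isComLaw.Build R 1 Rmult Rmult_associative Rmult_comm Rmult_1_l.
HB.instance Definition _ :=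
  Monoid.isMulLaw.Build R 0 Rmult Rmult_0_l Rmult_0_r.
HB.instance Definition _ :=
  Monoid.isAddLaw.Build R Rmult Rplus
    (fun x y z => Rmult_plus_distr_r x y z) (fun x y z => Rmult_plus_distr_l x y z).

Notation "\sumC_ ( i <- r | P ) F" := (\big[Cplus/RtoC 0]_(i <- r | P%B) F%C)
  (at level 41, F at level 41, i, r at level 60).
Notation "\sumC_ ( i <- r ) F" := (\big[Cplus/RtoC 0]_(i <- r) F%C)
  (at level 41, F at level 41, i, r at level 60).
Notation "\sumC_ ( m <= i < n | P ) F" := (\big[Cplus/RtoC 0]_(m <= i < n | P%B) F%C)
  (at level 41, F at level 41, m, i, n at level 60).
Notation "\sumC_ ( m <= i < n ) F" := (\big[Cplus/RtoC 0]_(m <= i < n) F%C)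
  (at level 41, F at level 41, m, i, n at level 60).
Notation "\sumR_ ( i <- r | P ) F" := (\big[Rplus/0%R]_(i <- r | P%B) F%R)
  (at level 41, F at level 41, i, r at level 60).
Notation "\sumR_ ( i <- r ) F" := (\big[Rplus/0%R]_(i <- r) F%R)
  (at level 41, F at level 41, i, r at level 60).
Notation "\sumR_ ( m <= i < n | P ) F" := (\big[Rplus/0%R]_(m <= i < n | P%B) F%R)
  (at level 41, F at level 41, m, i, n at level 60).
Notation "\sumR_ ( m <= i < n ) F" := (\big[Rplus/0%R]_(m <= i < n) F%R)
  (at level 41, F at level 41, m, i, n at level 60).

Lemma Cmod_sum (I : Type) (r : seq I) (P : pred I) (F : I -> C) :
  Cmod (\sumC_(i <- r | P i) F i) <= \sumR_(i <- r | P i) Cmod (F i).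
Proof.
elim/big_rec2: _ => [|i x y _ H]; first by rewrite Cmod_0; lra.
by have := Cmod_triangle (F i) y; lra.
Qed.

Lemma Rsum_le (I : Type) (r : seq I) (P : pred I) (F G : I -> R) :
  (forall i, P i -> F i <= G i) ->
  \sumR_(i <- r | P i) F i <= \sumR_(i <- r | P i) G i.
Proof.
move=> H; elim/big_rec2: _ => [|i x y Pi]; first by lra.
by have := H i Pi; lra.
Qed.

Lemma Rsum_le_nat (m n : nat) (F G : nat -> R) :
  (forall i, (m <= i < n)%N -> F i <= G i) ->
  \sumR_(m <= i < n) F i <= \sumR_(m <= i < n) G i.
Proof.
move=> H; rewrite big_nat_cond [in X in _ <= X]big_nat_cond.
by apply: Rsum_le => i; rewrite andbT => /H.
Qed.

Lemma Rsum_ge0 (I : Type) (r : seq I) (P : pred I) (F : I -> R) :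
  (forall i, P i -> 0 <= F i) -> 0 <= \sumR_(i <- r | P i) F i.
Proof.
move=> H; elim/big_rec: _ => [|i x Pi]; first by lra.
by have := H i Pi; lra.
Qed.

Lemma Rsum_telescope (v : nat -> R) (m n : nat) : (m <= n)%N ->
  \sumR_(m <= d < n) (v d - v d.+1) = v m - v n.
Proof.
elim: n => [|n IH]; first by rewrite leqn0 => /eqP ->; rewrite big_geq //; lra.
rewrite leq_eqVlt => /orP[/eqP <-|]; first by rewrite big_geq //; lra.
by rewrite ltnS => mn; rewrite big_nat_recr //= IH //; lra.
Qed.

Lemma Rsum_const (m n : nat) (c : R) : \sumR_(m <= d < n) c = INR (n - m) * c.
Proof.
rewrite big_const_nat; elim: (n - m)%N => [|k IH]; first by rewrite /=; ring.
by rewrite iterS IH S_INR; ring.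
Qed.

Lemma Csum_const (m n : nat) (c : C) : \sumC_(m <= d < n) c = (RtoC (INR (n - m)) * c)%C.
Proof.
rewrite big_const_nat; elim: (n - m)%N => [|k IH]; first by rewrite /=; ring.
by rewrite iterS IH S_INR RtoC_plus; ring.
Qed.

Lemma Re_sum (I : Type) (r : seq I) (P : pred I) (F : I -> C) :
  Re (\sumC_(i <- r | P i) F i) = \sumR_(i <- r | P i) Re (F i).
Proof. by elim/big_rec2: _ => [|i x y _ <-]. Qed.

Lemma RtoC_sum (I : Type) (r : seq I) (P : pred I) (F : I -> R) :
  RtoC (\sumR_(i <- r | P i) F i) = \sumC_(i <- r | P i) RtoC (F i).
Proof. by elim/big_rec2: _ => [|i x y _ <-] //; rewrite RtoC_plus. Qed.

Lemma Csum_opp (I : Type) (r : seq I) (P : pred I) (F : I -> C) :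
  (- (\sumC_(i <- r | P i) F i))%C = \sumC_(i <- r | P i) (- F i).
Proof. by elim/big_rec2: _ => [|i x y _ <-]; ring. Qed.

Lemma Csum_minus (I : Type) (r : seq I) (P : pred I) (F G : I -> C) :
  \sumC_(i <- r | P i) (F i - G i) =
  ((\sumC_(i <- r | P i) F i) - \sumC_(i <- r | P i) G i)%C.
Proof. by rewrite big_split -Csum_opp. Qed.

Lemma sum_n_m_big (f : nat -> C) (n : nat) :
  @sum_n_m C_AbelianMonoid f 1 n = \sumC_(1 <= i < n.+1) f i.
Proof.
elim: n => [|n IH]; first by rewrite sum_n_m_zero; [rewrite big_geq | lia].
rewrite sum_n_Sm; last by lia.
by rewrite IH [RHS]big_nat_recr.
Qed.

Lemma sum_n_big (f : nat -> C) (n : nat) :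
  @sum_n C_AbelianMonoid f n = \sumC_(0 <= i < n.+1) f i.
Proof.
elim: n => [|n IH]; first by rewrite sum_O big_nat1.
by rewrite sum_Sn IH [RHS]big_nat_recr.
Qed.

Lemma Cmod_sub_sym (x y : C) : Cmod (x - y)%C = Cmod (y - x)%C.
Proof. by rewrite -Cmod_opp; congr Cmod; ring. Qed.

Lemma Cmod_triangle_sub (x y : C) : Cmod (x - y)%C <= Cmod x + Cmod y.
Proof. by have := Cmod_triangle x (- y)%C; rewrite Cmod_opp. Qed.

Lemma Cmod_triangle_rev (x y : C) : Cmod x - Cmod y <= Cmod (x - y)%C.
Proof.
have := Cmod_triangle (x - y)%C y; have -> : (x - y + y)%C = x by ring.
by lra.
Qed.

Lemma im_le_Cmod (c : C) : Rabs (Im c) <= Cmod c.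
Proof. by have := Rmax_Cmod c; have := Rmax_r (Rabs c.1) (Rabs c.2); rewrite /Im; lra. Qed.

Lemma Cmod_le_Re_Im (c : C) : Cmod c <= Rabs (Re c) + Rabs (Im c).
Proof.
have [a b] : (0 <= Rabs (Re c) /\ 0 <= Rabs (Im c)) by split; apply: Rabs_pos.
apply: (Rsqr_incr_0_var); last by lra.
rewrite /Rsqr; have := Cmod2_alt c; rewrite /= !Rmult_1_r => ->.
rewrite -(Rabs_pos_eq (Re c * Re c)) ?Rabs_mult; last by nra.
by rewrite -(Rabs_pos_eq (Im c * Im c)) ?Rabs_mult; nra.
Qed.

Definition cpow (x : R) (s : C) : C := Cexp (s * RtoC (ln x)).

Lemma Cexp_add (z w : C) : Cexp (z + w) = (Cexp z * Cexp w)%C.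
Proof.
case: z w => [a b] [c d]; rewrite /Cexp /Cmult /Cplus /= exp_plus cos_plus sin_plus.
by congr (_, _); ring.
Qed.

Lemma Cexp_0 : Cexp (RtoC 0) = RtoC 1.
Proof. by rewrite /Cexp /= exp_0 cos_0 sin_0 !Rmult_1_l. Qed.

Lemma Cmod_Cexp (z : C) : Cmod (Cexp z) = exp (Re z).
Proof.
rewrite /Cmod /Cexp [_.1]/= [_.2]/=.
have -> : (exp (Re z) * cos (Im z)) ^ 2 + (exp (Re z) * sin (Im z)) ^ 2
   = (exp (Re z)) ^ 2 * (Rsqr (sin (Im z)) + Rsqr (cos (Im z))) by rewrite /Rsqr; ring.
by rewrite sin2_cos2 Rmult_1_r sqrt_pow2 //; apply: Rlt_le; apply: exp_pos.
Qed.

Lemma Cexp_neq0 (z : C) : Cexp z <> RtoC 0.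
Proof. by apply/Cmod_gt_0; rewrite Cmod_Cexp; apply: exp_pos. Qed.

Lemma Cexp_opp (z : C) : Cexp (- z) = (/ Cexp z)%C.
Proof.
have H := Cexp_neq0 z.
have E : (Cexp (- z) * Cexp z)%C = RtoC 1.
  by rewrite -Cexp_add Cplus_comm Cplus_opp_r Cexp_0.
have -> : Cexp (- z) = (Cexp (- z) * Cexp z / Cexp z)%C by field.
by rewrite E; field.
Qed.

Lemma Re_mult_RtoC (s : C) (x : R) : Re (s * RtoC x)%C = Re s * x.
Proof. by rewrite /Re /Cmult /=; ring. Qed.

Lemma Cmod_cpow (x : R) (s : C) : Cmod (cpow x s) = Rpower x (Re s).
Proof. by rewrite /cpow Cmod_Cexp Re_mult_RtoC. Qed.

Lemma cpow_add (x : R) (s t : C) : cpow x (s + t) = (cpow x s * cpow x t)%C.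
Proof. by rewrite /cpow -Cexp_add; congr Cexp; ring. Qed.

Lemma cpow_opp (x : R) (s : C) : cpow x (- s) = (/ cpow x s)%C.
Proof. by rewrite /cpow -Cexp_opp; congr Cexp; ring. Qed.

Lemma cpow_mul (x y : R) (s : C) : 0 < x -> 0 < y ->
  cpow (x * y) s = (cpow x s * cpow y s)%C.
Proof. by move=> hx hy; rewrite /cpow ln_mult // RtoC_plus -Cexp_add; congr Cexp; ring. Qed.

Lemma cpow_inv (x : R) (s : C) : 0 < x -> cpow (/ x) s = (/ cpow x s)%C.
Proof. by move=> hx; rewrite /cpow ln_Rinv // RtoC_opp -Cexp_opp; congr Cexp; ring. Qed.

Lemma cpow_1 (s : C) : cpow 1 s = RtoC 1.
Proof. by rewrite /cpow ln_1 Cmult_0_r Cexp_0. Qed.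

Lemma cpow_0 (x : R) : cpow x (RtoC 0) = RtoC 1.
Proof. by rewrite /cpow Cmult_0_l Cexp_0. Qed.

Lemma Cexp_RtoC (x : R) : Cexp (RtoC x) = RtoC (exp x).
Proof. by rewrite /Cexp /= cos_0 sin_0 Rmult_1_r Rmult_0_r. Qed.

Lemma cpow_Rpower (x a : R) : cpow x (RtoC a) = RtoC (Rpower x a).
Proof. by rewrite /cpow -RtoC_mult Cexp_RtoC. Qed.

Lemma cpow_id (x : R) : 0 < x -> cpow x (RtoC 1) = RtoC x.
Proof. by move=> hx; rewrite cpow_Rpower Rpower_1. Qed.

(** Complex functions are differentiated along a real variable only, component by component;
    increments are then estimated by [cderive_bound]. *)
Definition cderive (phi : R -> C) (t : R) (d : C) : Prop :=
  is_derive (fun x => Re (phi x)) t (Re d) /\ is_derive (fun x => Im (phi x)) t (Im d).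

Lemma cderive_mult (f g : R -> C) (t : R) (df dg : C) :
  cderive f t df -> cderive g t dg ->
  cderive (fun x => f x * g x)%C t (df * g t + f t * dg)%C.
Proof.
move=> [fr fi] [gr gi]; split.
- have -> : Re (df * g t + f t * dg)%C =
   (Re df * Re (g t) + Re (f t) * Re dg) - (Im df * Im (g t) + Im (f t) * Im dg).
    by rewrite /Re /Im /Cmult /Cplus /=; ring.
  by apply: is_derive_minus; apply: is_derive_mult => //; move=> a b; apply: Rmult_comm.
- have -> : Im (df * g t + f t * dg)%C =
   (Re df * Im (g t) + Re (f t) * Im dg) + (Im df * Re (g t) + Im (f t) * Re dg).
    by rewrite /Re /Im /Cmult /Cplus /=; ring.
  by apply: is_derive_plus; apply: is_derive_mult => //; move=> a b; apply: Rmult_comm.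
Qed.

Lemma cderive_minus (f g : R -> C) (t : R) (df dg : C) :
  cderive f t df -> cderive g t dg -> cderive (fun x => f x - g x)%C t (df - dg)%C.
Proof.
move=> [fr fi] [gr gi]; split.
- by apply: (is_derive_minus (fun x => Re (f x)) (fun x => Re (g x))).
- by apply: (is_derive_minus (fun x => Im (f x)) (fun x => Im (g x))).
Qed.

Lemma cderive_plus (f g : R -> C) (t : R) (df dg : C) :
  cderive f t df -> cderive g t dg -> cderive (fun x => f x + g x)%C t (df + dg)%C.
Proof.
move=> [fr fi] [gr gi]; split.
- by apply: (is_derive_plus (fun x => Re (f x)) (fun x => Re (g x))).
- by apply: (is_derive_plus (fun x => Im (f x)) (fun x => Im (g x))).
Qed.

Lemma cderive_const (c : C) (t : R) : cderive (fun _ => c) t (RtoC 0).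
Proof. by split; apply: is_derive_const. Qed.

Lemma cderive_RtoC (f : R -> R) (t d : R) :
  is_derive f t d -> cderive (fun x => RtoC (f x)) t (RtoC d).
Proof. by move=> H; split => //=; apply: is_derive_const. Qed.

Lemma cderive_scal (c : C) (f : R -> C) (t : R) (d : C) :
  cderive f t d -> cderive (fun x => c * f x)%C t (c * d)%C.
Proof.
move=> H; have := cderive_mult (fun _ => c) f t _ _ (cderive_const c t) H.
by have -> : (0 * f t + c * d)%C = (c * d)%C by ring.
Qed.

Lemma cderive_Cexp (s : C) (t : R) :
  cderive (fun x => Cexp (s * RtoC x)) t (s * Cexp (s * RtoC t))%C.
Proof.
case: s => a b; split; rewrite /Cexp /Cmult /Re /Im /=.
- apply: (is_derive_ext (fun x => exp (a * x) * cos (b * x))).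
    by move=> x; congr (exp _ * cos _); ring.
  by auto_derive => //; rewrite !Rmult_0_r !Rminus_0_r !Rplus_0_l; ring.
- apply: (is_derive_ext (fun x => exp (a * x) * sin (b * x))).
    by move=> x; congr (exp _ * sin _); ring.
  by auto_derive => //; rewrite !Rmult_0_r !Rminus_0_r !Rplus_0_l; ring.
Qed.

(** Turns a modulus into the real part of a linear expression. It reduces complex estimates to real
    ones in the mean value inequality and under the integral in the duality, and it aligns the sums
    attached to different primes. *)
Lemma unimodular_rotation (z : C) : exists u : C, Cmod u = 1 /\ (u * z)%C = RtoC (Cmod z).
Proof.
case: (Req_dec (Cmod z) 0) => hz.
  exists (RtoC 1); rewrite Cmod_1; split => //.
  by rewrite (Cmod_eq_0 _ hz) Cmult_0_r Cmod_0.
have zn : RtoC (Cmod z) <> RtoC 0 by move=> /RtoC_inj.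
exists (Cconj z / RtoC (Cmod z))%C; split.
  rewrite Cmod_div // Cmod_conj Cmod_R Rabs_pos_eq; last exact: Cmod_ge_0.
  by field.
have -> : (Cconj z / RtoC (Cmod z) * z)%C = (z * Cconj z / RtoC (Cmod z))%C by field.
by rewrite -Cmod2_conj RtoC_mult /= RtoC_mult; field.
Qed.

(* Apply the real mean value theorem to [g - Re (u * phi)], where the unimodular [u]
   rotates the increment of [phi] to the positive real axis. *)
Lemma cderive_bound (phi dphi : R -> C) (g dg : R -> R) (a b : R) : a <= b ->
  (forall t, a <= t <= b -> cderive phi t (dphi t)) ->
  (forall t, a <= t <= b -> is_derive g t (dg t)) ->
  (forall t, a <= t <= b -> Cmod (dphi t) <= dg t) ->
  Cmod (phi b - phi a)%C <= g b - g a.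
Proof.
move=> ab Hphi Hg Hle.
set z := (phi b - phi a)%C.
have [u [hu uz]] := unimodular_rotation z.
have huz : Re (u * z)%C = Cmod z by rewrite uz.
have D : forall t, a <= t <= b ->
   is_derive (fun x => g x - Re (u * phi x)%C) t (dg t - Re (u * dphi t)%C).
  move=> t ht; apply: (is_derive_minus g (fun x => Re (u * phi x)%C)); first exact: Hg.
  by case: (cderive_scal u phi t _ (Hphi t ht)).
have pos : forall t, a <= t <= b -> 0 <= dg t - Re (u * dphi t)%C.
  move=> t ht; have := Hle t ht; have := re_le_Cmod (u * dphi t)%C.
  rewrite Cmod_mult hu Rmult_1_l; have := Rle_abs (Re (u * dphi t)%C); lra.
have [c []] := MVT_gen (fun x => g x - Re (u * phi x)%C) a b (fun t => dg t - Re (u * dphi t)%C)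
  ltac:(move=> x; rewrite Rmin_left // Rmax_right // => hx; apply: D; lra)
  ltac:(move=> x; rewrite Rmin_left // Rmax_right // => hx; apply: derivable_continuous_pt;
        apply: ex_derive_Reals_0; eexists; apply: D; lra).
rewrite Rmin_left // Rmax_right // => hc E.
have := pos c hc => hp.
have E2 : Re (u * phi b)%C - Re (u * phi a)%C = Cmod z.
  by rewrite -huz /z /Re /Cmult /Cplus /Copp /=; ring.
have := Rmult_le_pos _ (b - a) hp ltac:(lra).
lra.
Qed.

Lemma Cmult_integral (x y : C) : (x * y)%C = RtoC 0 -> x = RtoC 0 \/ y = RtoC 0.
Proof.
move=> /(congr1 Cmod); rewrite Cmod_mult Cmod_0 => /Rmult_integral.
by case=> /Cmod_eq_0; [left | right].
Qed.

Lemma Rsum_recr (m n : nat) (F : nat -> R) : (m <= n)%N ->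
  \sumR_(m <= i < n.+1) F i = (\sumR_(m <= i < n) F i) + F n.
Proof. by move=> mn; rewrite big_nat_recr. Qed.

Lemma Rsum_split (f : nat -> R) (a b c : nat) : (a <= b)%N -> (b <= c)%N ->
  \sumR_(a <= i < c) f i = (\sumR_(a <= i < b) f i) + \sumR_(b <= i < c) f i.
Proof. by move=> h1 h2; rewrite (big_cat_nat (n := b)). Qed.

(** * Taylor expansions and the identity theorem *)

Definition Ccv (u : nat -> C) (l : C) : Prop := is_lim_seq (fun n => Cmod (u n - l)%C) 0.

(** A total function, like [Lim_seq]; its value means something only next to a [Ccv] fact, such as
    [Ccv_Clim] provides. *)
Definition Clim (u : nat -> C) : C :=
  (real (Lim_seq (fun n => Re (u n))), real (Lim_seq (fun n => Im (u n)))).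

Lemma is_lim_seq_0_le (u v : nat -> R) (N : nat) :
  (forall n, (N <= n)%coq_nat -> 0 <= u n <= v n) -> is_lim_seq v 0 -> is_lim_seq u 0.
Proof.
move=> H Hv; apply: (is_lim_seq_le_le_loc (fun _ => 0) _ v); last exact: Hv.
  by exists N => n /H.
exact: is_lim_seq_const.
Qed.

Lemma Ccv_le (u : nat -> C) (l : C) (v : nat -> R) (N : nat) :
  (forall n, (N <= n)%coq_nat -> Cmod (u n - l)%C <= v n) -> is_lim_seq v 0 -> Ccv u l.
Proof.
by move=> H; apply: (is_lim_seq_0_le _ _ N) => n /H; split => //; apply: Cmod_ge_0.
Qed.

Lemma Ccv_ext (u v : nat -> C) (l : C) : (forall n, u n = v n) -> Ccv u l -> Ccv v l.
Proof. by move=> E; apply: is_lim_seq_ext => n; rewrite E. Qed.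

Lemma Ccv_plus (u v : nat -> C) (l m : C) :
  Ccv u l -> Ccv v m -> Ccv (fun n => u n + v n)%C (l + m)%C.
Proof.
move=> Hu Hv; apply: (Ccv_le _ _ (fun n => Cmod (u n - l)%C + Cmod (v n - m)%C) 0).
  move=> n _; have -> : (u n + v n - (l + m))%C = ((u n - l) + (v n - m))%C by ring.
  exact: Cmod_triangle.
by have := is_lim_seq_plus' _ _ _ _ Hu Hv; rewrite Rplus_0_r.
Qed.

Lemma Ccv_scal (c : C) (u : nat -> C) (l : C) : Ccv u l -> Ccv (fun n => c * u n)%C (c * l)%C.
Proof.
move=> Hu; apply: (Ccv_le _ _ (fun n => Cmod c * Cmod (u n - l)%C) 0).
  move=> n _; have -> : (c * u n - c * l)%C = (c * (u n - l))%C by ring.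
  by rewrite Cmod_mult; lra.
by have := is_lim_seq_scal_l _ (Cmod c) _ Hu; rewrite /= Rmult_0_r.
Qed.

Lemma Ccv_const (c : C) : Ccv (fun _ => c) c.
Proof.
apply: (is_lim_seq_ext (fun _ => 0)); last exact: is_lim_seq_const.
by move=> n; rewrite /Cminus Cplus_opp_r Cmod_0.
Qed.

Lemma Ccv_minus (u v : nat -> C) (l m : C) :
  Ccv u l -> Ccv v m -> Ccv (fun n => u n - v n)%C (l - m)%C.
Proof.
move=> Hu Hv; have := Ccv_plus _ _ _ _ Hu (Ccv_scal (- (1))%C _ _ Hv).
have -> : (l + - (1) * m)%C = (l - m)%C by ring.
by apply: Ccv_ext => n; cbv beta; ring.
Qed.

Lemma Ccv_le_bound (u : nat -> C) (l : C) (B : R) (N : nat) :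
  Ccv u l -> (forall n, (N <= n)%coq_nat -> Cmod (u n) <= B) -> Cmod l <= B.
Proof.
move=> Hu HB.
have H1 : is_lim_seq (fun n => B + Cmod (u n - l)%C) (B + 0).
  by apply: is_lim_seq_plus' => //; apply: is_lim_seq_const.
have := is_lim_seq_le_loc (fun _ => Cmod l) _ (Cmod l) (B + 0) _ (is_lim_seq_const _) H1.
rewrite /= Rplus_0_r; apply; exists N => n hn.
have := Cmod_triangle_rev l (u n); rewrite Cmod_sub_sym; have := HB n hn; lra.
Qed.

Lemma Ccv_unique (u : nat -> C) (l m : C) : Ccv u l -> Ccv u m -> l = m.
Proof.
move=> Hl Hm; have H := Ccv_minus _ _ _ _ Hl Hm.
have H0 : Cmod (l - m)%C <= 0.
  apply: (Ccv_le_bound _ _ _ 0 H) => n _.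
  by rewrite /Cminus Cplus_opp_r Cmod_0; lra.
have /Cmod_eq_0 E : Cmod (l - m)%C = 0 by have := Cmod_ge_0 (l - m)%C; lra.
have -> : l = ((l - m) + m)%C by ring.
by rewrite E; ring.
Qed.

Lemma Ccv_bounded (u : nat -> C) (l : C) : Ccv u l -> exists B, forall n, Cmod (u n) <= B.
Proof.
move=> /is_lim_seq_spec H; have [N HN] := H (mkposreal 1 Rlt_0_1).
have [B HB] : exists B, forall n, (n < N)%coq_nat -> Cmod (u n) <= B.
  elim: N {HN} => [|N [B HB]]; first by exists 0 => n hn; lia.
  exists (Rmax B (Cmod (u N))) => n hn.
  case: (PeanoNat.Nat.eq_dec n N) => [->|ne]; first exact: Rmax_r.
  by apply: (Rle_trans _ B); [apply: HB; lia | exact: Rmax_l].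
exists (Rmax B (1 + Cmod l)) => n; case: (PeanoNat.Nat.lt_ge_cases n N) => hn.
  by apply: (Rle_trans _ B); [apply: HB | exact: Rmax_l].
apply: (Rle_trans _ (1 + Cmod l)); last exact: Rmax_r.
have := HN n hn; rewrite Rminus_0_r /= Rabs_pos_eq; last exact: Cmod_ge_0.
by have := Cmod_triangle_rev (u n) l; lra.
Qed.

Lemma Ccv_subseq (u : nat -> C) (l : C) (phi : nat -> nat) :
  filterlim phi eventually eventually -> Ccv u l -> Ccv (fun n => u (phi n)) l.
Proof. by move=> Hphi; apply: (is_lim_seq_subseq (fun n => Cmod (u n - l)%C)). Qed.

(** The Cauchy criterion with an explicit modulus: letting the larger index tend to infinity
    preserves [omega] as a bound for the tail. The later arguments use this tail, not only
    convergence. *)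
Lemma Ccv_Clim (u : nat -> C) (omega : nat -> R) :
  (forall m n, (m <= n)%coq_nat -> Cmod (u n - u m)%C <= omega m) -> is_lim_seq omega 0 ->
  Ccv u (Clim u) /\ forall m, Cmod (Clim u - u m)%C <= omega m.
Proof.
move=> H /is_lim_seq_spec Ho.
have cau : forall g : C -> R, (forall x y, g (x - y)%C = g x - g y) ->
   (forall x, Rabs (g x) <= Cmod x) -> is_lim_seq (fun n => g (u n)) (real (Lim_seq (fun n => g (u n)))).
  move=> g gm gb; apply: Lim_seq_correct'; apply/ex_lim_seq_cauchy_corr => eps.
  have [N HN] := Ho eps; exists N => n m hn hm.
  rewrite -gm; apply: (Rle_lt_trans _ _ _ (gb _)).
  case: (PeanoNat.Nat.le_ge_cases n m) => nm.
    rewrite Cmod_sub_sym; apply: (Rle_lt_trans _ _ _ (H _ _ nm)).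
    have := HN n hn; rewrite Rminus_0_r; have := Rle_abs (omega n); lra.
  apply: (Rle_lt_trans _ _ _ (H _ _ nm)).
  have := HN m hm; rewrite Rminus_0_r; have := Rle_abs (omega m); lra.
have hr := cau Re (fun x y => erefl) re_le_Cmod.
have hi := cau Im (fun x y => erefl) im_le_Cmod.
have Hc : Ccv u (Clim u).
  apply: (Ccv_le _ _ (fun n => Rabs (Re (u n) - Re (Clim u)) + Rabs (Im (u n) - Im (Clim u))) 0).
    by move=> n _; apply: Cmod_le_Re_Im.
  have z : forall f : nat -> R, forall l : R, is_lim_seq f l -> is_lim_seq (fun n => Rabs (f n - l)) 0.
    move=> f l hf; have := is_lim_seq_abs_0 (fun n => f n - l); case=> a _; apply: a.
    by have := is_lim_seq_minus' _ _ _ _ hf (is_lim_seq_const l); rewrite Rminus_diag.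
  by have := is_lim_seq_plus' _ _ _ _ (z _ _ hr) (z _ _ hi); rewrite Rplus_0_r.
split => // m.
apply: (Ccv_le_bound (fun n => u n - u m)%C _ _ m); last by move=> n; apply: H.
by apply: Ccv_minus => //; apply: Ccv_const.
Qed.

Lemma is_series_Ccv (a : nat -> C) (l : C) :
  @is_series C_AbsRing C_NormedModule a l -> Ccv (fun n => \sumC_(0 <= k < n.+1) a k) l.
Proof.
rewrite /is_series => /filterlim_locally_ball_norm H.
apply/is_lim_seq_spec => eps.
have [N HN] := H eps; exists N => n hn.
have := HN n hn; rewrite /ball_norm Rminus_0_r Rabs_pos_eq; last exact: Cmod_ge_0.
by rewrite sum_n_big.
Qed.

(* Analyticity as a Taylor expansion whose remainders decay geometrically: it is stable under
   products and suffices for the identity theorem, so no Cauchy theory is needed. *)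
Definition taylor_at (f : C -> C) (z0 : C) : Prop :=
  exists (a : nat -> C) (r C0 : R), 0 < r /\
    forall K h, Cmod h < r ->
      Cmod (f (z0 + h)%C - \sumC_(0 <= k < K) (a k * Cpow h k))%C <= C0 * (Cmod h / r) ^ K.

Lemma Csum_split (f : nat -> C) (a b c : nat) : (a <= b)%N -> (b <= c)%N ->
  (\sumC_(a <= i < c) f i = (\sumC_(a <= i < b) f i) + \sumC_(b <= i < c) f i)%C.
Proof. by move=> h1 h2; rewrite (big_cat_nat (n := b)). Qed.

Lemma Rsum_geom (x : R) (a b : nat) : 0 <= x <= / 2 ->
  \sumR_(a <= k < b) x ^ k <= 2 * x ^ a.
Proof.
move=> hx.
have xa : forall k, 0 <= x ^ k by move=> k; apply: pow_le; lra.
case: (leqP a b) => ab; last by rewrite big_geq; [have := xa a; lra | exact: ltnW].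
have : \sumR_(a <= k < b) x ^ k <= \sumR_(a <= k < b) (2 * x ^ k - 2 * x ^ k.+1).
  by apply: Rsum_le => k _ /=; have := xa k; nra.
by rewrite Rsum_telescope //; have := xa b; lra.
Qed.

Lemma pow_n_Cpow (x : C) (k : nat) : @pow_n C_Ring x k = Cpow x k.
Proof. by elim: k => //= k ->. Qed.

(** Convergence at the point r / 2 bounds the partial sums there, hence their consecutive
    differences, the terms |a_k| (r / 2)^k. For |h| < r / 4 the tail is then dominated by a
    geometric series of ratio at most 1/2. *)
Lemma analytic_taylor (f : C -> C) (z0 : C) : analytic_at f z0 -> taylor_at f z0.
Proof.
move=> [a [r [hr H]]].
have ser : forall h, Cmod h < r -> Ccv (fun n => \sumC_(0 <= k < n.+1) (a k * Cpow h k)) (f (z0 + h)%C).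
  move=> h hh; have E : (z0 + h - z0)%C = h by ring.
  have := H (z0 + h)%C; rewrite E => /(_ hh) /is_series_Ccv.
  apply: Ccv_ext => n; apply: eq_bigr => k _.
  by rewrite pow_n_Cpow Cmult_comm.
have [B [hB HB]] : exists B, 0 <= B /\ forall k, Cmod (a k) * (r / 2) ^ k <= B.
  have h2 : Cmod (RtoC (r / 2)) < r by rewrite Cmod_R Rabs_pos_eq; lra.
  have [B HB] := Ccv_bounded _ _ (ser _ h2).
  exists (2 * B); split; first by have := HB 0%N; have := Cmod_ge_0 (\sumC_(0 <= k < 1) (a k * Cpow (RtoC (r / 2)) k)); lra.
  move=> k; have -> : Cmod (a k) * (r / 2) ^ k = Cmod (a k * Cpow (RtoC (r / 2)) k)%C.
    by rewrite Cmod_mult Cmod_pow Cmod_R Rabs_pos_eq; lra.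
  have := HB k; case: k => [|k]; rewrite big_nat_recr //=.
    by rewrite big_geq // Cplus_0_l => h; have := Cmod_ge_0 (a 0%N * 1)%C; lra.
  have := HB k; set S := bigop _ _ _; set T := (_ * _)%C => h1 h2'.
  have -> : T = (S + T - S)%C by ring.
  by have := Cmod_triangle_sub (S + T)%C S; lra.
exists a, (r / 4), (2 * B); split; first by lra.
move=> K h hh.
have hr2 : Cmod h < r by have := Cmod_ge_0 h; lra.
have cv := Ccv_minus _ _ _ _ (ser _ hr2) (Ccv_const (\sumC_(0 <= k < K) (a k * Cpow h k))).
apply: (Ccv_le_bound _ _ _ K cv) => n /leP hn.
rewrite (Csum_split _ 0 K n.+1) //; last exact: leqW.
set S := \sumC_(0 <= i < K) _.
have -> : (S + (\sumC_(K <= i < n.+1) (a i * h ^ i)) - S)%C = \sumC_(K <= i < n.+1) (a i * h ^ i) by ring.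
apply: (Rle_trans _ _ _ (Cmod_sum _ _ _ _)).
set x := Cmod h / (r / 2).
have hx : 0 <= x <= / 2.
  have := Cmod_ge_0 h; rewrite /x => h0; split; first by apply: Rdiv_le_0_compat; lra.
  by apply/Rle_div_l; lra.
have E k : Cmod (a k * h ^ k)%C <= B * x ^ k.
  rewrite Cmod_mult Cmod_pow.
  have -> : Cmod h ^ k = (r / 2) ^ k * x ^ k by rewrite -Rpow_mult_distr; congr (_ ^ _); rewrite /x; field; lra.
  by rewrite -Rmult_assoc; apply: Rmult_le_compat_r; [apply: pow_le; lra | apply: HB].
apply: (Rle_trans _ (\sumR_(K <= i < n.+1) (B * x ^ i))); first by apply: Rsum_le => k _.
rewrite -big_distrr /=.
have := Rsum_geom x K n.+1 hx => hg.
have le : x ^ K <= (Cmod h / (r / 4)) ^ K.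
  apply: pow_incr; split; first by lra.
  by rewrite /x; apply: Rmult_le_compat_l; [exact: Cmod_ge_0 | apply: Rinv_le_contravar; lra].
by have := Rmult_le_compat_l _ _ _ hB hg; have := Rmult_le_compat_l _ _ _ hB le; lra.
Qed.

Lemma is_lim_seq_Rpower_neg (a : R) : 0 < a -> is_lim_seq (fun n => Rpower (INR n.+1) (- a)) 0.
Proof.
move=> ha; apply: (is_lim_seq_ext (fun n => exp (- a * ln (INR n.+1)))) => //.
apply: (filterlim_comp _ _ _ (fun n => - a * ln (INR n.+1)) exp _ (Rbar_locally m_infty));
  last exact: is_lim_exp_m.
have H : is_lim_seq (fun n => ln (INR n.+1)) p_infty.
  apply: (filterlim_comp _ _ _ (fun n => INR n.+1) ln _ (Rbar_locally p_infty)); last exact: is_lim_ln_p.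
  by apply/(is_lim_seq_incr_1 INR); exact: is_lim_seq_INR.
have := is_lim_seq_scal_l _ (- a) _ H.
rewrite (_ : Rbar_mult _ _ = m_infty) //; apply: is_Rbar_mult_unique.
by apply: is_Rbar_mult_sym; apply: is_Rbar_mult_p_infty_neg => /=; lra.
Qed.

(** * Taylor remainders of the exponential along a ray *)

Lemma exp_le_exp (x y : R) : x <= y -> exp x <= exp y.
Proof. by case=> [h|->]; [left; apply: exp_increasing | right]. Qed.

Lemma is_derive_scal_pow (c : R) (K : nat) (t : R) :
  is_derive (fun x => c * x ^ K.+1) t (c * (INR K.+1 * t ^ K)).
Proof.
apply: (is_derive_scal (fun x => x ^ K.+1)).
have := is_derive_pow (fun x => x) K.+1 t 1 (is_derive_id t).
by rewrite Rmult_1_r.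
Qed.

Lemma pow_fact_le_exp (K : nat) (x : R) : 0 <= x -> x ^ K / INR (fact K) <= exp x.
Proof.
elim: K x => [|K IH] x hx.
  by rewrite /= Rdiv_1_r; have := exp_ineq1_le x; lra.
have fp : forall k, 0 < INR (fact k) by move=> k; apply: INR_fact_lt_0.
have := cderive_bound (fun t => RtoC (t ^ K.+1 / INR (fact K.+1))) (fun t => RtoC (t ^ K / INR (fact K)))
  exp exp 0 x hx.
rewrite exp_0 -RtoC_minus Cmod_R => H.
have {H} : Rabs (x ^ K.+1 / INR (fact K.+1) - 0 ^ K.+1 / INR (fact K.+1)) <= exp x - 1.
  apply: H => t ht.
  - apply: cderive_RtoC.
    have E : INR (fact K.+1) = INR K.+1 * INR (fact K) by rewrite -mult_INR.
    have -> : t ^ K / INR (fact K) = / INR (fact K.+1) * (INR K.+1 * t ^ K).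
      by rewrite E; field; split; [have := fp K; lra | apply: not_0_INR].
    apply: (is_derive_ext (fun x => / INR (fact K.+1) * x ^ K.+1)); last exact: is_derive_scal_pow.
    by move=> y; rewrite Rmult_comm.
  - exact: is_derive_exp.
  - rewrite Cmod_R Rabs_pos_eq; first by apply: IH; lra.
    by apply: Rdiv_le_0_compat => //; apply: pow_le; lra.
rewrite [0 ^ _]/= Rmult_0_l /Rdiv Rmult_0_l Rminus_0_r; set A := _ * / _.
by have := Rle_abs A; lra.
Qed.

Definition exp_rem (K : nat) (z : C) : C :=
  (Cexp z - \sumC_(0 <= k < K) (Cpow z k / RtoC (INR (fact k))))%C.

Lemma exp_rem_S (K : nat) (z : C) :
  exp_rem K.+1 z = (exp_rem K z - Cpow z K / RtoC (INR (fact K)))%C.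
Proof. by rewrite /exp_rem big_nat_recr //=; ring. Qed.

Lemma cderive_ext (f g : R -> C) (t : R) (d : C) :
  (forall x, f x = g x) -> cderive f t d -> cderive g t d.
Proof.
move=> E [a b]; split.
  by apply: (is_derive_ext (fun x => Re (f x))) => // x; rewrite E.
by apply: (is_derive_ext (fun x => Im (f x))) => // x; rewrite E.
Qed.

Lemma RtoC_INR_fact_neq0 (k : nat) : RtoC (INR (fact k)) <> RtoC 0.
Proof. by move=> /RtoC_inj; apply: INR_fact_neq_0. Qed.

Lemma cderive_pow (z : C) (K : nat) (t : R) :
  cderive (fun x => Cpow (z * RtoC x) K.+1 / RtoC (INR (fact K.+1)))%C t
    (z * (Cpow (z * RtoC t) K / RtoC (INR (fact K))))%C.
Proof.
have H : cderive (fun x => (Cpow z K.+1 / RtoC (INR (fact K.+1))) * RtoC (x ^ K.+1))%C t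
   ((Cpow z K.+1 / RtoC (INR (fact K.+1))) * RtoC (INR K.+1 * t ^ K))%C.
  apply: cderive_scal; apply: cderive_RtoC.
  have := is_derive_scal_pow 1 K t; rewrite Rmult_1_l.
  by apply: is_derive_ext => x; rewrite Rmult_1_l.
have P : forall x k, Cpow (z * RtoC x) k = (Cpow z k * RtoC (x ^ k))%C.
  by move=> x k; rewrite Cpow_mult_l RtoC_pow.
have E : (Cpow z K.+1 / RtoC (INR (fact K.+1)) * RtoC (INR K.+1 * t ^ K))%C =
   (z * (Cpow (z * RtoC t) K / RtoC (INR (fact K))))%C.
  have -> : INR (fact K.+1) = INR K.+1 * INR (fact K) by rewrite -mult_INR.
  rewrite P !RtoC_mult; have f0 := RtoC_INR_fact_neq0 K.
  have n0 : RtoC (INR K.+1) <> RtoC 0 by move=> /RtoC_inj; apply: not_0_INR.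
  by rewrite -[Cpow z K.+1]/(z * Cpow z K)%C; field.
rewrite -E; apply: cderive_ext H => x; rewrite P /Cdiv; ring.
Qed.

(** Differentiating lowers the order of the remainder by one. At order 0 the remainder is [Cexp]
    itself, whose derivative has order 0 again, in agreement with the truncated predecessor. *)
Lemma cderive_exp_rem (z : C) (K : nat) (t : R) :
  cderive (fun x => exp_rem K (z * RtoC x)%C) t (z * exp_rem K.-1 (z * RtoC t))%C.
Proof.
have H0 : cderive (fun x => exp_rem 0 (z * RtoC x)%C) t (z * exp_rem 0 (z * RtoC t))%C.
  have := cderive_Cexp z t.
  have -> : (z * exp_rem 0 (z * RtoC t))%C = (z * Cexp (z * RtoC t))%C.
    by rewrite /exp_rem big_geq //; ring.
  by apply: cderive_ext => x; rewrite /exp_rem big_geq //; ring.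
case: K => // K; elim: K => [|K IH].
  apply: (cderive_ext (fun x => exp_rem 0 (z * RtoC x) - RtoC 1)%C).
    by move=> x; rewrite exp_rem_S /=; field; move=> /RtoC_inj; lra.
  have := cderive_minus _ _ _ _ _ H0 (cderive_const (RtoC 1) t).
  by have -> : (z * exp_rem 0 (z * RtoC t) - 0)%C = (z * exp_rem 0 (z * RtoC t))%C by ring.
apply: (cderive_ext (fun x => exp_rem K.+1 (z * RtoC x) -
    Cpow (z * RtoC x) K.+1 / RtoC (INR (fact K.+1)))%C).
  by move=> x; rewrite -exp_rem_S.
have := cderive_minus _ _ _ _ _ IH (cderive_pow z K t).
have -> // : (z * exp_rem (K.+1).-1 (z * RtoC t) - z * (Cpow (z * RtoC t) K / RtoC (INR (fact K))))%C =
  (z * exp_rem (K.+2).-1 (z * RtoC t))%C.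
by rewrite [_.-1]/= [K.+2.-1]/= exp_rem_S; ring.
Qed.

Lemma exp_rem_0 (K : nat) : exp_rem K.+1 (RtoC 0) = RtoC 0.
Proof.
elim: K => [|K IH]; rewrite exp_rem_S.
  rewrite /exp_rem big_geq // Cexp_0 /=; field; move=> /RtoC_inj; lra.
by rewrite IH /= Cmult_0_l /Cdiv Cmult_0_l; ring.
Qed.

Lemma exp_rem_bound (K : nat) (z : C) :
  Cmod (exp_rem K z) <= Cmod z ^ K / INR (fact K) * exp (Cmod z).
Proof.
have expb : forall w : C, Cmod (Cexp w) <= exp (Cmod w).
  move=> w; rewrite Cmod_Cexp; apply: exp_le_exp.
  by have := re_le_Cmod w; have := Rle_abs (Re w); lra.
elim: K z => [|K IH] z.
  rewrite /exp_rem big_geq // /= Rdiv_1_r Rmult_1_l.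
  by have -> : (Cexp z - 0)%C = Cexp z by ring.
have z0 := Cmod_ge_0 z.
have fp : forall k, 0 < INR (fact k) by move=> k; apply: INR_fact_lt_0.
have E : INR (fact K.+1) = INR K.+1 * INR (fact K) by rewrite -mult_INR.
have n0 : INR K.+1 <> 0 by apply: not_0_INR.
have := cderive_bound (fun t => exp_rem K.+1 (z * RtoC t)%C) (fun t => z * exp_rem K (z * RtoC t))%C
  (fun t => Cmod z ^ K.+1 / INR (fact K.+1) * exp (Cmod z) * t ^ K.+1)
  (fun t => Cmod z * ((Cmod z * t) ^ K / INR (fact K) * exp (Cmod z))) 0 1 ltac:(lra).
rewrite Cmult_0_r exp_rem_0 Cmult_1_r pow1 [0 ^ _]/= !Rmult_0_l Rmult_0_r Rmult_1_r Rminus_0_r.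
have -> : (exp_rem K.+1 z - 0)%C = exp_rem K.+1 z by ring.
apply => t ht; first exact: (cderive_exp_rem z K.+1 t).
- have -> : Cmod z * ((Cmod z * t) ^ K / INR (fact K) * exp (Cmod z)) =
    Cmod z ^ K.+1 / INR (fact K.+1) * exp (Cmod z) * (INR K.+1 * t ^ K).
    by rewrite E Rpow_mult_distr -tech_pow_Rmult; field; split => //; have := fp K; lra.
  exact: is_derive_scal_pow.
- rewrite Cmod_mult; apply: Rmult_le_compat_l => //.
  apply: (Rle_trans _ _ _ (IH _)); rewrite Cmod_mult Cmod_R (Rabs_pos_eq t); last by lra.
  apply: Rmult_le_compat_l.
    by apply: Rdiv_le_0_compat => //; apply: pow_le; nra.
  by apply: exp_le_exp; nra.
Qed.

(** Since (r t)^K / K! is at most exp (r t), the factorial is traded for geometric decay in K at the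
    cost of a factor exp (2 r t). At t = ln d that factor is d^(2 r), which d^(-s0) can afford when
    r is a quarter of Re s0. *)
Lemma exp_rem_bound_ray (K : nat) (h : C) (r t : R) : 0 < r -> Cmod h <= r -> 0 <= t ->
  Cmod (exp_rem K (h * RtoC t)%C) <= (Cmod h / r) ^ K * exp (2 * r * t).
Proof.
move=> hr hh ht; have h0 := Cmod_ge_0 h.
apply: (Rle_trans _ _ _ (exp_rem_bound _ _)).
rewrite Cmod_mult Cmod_R (Rabs_pos_eq t) //.
have -> : (Cmod h * t) ^ K = (Cmod h / r) ^ K * (r * t) ^ K.
  by rewrite -Rpow_mult_distr; congr (_ ^ _); field; lra.
have := pow_fact_le_exp K (r * t) ltac:(nra) => H1.
have H2 : exp (Cmod h * t) <= exp (r * t) by apply: exp_le_exp; nra.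
have -> : exp (2 * r * t) = exp (r * t) * exp (r * t) by rewrite -exp_plus; congr exp; ring.
have p0 : 0 <= (Cmod h / r) ^ K by apply: pow_le; apply: Rdiv_le_0_compat.
rewrite /Rdiv !Rmult_assoc; apply: Rmult_le_compat_l => //; rewrite -Rmult_assoc.
apply: Rmult_le_compat => //; last by left; apply: exp_pos.
by apply: Rdiv_le_0_compat; [apply: pow_le; nra | apply: INR_fact_lt_0].
Qed.

(** With t = ln x: the variation of x^(-s) is at most |s| / Re s times that of x^(-Re s), because
    the ratio of the sizes of the two derivatives is constant. *)
Lemma Cexp_ray_bound (s : C) (a b : R) : 0 < Re s -> a <= b ->
  Cmod (Cexp (- s * RtoC b) - Cexp (- s * RtoC a))%C <=
  Cmod s / Re s * exp (- Re s * a) - Cmod s / Re s * exp (- Re s * b).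
Proof.
move=> hs hab.
have := cderive_bound (fun t => Cexp (- s * RtoC t)) (fun t => - s * Cexp (- s * RtoC t))%C
  (fun t => - (Cmod s / Re s * exp (- Re s * t))) (fun t => Cmod s * exp (- Re s * t)) a b hab.
set l := Cmod (Cexp _ - _)%C => H; have {H} : l <= - (Cmod s / Re s * exp (- Re s * b)) - - (Cmod s / Re s * exp (- Re s * a)).
  apply: H => t ht; first exact: cderive_Cexp.
    by auto_derive => //; field; lra.
  by rewrite Cmod_mult Cmod_opp Cmod_Cexp Re_mult_RtoC; right.
lra.
Qed.

Lemma Abel_identity (eta b : nat -> C) (m n : nat) : (m <= n)%N ->
  let E k := \sumC_(1 <= d < k.+1) eta d in
  \sumC_(m.+1 <= d < n.+1) (eta d * b d) =
  (E n * b n.+1 - E m * b m.+1 + \sumC_(m.+1 <= d < n.+1) (E d * (b d - b d.+1)))%C.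
Proof.
move=> mn E; elim: n mn => [|n IH].
  by rewrite leqn0 => /eqP ->; rewrite !big_geq //; ring.
rewrite leq_eqVlt => /orP[/eqP ->|]; first by rewrite !big_geq //; ring.
rewrite ltnS => mn; rewrite big_nat_recr //= IH // [in RHS]big_nat_recr //=.
have -> : E n.+1 = (E n + eta n.+1)%C by rewrite /E big_nat_recr.
ring.
Qed.

(** After summation by parts the boundary terms cost C0 (v n.+1 + v m.+1) and the telescoping
    variation costs C0 (v m.+1 - v n.+1). The contributions at n.+1 cancel, so the bound depends on
    the start of the range only. *)
Lemma dirichlet_test (eta b : nat -> C) (v : nat -> R) (C0 : R) :
  (forall n, Cmod (\sumC_(1 <= d < n.+1) eta d) <= C0) ->
  (forall d, (0 < d)%N -> Cmod (b d) <= v d) ->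
  (forall d, (0 < d)%N -> Cmod (b d - b d.+1)%C <= v d - v d.+1) ->
  forall m n, (m <= n)%N -> Cmod (\sumC_(m.+1 <= d < n.+1) (eta d * b d)) <= 2 * C0 * v m.+1.
Proof.
move=> HE Hb Hd m n mn.
have C0p : 0 <= C0 by apply: Rle_trans (HE 0%N); apply: Cmod_ge_0.
pose E k := \sumC_(1 <= d < k.+1) eta d.
have -> : \sumC_(m.+1 <= d < n.+1) (eta d * b d) =
  (E n * b n.+1 - E m * b m.+1 + \sumC_(m.+1 <= d < n.+1) (E d * (b d - b d.+1)))%C by exact: Abel_identity.
apply: (Rle_trans _ _ _ (Cmod_triangle _ _)).
have H1 : Cmod (E n * b n.+1 - E m * b m.+1)%C <= C0 * v n.+1 + C0 * v m.+1.
  apply: (Rle_trans _ _ _ (Cmod_triangle_sub _ _)); rewrite !Cmod_mult.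
  by apply: Rplus_le_compat; apply: Rmult_le_compat; try exact: Cmod_ge_0; [apply: HE|apply: Hb|apply: HE|apply: Hb].
have H2 : Cmod (\sumC_(m.+1 <= d < n.+1) (E d * (b d - b d.+1))) <= C0 * v m.+1 - C0 * v n.+1.
  apply: (Rle_trans _ _ _ (Cmod_sum _ _ _ _)).
  apply: (Rle_trans _ (\sumR_(m.+1 <= d < n.+1) (C0 * v d - C0 * v d.+1))); last first.
    by rewrite (Rsum_telescope (fun d => C0 * v d)) //; lra.
  apply: Rsum_le_nat => d /andP[md _]; rewrite Cmod_mult -Rmult_minus_distr_l.
  apply: Rmult_le_compat; try exact: Cmod_ge_0; first exact: HE.
  by apply: Hd; apply: leq_ltn_trans md.
lra.
Qed.

Lemma taylor_C0_ge0 (f : C -> C) (z0 : C) (a : nat -> C) (r C0 : R) : 0 < r ->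
  (forall K h, Cmod h < r ->
    Cmod (f (z0 + h)%C - \sumC_(0 <= k < K) (a k * Cpow h k))%C <= C0 * (Cmod h / r) ^ K) -> 0 <= C0.
Proof.
move=> hr H; have := H 0%N (RtoC 0); rewrite Cmod_0 => /(_ hr).
by set A := Cmod _; have : 0 <= A by [exact: Cmod_ge_0]; rewrite /= Rmult_1_r; lra.
Qed.

Lemma taylor_shrink (f : C -> C) (z0 : C) (a : nat -> C) (r r' C0 : R) : 0 < r' <= r ->
  (forall K h, Cmod h < r ->
    Cmod (f (z0 + h)%C - \sumC_(0 <= k < K) (a k * Cpow h k))%C <= C0 * (Cmod h / r) ^ K) ->
  forall K h, Cmod h < r' ->
    Cmod (f (z0 + h)%C - \sumC_(0 <= k < K) (a k * Cpow h k))%C <= C0 * (Cmod h / r') ^ K.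
Proof.
move=> hr H K h hh.
have C0p : 0 <= C0 by apply: (taylor_C0_ge0 f z0 a r) H; lra.
apply: (Rle_trans _ _ _ (H K h ltac:(lra))); apply: Rmult_le_compat_l => //.
have h0 := Cmod_ge_0 h; apply: pow_incr; split; first by apply: Rdiv_le_0_compat; lra.
by apply: Rmult_le_compat_l => //; apply: Rinv_le_contravar; lra.
Qed.

Lemma taylor_minus (f g : C -> C) (z0 : C) :
  taylor_at f z0 -> taylor_at g z0 -> taylor_at (fun z => f z - g z)%C z0.
Proof.
move=> [a [r1 [C1 [hr1 H1]]]] [b [r2 [C2 [hr2 H2]]]].
have hr : 0 < Rmin r1 r2 by apply: Rmin_glb_lt.
have {}H1 := taylor_shrink _ _ _ _ (Rmin r1 r2) _ (conj hr (Rmin_l _ _)) H1.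
have {}H2 := taylor_shrink _ _ _ _ (Rmin r1 r2) _ (conj hr (Rmin_r _ _)) H2.
exists (fun k => a k - b k)%C, (Rmin r1 r2), (C1 + C2); split => // K h hh.
have -> : \sumC_(0 <= k < K) ((a k - b k) * h ^ k) =
  ((\sumC_(0 <= k < K) (a k * h ^ k)) - \sumC_(0 <= k < K) (b k * h ^ k))%C.
  by rewrite -Csum_minus; apply: eq_bigr => k _; ring.
have := H1 K h hh; have := H2 K h hh; set A := bigop _ _ _; set B := bigop _ _ _ => h2 h1.
have -> : (f (z0 + h) - g (z0 + h) - (B - A))%C = ((f (z0 + h) - B) - (g (z0 + h) - A))%C by ring.
by apply: (Rle_trans _ _ _ (Cmod_triangle_sub _ _)); lra.
Qed.

(** Truncating the Cauchy product at K leaves (f - T_K f) g plus the sum over i < K of a_i h^i (g -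
    T_(K-i) g), and each piece is O(x^K). Their number grows with K; halving the radius absorbs it,
    since K + 1 <= 2^K. *)
Lemma taylor_mult (f g : C -> C) (z0 : C) :
  taylor_at f z0 -> taylor_at g z0 -> taylor_at (fun z => f z * g z)%C z0.
Proof.
move=> [a [r1 [C1 [hr1 H1]]]] [b [r2 [C2 [hr2 H2]]]].
set r := Rmin r1 r2; have hr : 0 < r by apply: Rmin_glb_lt.
have {}H1 := taylor_shrink _ _ _ _ r _ (conj hr (Rmin_l _ _)) H1.
have {}H2 := taylor_shrink _ _ _ _ r _ (conj hr (Rmin_r _ _)) H2.
have C1p := taylor_C0_ge0 _ _ _ _ _ hr H1; have C2p := taylor_C0_ge0 _ _ _ _ _ hr H2.
exists (fun k => \sumC_(0 <= i < k.+1) (a i * b (k - i)%N)), (r / 2), (3 * C1 * C2); split; first by lra.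
move=> K h hh; have h0 := Cmod_ge_0 h; have hhr : Cmod h < r by lra.
pose Tf K := \sumC_(0 <= k < K) (a k * h ^ k); pose Tg K := \sumC_(0 <= k < K) (b k * h ^ k).
have E : \sumC_(0 <= k < K) ((\sumC_(0 <= i < k.+1) (a i * b (k - i)%N)) * h ^ k) =
   \sumC_(0 <= i < K) (a i * h ^ i * Tg (K - i)%N).
  elim: K => [|K IH]; first by rewrite !big_geq.
  rewrite big_nat_recr //= IH [in RHS]big_nat_recr //= subSnn.
  have -> : \sumC_(0 <= i < K) (a i * h ^ i * Tg (K.+1 - i)%N) =
    ((\sumC_(0 <= i < K) (a i * h ^ i * Tg (K - i)%N)) +
     (\sumC_(0 <= i < K) (a i * b (K - i)%N)) * h ^ K)%C.
    rewrite big_distrl -big_split; apply: eq_big_nat => i /andP[_ iK] /=.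
    rewrite subSn; last exact: ltnW.
    rewrite /Tg big_nat_recr //=.
    have -> : (h ^ K = h ^ i * h ^ (K - i)%N)%C by rewrite -Cpow_add_r plusE subnKC // ltnW.
    by ring.
  by rewrite big_nat_recr //= subnn /Tg big_nat1 /=; ring.
rewrite E.
set x := Cmod h / r.
have x0 : 0 <= x by apply: Rdiv_le_0_compat.
have x1 : x <= 1 by apply/Rle_div_l; lra.
have xp : forall k, 0 <= x ^ k by move=> k; apply: pow_le.
have F : (f (z0 + h) * g (z0 + h) - \sumC_(0 <= i < K) (a i * h ^ i * Tg (K - i)%N))%C =
  ((f (z0 + h) - Tf K) * g (z0 + h) + \sumC_(0 <= i < K) (a i * h ^ i * (g (z0 + h) - Tg (K - i)%N)))%C.
  have -> : \sumC_(0 <= i < K) (a i * h ^ i * (g (z0 + h) - Tg (K - i)%N)) =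
    (Tf K * g (z0 + h) - \sumC_(0 <= i < K) (a i * h ^ i * Tg (K - i)%N))%C.
    by rewrite /Tf big_distrl -Csum_minus; apply: eq_bigr => i _ /=; ring.
  ring.
rewrite F.
have ga : Cmod (g (z0 + h)%C) <= C2.
  have := H2 0%N h hhr; rewrite big_geq //= Rmult_1_r.
  by have -> : (g (z0 + h) - 0)%C = g (z0 + h)%C by ring.
have ab i : Cmod (a i * h ^ i)%C <= 2 * C1 * x ^ i.
  have := H1 i h hhr; have := H1 i.+1 h hhr; rewrite big_nat_recr //=.
  set S := bigop _ _ _; set Q := (a i * _)%C => h1 h2.
  have -> : Q = ((f (z0 + h) - S) - (f (z0 + h) - (S + Q)))%C by ring.
  apply: (Rle_trans _ _ _ (Cmod_triangle_sub _ _)).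
  move: h1 h2; rewrite -/x; have := xp i; have : 0 <= C1 * x ^ i by apply: Rmult_le_pos.
  nra.
have B : Cmod (\sumC_(0 <= i < K) (a i * h ^ i * (g (z0 + h) - Tg (K - i)%N))) <= INR K * (2 * C1 * C2 * x ^ K).
  apply: (Rle_trans _ _ _ (Cmod_sum _ _ _ _)).
  have := Rsum_const 0 K (2 * C1 * C2 * x ^ K); rewrite subn0 => <-.
  apply: Rsum_le_nat => i /andP[_ iK].
  have -> : 2 * C1 * C2 * x ^ K = (2 * C1 * x ^ i) * (C2 * x ^ (K - i)).
    have -> : (x ^ K = x ^ i * x ^ (K - i)) by rewrite -pow_add plusE subnKC // ltnW.
    by ring.
  rewrite Cmod_mult; apply: Rmult_le_compat; try exact: Cmod_ge_0; first exact: ab.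
  exact: H2.
apply: (Rle_trans _ _ _ (Cmod_triangle _ _)); rewrite Cmod_mult.
have A := H1 K h hhr; rewrite -/x -/(Tf K) in A.
have A' : Cmod (f (z0 + h) - Tf K)%C * Cmod (g (z0 + h)%C) <= C1 * x ^ K * C2.
  by apply: Rmult_le_compat; try exact: Cmod_ge_0.
have K2 : INR K + 1 <= 2 ^ K.
  elim: K {E F B A A'} => [|K IH]; first by rewrite /=; lra.
  by rewrite S_INR -tech_pow_Rmult; have := pos_INR K; lra.
have -> : (Cmod h / (r / 2)) ^ K = 2 ^ K * x ^ K by rewrite -Rpow_mult_distr; congr pow; rewrite /x; field; lra.
have P : 0 <= C1 * C2 * x ^ K by apply: Rmult_le_pos => //; apply: Rmult_le_pos.
have := Rmult_le_compat_l _ _ _ P K2; have := pos_INR K; nra.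
Qed.

(** With l = ln 2 this is the factor 1 - kappa 2^(-z) by which L is multiplied in
    [L_continuation]. *)
Lemma taylor_exp (c0 c1 : C) (l : R) (z0 : C) : 0 <= l ->
  taylor_at (fun z => c0 - c1 * Cexp (- z * RtoC l))%C z0.
Proof.
move=> hl.
exists (fun k => (if k is 0%N then c0 else RtoC 0) - c1 * (Cexp (- z0 * RtoC l) * ((RtoC (- l)) ^ k / RtoC (INR (fact k)))))%C.
exists 1, (Cmod c0 + Cmod c1 * Cmod (Cexp (- z0 * RtoC l)) * exp (2 * 1 * l)); split; first by lra.
move=> K h hh; have h0 := Cmod_ge_0 h.
have -> : \sumC_(0 <= k < K) (((if k is 0%N then c0 else RtoC 0) - c1 * (Cexp (- z0 * RtoC l) * ((RtoC (- l)) ^ k / RtoC (INR (fact k))))) * h ^ k) =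
  ((if K is 0%N then RtoC 0 else c0) - c1 * Cexp (- z0 * RtoC l) * \sumC_(0 <= k < K) ((- h * RtoC l) ^ k / RtoC (INR (fact k))))%C.
  elim: K => [|K IH]; first by rewrite !big_geq //; ring.
  rewrite big_nat_recr //= IH big_nat_recr //=.
  have -> : ((- h * RtoC l) ^ K = RtoC (- l) ^ K * h ^ K)%C by rewrite -Cpow_mult_l; congr Cpow; rewrite RtoC_opp; ring.
  by case: K {IH} => [|K] /=; rewrite /Cdiv; ring.
have -> : Cexp (- (z0 + h) * RtoC l) = (Cexp (- z0 * RtoC l) * Cexp (- h * RtoC l))%C.
  by rewrite -Cexp_add; congr Cexp; ring.
set e0 := Cexp (- z0 * RtoC l).
have -> : forall S T : C, (c0 - c1 * (e0 * Cexp (- h * RtoC l)) - (S - c1 * e0 * T) =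
   (c0 - S) - c1 * e0 * (Cexp (- h * RtoC l) - T))%C by move=> S T; ring.
apply: (Rle_trans _ _ _ (Cmod_triangle_sub _ _)); rewrite !Cmod_mult.
have B : Cmod (exp_rem K (- h * RtoC l)%C) <= (Cmod h / 1) ^ K * exp (2 * 1 * l).
  by have := exp_rem_bound_ray K (- h)%C 1 l; rewrite Cmod_opp; apply; lra.
have B' : Cmod c1 * Cmod e0 * Cmod (exp_rem K (- h * RtoC l)%C) <= Cmod c1 * Cmod e0 * ((Cmod h / 1) ^ K * exp (2 * 1 * l)).
  by apply: Rmult_le_compat_l => //; apply: Rmult_le_pos; apply: Cmod_ge_0.
have xp : 0 <= (Cmod h / 1) ^ K by apply: pow_le; lra.
have A : Cmod (c0 - match K with 0%N => RtoC 0 | _ => c0 end)%C <= Cmod c0 * (Cmod h / 1) ^ K.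
  case: K {B B'} xp => [|K] xp.
    by rewrite /= Rmult_1_r; right; congr Cmod; ring.
  by rewrite /Cminus Cplus_opp_r Cmod_0; apply: Rmult_le_pos => //; apply: Cmod_ge_0.
rewrite /exp_rem in B'; lra.
Qed.

(** If a_k were the first nonzero coefficient, the remainder of order k + 1 at z0 + t v would give
    |a_k| <= C0 / r^(k+1) * t |v|, which is false for small t. Once all coefficients vanish, letting
    K tend to infinity in the remainder bound kills f on the whole disc. *)
Lemma taylor_zero (f : C -> C) (z0 v : C) (tau : R) : taylor_at f z0 -> v <> RtoC 0 -> 0 < tau ->
  (forall t, 0 < t < tau -> f (z0 + RtoC t * v)%C = RtoC 0) ->
  exists delta, 0 < delta /\ forall h, Cmod h < delta -> f (z0 + h)%C = RtoC 0.
Proof.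
move=> [a [r [C0 [hr H]]]] hv htau Hz.
have C0p := taylor_C0_ge0 _ _ _ _ _ hr H.
have vp : 0 < Cmod v by apply/Cmod_gt_0.
have a0 : forall k, (forall j, (j < k)%N -> a j = RtoC 0) -> a k = RtoC 0.
  move=> k IH; apply: Cmod_eq_0; apply: Rle_antisym; last exact: Cmod_ge_0.
  apply: Rnot_lt_le => ak.
  (* The summand 1 keeps [D] positive when C0 = 0; [t] is defined by dividing by it. *)
  set D := C0 / r ^ k.+1 + 1.
  have rk : 0 < r ^ k.+1 by apply: pow_lt.
  have Dp : 0 < D by rewrite /D; have : 0 <= C0 / r ^ k.+1 by [apply: Rdiv_le_0_compat]; lra.
  set t := Rmin (tau / 2) (Rmin (r / (2 * Cmod v)) (Cmod (a k) / (2 * D * Cmod v))).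
  have tp : 0 < t.
    by apply: Rmin_glb_lt; [lra | apply: Rmin_glb_lt; apply: Rdiv_lt_0_compat => //; nra].
  have t1 : t <= tau / 2 by apply: Rmin_l.
  have t2 : t <= r / (2 * Cmod v) by apply: Rle_trans (Rmin_r _ _) (Rmin_l _ _).
  have t3 : t <= Cmod (a k) / (2 * D * Cmod v) by apply: Rle_trans (Rmin_r _ _) (Rmin_r _ _).
  have tv : Cmod (RtoC t * v)%C = t * Cmod v by rewrite Cmod_mult Cmod_R Rabs_pos_eq; lra.
  have tvr : t * Cmod v <= r / 2.
    by have := Rmult_le_compat_r _ _ _ (Rlt_le _ _ vp) t2; have -> : r / (2 * Cmod v) * Cmod v = r / 2 by field; lra.
  have := H k.+1 (RtoC t * v)%C; rewrite tv Hz; last by lra.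
  rewrite big_nat_recr //= big_nat big1; last first.
    by move=> i /andP[_ ik]; rewrite IH // Cmult_0_l.
  have -> : forall q : C, (0 - (0 + q))%C = (- q)%C by move=> q; ring.
  rewrite Cmod_opp Cmod_mult Cmod_pow tv => /(_ ltac:(lra)) HH.
  have tk : 0 < (t * Cmod v) ^ k by apply: pow_lt; nra.
  have E : C0 * (t * Cmod v / r * (t * Cmod v / r) ^ k) = C0 / r ^ k.+1 * (t * Cmod v) * (t * Cmod v) ^ k.
    rewrite [in LHS]/Rdiv Rpow_mult_distr pow_inv -tech_pow_Rmult; field; split; last by lra.
    by apply: pow_nonzero; lra.
  rewrite E in HH; have {}HH := Rmult_le_reg_r _ _ _ tk HH.
  have t3' : D * (t * Cmod v) <= Cmod (a k) / 2.
    have := Rmult_le_compat_r (D * Cmod v) _ _ ltac:(nra) t3.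
    by have -> : Cmod (a k) / (2 * D * Cmod v) * (D * Cmod v) = Cmod (a k) / 2 by [field; lra]; lra.
  have : C0 / r ^ k.+1 * (t * Cmod v) <= D * (t * Cmod v).
    by apply: Rmult_le_compat_r; [nra | rewrite /D; lra].
  lra.
have az : forall k, a k = RtoC 0.
  by move=> k; have [n] := ubnP k; elim: n k => // n IH k kn; apply: a0 => j jk; apply: IH; apply: leq_trans jk _.
exists r; split => // h hh; apply: Cmod_eq_0; apply: Rle_antisym; last exact: Cmod_ge_0.
have h0 := Cmod_ge_0 h.
have x0 : 0 <= Cmod h / r by apply: Rdiv_le_0_compat.
have x1 : Rabs (Cmod h / r) < 1 by rewrite Rabs_pos_eq //; apply/Rlt_div_l; lra.
have L := is_lim_seq_scal_l _ C0 _ (is_lim_seq_geom _ x1).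
rewrite /= Rmult_0_r in L.
apply: (is_lim_seq_le (fun _ => Cmod (f (z0 + h)%C)) _ _ 0 _ (is_lim_seq_const _) L) => K.
have := H K h hh; rewrite big1; first by have -> : (f (z0 + h) - 0)%C = f (z0 + h)%C by ring.
by move=> i _; rewrite az Cmult_0_l.
Qed.

(** Let T be the supremum of the times up to which f vanishes. Approaching T from the left, that is
    in direction -v, gives by [taylor_zero] a disc of zeros around the point at time T, which forces
    T = 1. Expansions are required on the segment alone, so a singularity off the segment does no
    harm. *)
Lemma identity_on_segment (f : C -> C) (z1 v : C) (tau : R) : v <> RtoC 0 -> 0 < tau ->
  (forall t, 0 <= t <= 1 -> taylor_at f (z1 + RtoC t * v)%C) ->
  (forall t, 0 <= t < tau -> f (z1 + RtoC t * v)%C = RtoC 0) ->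
  f (z1 + v)%C = RtoC 0.
Proof.
move=> hv htau HT Hz.
have vp : 0 < Cmod v by apply/Cmod_gt_0.
pose S t := 0 <= t <= 1 /\ forall s, 0 <= s <= t -> f (z1 + RtoC s * v)%C = RtoC 0.
have [T [ub lub]] : {T | is_lub S T}.
  apply: completeness; first by exists 1 => t [[_ ht] _].
  by exists 0; split; [lra | move=> s hs; apply: Hz; lra].
set t0 := Rmin (tau / 2) 1.
have t0p : 0 < t0 by apply: Rmin_glb_lt; lra.
have St0 : S t0.
  split; first by have := Rmin_r (tau / 2) 1; rewrite -/t0; lra.
  by move=> s hs; apply: Hz; have := Rmin_l (tau / 2) 1; rewrite -/t0; lra.
have Tp : t0 <= T by apply: ub.
have T1 : T <= 1 by apply: lub => t [[_ ht] _].
have below : forall s, 0 <= s < T -> f (z1 + RtoC s * v)%C = RtoC 0.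
  move=> s hs; apply: NNPP => hn.
  have : T <= s; last by lra.
  by apply: lub => t [ht Ht]; apply: Rnot_lt_le => st; apply: hn; apply: Ht; lra.
have [d [dp Hd]] := taylor_zero f (z1 + RtoC T * v)%C (- v)%C T (HT T ltac:(lra))
  ltac:(move=> E; apply: hv; rewrite -(Copp_0); rewrite -E; ring) ltac:(lra)
  ltac:(move=> t ht; rewrite -(below (T - t) ltac:(lra)) RtoC_minus; congr f; ring).
have near : forall s, Rabs (s - T) < d / Cmod v -> f (z1 + RtoC s * v)%C = RtoC 0.
  move=> s hs; rewrite -(Hd (RtoC (s - T) * v)%C).
    by congr f; rewrite RtoC_minus; ring.
  by rewrite Cmod_mult Cmod_R; apply/Rlt_div_r.
have dv : 0 < d / Cmod v by apply: Rdiv_lt_0_compat.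
have T1' : T = 1.
  apply: Rle_antisym => //; apply: Rnot_lt_le => lt.
  set u := Rmin 1 (T + d / Cmod v / 2).
  have u1 : u <= 1 by apply: Rmin_l.
  have u2 : u <= T + d / Cmod v / 2 by apply: Rmin_r.
  have uT : T < u by apply: Rmin_glb_lt; lra.
  have : S u; last by move=> /ub; lra.
  split; first by lra.
  move=> s hs; case: (Rlt_le_dec s T) => sT; first by apply: below; lra.
  by apply: near; rewrite Rabs_pos_eq; lra.
by rewrite -(near 1) ?Cmult_1_l // T1' Rminus_diag Rabs_R0.
Qed.

(** * Dirichlet series whose coefficients have bounded partial sums *)

Definition dser (eta : nat -> C) (s : C) (N : nat) : C :=
  \sumC_(1 <= d < N.+1) (eta d * cpow (INR d) (- s)).

Definition bounded_sums (eta : nat -> C) (C0 : R) : Prop :=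
  forall n, Cmod (\sumC_(1 <= d < n.+1) eta d) <= C0.

Lemma ln_INR_S_le (d : nat) : (0 < d)%N -> ln (INR d) <= ln (INR d.+1).
Proof.
move=> /ltP/lt_0_INR hd; apply: ln_le => //.
by rewrite S_INR; lra.
Qed.

Lemma ln_INR_ge0 (d : nat) : (0 < d)%N -> 0 <= ln (INR d).
Proof.
move=> hd; rewrite -ln_1; apply: ln_le; first by lra.
by move/leP/le_INR: hd.
Qed.

Lemma bounded_sums_ge0 (eta : nat -> C) (C0 : R) : bounded_sums eta C0 -> 0 <= C0.
Proof. by move=> /(_ 0%N); apply: Rle_trans; apply: Cmod_ge_0. Qed.

Lemma Csum_partial_sub (f : nat -> C) (m n : nat) : (m <= n)%N ->
  ((\sumC_(1 <= d < n.+1) f d) - \sumC_(1 <= d < m.+1) f d)%C = \sumC_(m.+1 <= d < n.+1) f d.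
Proof. by move=> mn; rewrite (Csum_split f 1 m.+1 n.+1) //; ring. Qed.

Lemma dirichlet_test_cv (eta b : nat -> C) (v : nat -> R) (C0 : R) :
  bounded_sums eta C0 ->
  (forall d, (0 < d)%N -> Cmod (b d) <= v d) ->
  (forall d, (0 < d)%N -> Cmod (b d - b d.+1)%C <= v d - v d.+1) ->
  is_lim_seq (fun n => v n.+1) 0 ->
  let u n := \sumC_(1 <= d < n.+1) (eta d * b d) in
  Ccv u (Clim u) /\ forall m, Cmod (Clim u - u m)%C <= 2 * C0 * v m.+1.
Proof.
move=> HE Hb Hd Hv u.
apply: (Ccv_Clim u (fun m => 2 * C0 * v m.+1)).
  move=> m n /leP mn; rewrite Csum_partial_sub //.
  exact: dirichlet_test.
by have := is_lim_seq_scal_l _ (2 * C0) _ Hv; rewrite /= Rmult_0_r.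
Qed.

Lemma Re_le_Cmod_div (s : C) : 0 < Re s -> 1 <= Cmod s / Re s.
Proof.
move=> hs; apply/Rle_div_r => //; rewrite Rmult_1_l.
by have := re_le_Cmod s; have := Rle_abs (Re s); lra.
Qed.

Lemma cpow_variation (s : C) (d : nat) : 0 < Re s -> (0 < d)%N ->
  Cmod (cpow (INR d) (- s) - cpow (INR d.+1) (- s))%C <=
  Cmod s / Re s * Rpower (INR d) (- Re s) - Cmod s / Re s * Rpower (INR d.+1) (- Re s).
Proof.
move=> hs hd; rewrite Cmod_sub_sym /cpow /Rpower.
by apply: Cexp_ray_bound => //; apply: ln_INR_S_le.
Qed.

Lemma cpow_le_majorant (s : C) (d : nat) : 0 < Re s ->
  Cmod (cpow (INR d) (- s)) <= Cmod s / Re s * Rpower (INR d) (- Re s).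
Proof.
move=> hs; rewrite Cmod_cpow.
have := Re_le_Cmod_div s hs; have : 0 < Rpower (INR d) (- Re s) by apply: exp_pos.
by rewrite -[Re (- s)%C]/(- Re s); nra.
Qed.

Lemma dser_partial_bound (eta : nat -> C) (C0 : R) (s : C) (m n : nat) :
  bounded_sums eta C0 -> 0 < Re s -> (m <= n)%N ->
  Cmod (\sumC_(m.+1 <= d < n.+1) (eta d * cpow (INR d) (- s))) <=
    2 * C0 * (Cmod s / Re s * Rpower (INR m.+1) (- Re s)).
Proof.
move=> HE hs mn.
apply: (dirichlet_test eta _ (fun d => Cmod s / Re s * Rpower (INR d) (- Re s))) => // d hd.
  exact: cpow_le_majorant.
exact: cpow_variation.
Qed.

Lemma dser_cv (eta : nat -> C) (C0 : R) (s : C) : bounded_sums eta C0 -> 0 < Re s ->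
  Ccv (dser eta s) (Clim (dser eta s)) /\
  forall m, Cmod (Clim (dser eta s) - dser eta s m)%C <=
    2 * C0 * (Cmod s / Re s * Rpower (INR m.+1) (- Re s)).
Proof.
move=> HE hs.
apply: (dirichlet_test_cv eta _ (fun d => Cmod s / Re s * Rpower (INR d) (- Re s))) => //.
- by move=> d hd; apply: cpow_le_majorant.
- by move=> d hd; apply: cpow_variation.
- by have := is_lim_seq_scal_l _ (Cmod s / Re s) _ (is_lim_seq_Rpower_neg _ hs); rewrite /= Rmult_0_r.
Qed.

(* Differentiating along the ray [t = ln d] bounds the increments of
   [d ^ (- s0) * exp_rem K (- h * ln d)] by those of a multiple of [d ^ (- Re s0 / 2)]. *)
Lemma exp_rem_variation (s0 h : C) (r : R) (K : nat) (a b : R) :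
  0 < Re s0 -> r = Re s0 / 4 -> Cmod h <= r -> 0 <= a <= b ->
  let phi t := (Cexp (- s0 * RtoC t) * exp_rem K (- h * RtoC t))%C in
  let v t := (Cmod s0 + r) / (Re s0 / 2) * (Cmod h / r) ^ K * exp (- (Re s0 / 2) * t) in
  Cmod (phi a) <= v a /\ Cmod (phi a - phi b)%C <= v a - v b.
Proof.
move=> hs Er hh hab phi v.
have hr : 0 < r by lra.
have h0 := Cmod_ge_0 h.
have xp : forall k, 0 <= (Cmod h / r) ^ k by move=> k; apply: pow_le; apply: Rdiv_le_0_compat.
have bnd k t : 0 <= t -> Cmod (exp_rem k (- h * RtoC t)%C) <= (Cmod h / r) ^ k * exp (2 * r * t).
  by move=> ht; have := exp_rem_bound_ray k (- h)%C r t hr; rewrite Cmod_opp; apply.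
have ce t : Cmod (Cexp (- s0 * RtoC t)) = exp (- Re s0 * t) by rewrite Cmod_Cexp Re_mult_RtoC.
have sr : Re s0 <= Cmod s0 by have := re_le_Cmod s0; have := Rle_abs (Re s0); lra.
have ee t : exp (- Re s0 * t) * exp (2 * r * t) = exp (- (Re s0 / 2) * t).
  by rewrite -exp_plus; congr exp; rewrite Er; field.
split.
  rewrite /phi Cmod_mult ce.
  apply: (Rle_trans _ (exp (- Re s0 * a) * ((Cmod h / r) ^ K * exp (2 * r * a)))).
    by apply: Rmult_le_compat_l; [left; apply: exp_pos | apply: bnd; lra].
  rewrite -Rmult_assoc [exp _ * _ ^ _]Rmult_comm Rmult_assoc ee /v.
  apply: Rmult_le_compat_r; first by left; apply: exp_pos.
  rewrite -[X in X <= _]Rmult_1_l; apply: Rmult_le_compat_r => //.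
  by apply/Rle_div_r; lra.
rewrite Cmod_sub_sym.
have := cderive_bound phi
  (fun t => - s0 * Cexp (- s0 * RtoC t) * exp_rem K (- h * RtoC t) +
     Cexp (- s0 * RtoC t) * (- h * exp_rem K.-1 (- h * RtoC t)))%C
  (fun t => - v t) (fun t => (Cmod s0 + r) * (Cmod h / r) ^ K * exp (- (Re s0 / 2) * t)) a b ltac:(lra).
have -> : - v b - - v a = v a - v b by ring.
apply => t ht.
- by apply: cderive_mult; [exact: cderive_Cexp | exact: cderive_exp_rem].
- by rewrite /v; auto_derive => //; field; lra.
apply: (Rle_trans _ _ _ (Cmod_triangle _ _)); rewrite !Cmod_mult !Cmod_opp ce.
have e0 : 0 < exp (- Re s0 * t) by apply: exp_pos.
have B1 := bnd K t ltac:(lra); have B2 := bnd K.-1 t ltac:(lra).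
have B3 : Cmod h * Cmod (exp_rem K.-1 (- h * RtoC t)%C) <= r * ((Cmod h / r) ^ K * exp (2 * r * t)).
  apply: (Rle_trans _ (Cmod h * ((Cmod h / r) ^ K.-1 * exp (2 * r * t)))).
    by apply: Rmult_le_compat_l.
  rewrite -!Rmult_assoc; apply: Rmult_le_compat_r; first by left; apply: exp_pos.
  case: (K) => [|k] /=; first by rewrite !Rmult_1_r.
  by right; field; lra.
have s0p := Cmod_ge_0 s0.
have -> : (Cmod s0 + r) * (Cmod h / r) ^ K * exp (- (Re s0 / 2) * t) =
  Cmod s0 * exp (- Re s0 * t) * ((Cmod h / r) ^ K * exp (2 * r * t)) +
  exp (- Re s0 * t) * (r * ((Cmod h / r) ^ K * exp (2 * r * t))) by rewrite -ee; ring.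
apply: Rplus_le_compat.
  by apply: Rmult_le_compat_l => //; apply: Rmult_le_pos => //; lra.
by apply: Rmult_le_compat_l => //; lra.
Qed.

(* The Taylor coefficients are limits in [N] of those of the partial sums; they converge because
   consecutive remainders [U_k - U_(k+1)] differ exactly by the [k]-th Taylor term. *)
Lemma dser_taylor (eta : nat -> C) (C0 : R) (s0 : C) : bounded_sums eta C0 -> 0 < Re s0 ->
  taylor_at (fun s => Clim (dser eta s)) s0.
Proof.
move=> HE hs.
set r := Re s0 / 4; have hr : 0 < r by rewrite /r; lra.
pose V := (Cmod s0 + r) / (Re s0 / 2).
have Vp : 0 <= V by apply: Rdiv_le_0_compat; [have := Cmod_ge_0 s0; lra | lra].
pose b h K d := (Cexp (- s0 * RtoC (ln (INR d))) * exp_rem K (- h * RtoC (ln (INR d))))%C.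
pose u h K n := \sumC_(1 <= d < n.+1) (eta d * b h K d).
have cv h K : Cmod h < r -> Ccv (u h K) (Clim (u h K)) /\
    Cmod (Clim (u h K)) <= 2 * C0 * V * (Cmod h / r) ^ K.
  move=> hh.
  have vr d := exp_rem_variation s0 h r K (ln (INR d)) (ln (INR d.+1)) hs erefl (Rlt_le _ _ hh).
  have [|||Hc Hb] := dirichlet_test_cv eta (b h K)
    (fun d => V * (Cmod h / r) ^ K * exp (- (Re s0 / 2) * ln (INR d))) C0 HE.
  - by move=> d hd; case: (vr d) => //; split; [apply: ln_INR_ge0 | apply: ln_INR_S_le].
  - by move=> d hd; case: (vr d) => //; split; [apply: ln_INR_ge0 | apply: ln_INR_S_le].
  - have := is_lim_seq_scal_l _ (V * (Cmod h / r) ^ K) _ (is_lim_seq_Rpower_neg (Re s0 / 2) ltac:(lra)).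
    by rewrite /= Rmult_0_r.
  split => //; have := Hb 0%N; rewrite big_geq // /= ln_1 Rmult_0_r exp_0 Rmult_1_r.
  by have -> : (Clim (u h K) - 0)%C = Clim (u h K) by [ring]; rewrite -/(u h K) !Rmult_assoc.
pose al k n := \sumC_(1 <= d < n.+1) (eta d * (Cexp (- s0 * RtoC (ln (INR d))) * (Cpow (- RtoC (ln (INR d))) k / RtoC (INR (fact k))))).
have du h k n : (u h k n - u h k.+1 n)%C = (h ^ k * al k n)%C.
  rewrite /u /al -Csum_minus big_distrr; apply: eq_bigr => d _ /=; rewrite /b exp_rem_S.
  have -> : ((- h * RtoC (ln (INR d))) ^ k = h ^ k * (- RtoC (ln (INR d))) ^ k)%C.
    by rewrite -Cpow_mult_l; congr Cpow; ring.
  by rewrite /Cdiv; ring.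
have h1r : Cmod (RtoC (r / 2)) < r by rewrite Cmod_R Rabs_pos_eq; lra.
(* The coefficient sums [al] do not involve h, so their limits can be read off at the single point h
   = r / 2. *)
have ca k : Ccv (al k) (/ (RtoC (r / 2)) ^ k * (Clim (u (RtoC (r / 2)) k) - Clim (u (RtoC (r / 2)) k.+1)))%C.
  have rn : ((RtoC (r / 2)) ^ k)%C <> RtoC 0.
    by apply: Cpow_nz => /RtoC_inj; lra.
  have := Ccv_scal (/ (RtoC (r / 2)) ^ k)%C _ _ (Ccv_minus _ _ _ _ (proj1 (cv _ k h1r)) (proj1 (cv _ k.+1 h1r))).
  by apply: Ccv_ext => n; rewrite du; field.
set a := fun k => (/ (RtoC (r / 2)) ^ k * (Clim (u (RtoC (r / 2)) k) - Clim (u (RtoC (r / 2)) k.+1)))%C.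
exists a, r, (2 * C0 * V); split => // K h hh.
have -> : (Clim (dser eta (s0 + h)) - \sumC_(0 <= k < K) (a k * h ^ k))%C = Clim (u h K); last by case: (cv h K hh).
have E0 : Clim (dser eta (s0 + h)) = Clim (u h 0%N).
  have hsp : 0 < Re (s0 + h)%C.
    have -> : Re (s0 + h)%C = Re s0 + Re h by case: (s0); case: (h).
    have := re_le_Cmod h; have := Rle_abs (- Re h); rewrite Rabs_Ropp /r in hh *; lra.
  apply: (Ccv_unique (dser eta (s0 + h)%C)); first by case: (dser_cv eta C0 (s0 + h)%C HE hsp).
  apply: (Ccv_ext (u h 0%N)); last by case: (cv h 0%N hh).
  move=> n; apply: eq_bigr => d _; congr Cmult; rewrite /b /exp_rem big_geq // /cpow.
  have -> : forall z : C, (z - 0)%C = z by move=> z; ring.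
  by rewrite -Cexp_add; congr Cexp; ring.
have step k : (Clim (u h k) - a k * h ^ k)%C = Clim (u h k.+1).
  have L := Ccv_minus _ _ _ _ (proj1 (cv h k hh)) (Ccv_scal (h ^ k)%C _ _ (ca k)).
  rewrite [(a k * _)%C]Cmult_comm.
  apply: (Ccv_unique (u h k.+1)); last by case: (cv h k.+1 hh).
  by apply: Ccv_ext L => n; rewrite -du; ring.
elim: K => [|K IH]; first by rewrite big_geq // E0; ring.
by rewrite big_nat_recr //= -step -IH; ring.
Qed.

(** * Characters as periodic functions *)

Lemma e_cis (x : R) : e x = (cos (2 * PI * x), sin (2 * PI * x)).
Proof.
rewrite /e /Cexp /Cmult /Ci /RtoC /Re /Im /=.
by congr (_, _); rewrite ?Rmult_0_r ?Rmult_1_r ?Rmult_0_l ?Rminus_0_r ?Rplus_0_r exp_0 Rmult_1_l.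
Qed.

Lemma e_add (x y : R) : e (x + y) = (e x * e y)%C.
Proof. by rewrite /e -Cexp_add; congr Cexp; rewrite Rmult_plus_distr_l RtoC_plus; ring. Qed.

Lemma Cmod_e (x : R) : Cmod (e x) = 1.
Proof.
rewrite /e Cmod_Cexp -exp_0; congr exp.
by rewrite /Re /Cmult /Ci /RtoC /=; ring.
Qed.

Lemma e_0 : e 0 = RtoC 1.
Proof. by rewrite /e Rmult_0_r Cmult_0_l Cexp_0. Qed.

Lemma e_nat (n : nat) : e (INR n) = RtoC 1.
Proof.
rewrite e_cis; have -> : 2 * PI * INR n = 0 + 2 * INR n * PI by ring.
by rewrite cos_period sin_period cos_0 sin_0.
Qed.

Lemma e_opp (x : R) : (e x * e (- x))%C = RtoC 1.
Proof. by rewrite -e_add Rplus_opp_r e_0. Qed.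

Lemma e_Z (k : Z) : e (IZR k) = RtoC 1.
Proof.
case: (Z_le_gt_dec 0 k) => hk.
  by rewrite -(Z2Nat.id k) // -INR_IZR_INZ e_nat.
have H : e (- IZR k) = RtoC 1.
  by rewrite -opp_IZR -(Z2Nat.id (- k)); [rewrite -INR_IZR_INZ e_nat | lia].
by have := e_opp (IZR k); rewrite H Cmult_1_r.
Qed.

Lemma e_addZ (x : R) (k : Z) : e (x + IZR k) = e x.
Proof. by rewrite e_add e_Z Cmult_1_r. Qed.

Lemma e_mul_nat (n : nat) (x : R) : e (INR n * x) = Cpow (e x) n.
Proof.
elim: n => [|n IH]; first by rewrite Rmult_0_l e_0.
by rewrite S_INR Rmult_plus_distr_r Rmult_1_l e_add IH Cmult_comm.
Qed.

Lemma Cmod_1_sub_e (x : R) : Cmod (1 - e x)%C = 2 * Rabs (sin (PI * x)).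
Proof.
have h : 0 <= 2 * Rabs (sin (PI * x)) by have := Rabs_pos (sin (PI * x)); lra.
apply: Rsqr_inj => //; first exact: Cmod_ge_0.
rewrite !Rsqr_pow2 Cmod2_alt e_cis Rpow_mult_distr pow2_abs.
have -> : Re (1 - (cos (2 * PI * x), sin (2 * PI * x)))%C = 1 - cos (2 * (PI * x)) by rewrite -Rmult_assoc.
have -> : Im (1 - (cos (2 * PI * x), sin (2 * PI * x)))%C = - sin (2 * (PI * x)).
  by rewrite -Rmult_assoc /Im /=; ring.
rewrite cos_2a_sin sin_2a; have := sin2_cos2 (PI * x); rewrite /Rsqr => H.
have -> : (- (2 * sin (PI * x) * cos (PI * x))) ^ 2 = 4 * sin (PI * x) ^ 2 * (cos (PI * x) * cos (PI * x)) by ring.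
have -> : cos (PI * x) * cos (PI * x) = 1 - sin (PI * x) * sin (PI * x) by lra.
by ring.
Qed.

Lemma fractional_part (x : R) : exists k : Z, 0 <= x - IZR k < 1.
Proof. by exists (Int_part x); have := base_Int_part x; lra. Qed.

Lemma e_eq1_Z (x : R) : e x = RtoC 1 -> exists k : Z, x = IZR k.
Proof.
move=> H; have [k hk] := fractional_part x; exists k.
have H1 : e (x - IZR k) = RtoC 1 by rewrite /Rminus -opp_IZR e_addZ.
have := Cmod_1_sub_e (x - IZR k); rewrite H1 /Cminus Cplus_opp_r Cmod_0 => h0.
case: (Req_dec (x - IZR k) 0) => [|ne]; first by lra.
have := sin_gt_0 (PI * (x - IZR k)); have := PI_RGT_0 => pp h.
have := h ltac:(nra) ltac:(nra) => sp.
by rewrite Rabs_pos_eq in h0; lra.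
Qed.

Lemma Cgeom (w : C) (n : nat) : ((1 - w) * \sumC_(0 <= b < n) (Cpow w b))%C = (1 - Cpow w n)%C.
Proof.
elim: n => [|n IH]; first by rewrite big_geq //=; ring.
by rewrite big_nat_recr //= Cmult_plus_distr_l IH; ring.
Qed.

Lemma e_sum_trivial (n : nat) (x : R) : e x = RtoC 1 ->
  \sumC_(0 <= b < n) e (INR b * x) = RtoC (INR n).
Proof.
move=> H; rewrite (eq_bigr (fun _ => RtoC 1)); last by move=> b _; rewrite e_mul_nat H Cpow_1_l.
by rewrite Csum_const subn0 Cmult_1_r.
Qed.

Lemma e_sum_zero (n : nat) (x : R) : e x <> RtoC 1 -> e (INR n * x) = RtoC 1 ->
  \sumC_(0 <= b < n) e (INR b * x) = RtoC 0.
Proof.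
move=> H1 Hn; rewrite (eq_bigr (fun b => Cpow (e x) b)); last by move=> b _; rewrite e_mul_nat.
have := Cgeom (e x) n; rewrite -e_mul_nat Hn {2}/Cminus Cplus_opp_r => E.
have n0 : (1 - e x)%C <> RtoC 0 by move=> E0; apply: H1; rewrite -(Cplus_0_r (e x)) -E0; ring.
by case: (Cmult_integral _ _ E).
Qed.

Lemma e_sum_div (Q : nat) (k : Z) : (0 < Q)%N ->
  \sumC_(0 <= b < Q) e (INR b * (IZR k / INR Q)) =
  if Z.eqb (Z.modulo k (Z.of_nat Q)) 0 then RtoC (INR Q) else RtoC 0.
Proof.
move=> /ltP hQ; have Q0 : INR Q <> 0 by apply: not_0_INR; lia.
case: Z.eqb_spec => H.
  apply: e_sum_trivial.
  have [m Em] : (Z.of_nat Q | k)%Z by apply/Z.mod_divide => //; lia.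
  have -> : IZR k / INR Q = IZR m by rewrite Em mult_IZR -INR_IZR_INZ; field.
  exact: e_Z.
apply: e_sum_zero; last first.
  by have -> : INR Q * (IZR k / INR Q) = IZR k by [field]; rewrite e_Z.
move=> /e_eq1_Z [m Em]; apply: H.
have E : IZR k = IZR (m * Z.of_nat Q) by rewrite mult_IZR -INR_IZR_INZ -Em; field.
by rewrite (eq_IZR _ _ E) Z.mod_mul //; lia.
Qed.

(** A character as it occurs in sums over natural numbers. The square of such a function is of the
    same kind, and [nc_norm] recovers the dichotomy between the value 0 and modulus 1. *)
Record nat_character (Q : nat) (f : nat -> C) : Prop := {
  nc_pos : (0 < Q)%N;
  nc_one : f 1%N = RtoC 1;
  nc_mul : forall m n, f (m * n)%N = (f m * f n)%C;
  nc_per : forall n, f (n + Q)%N = f n }.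

Lemma dirichlet_nat_character (q : Z) (chi : Z -> C) : dirichlet_character q chi ->
  nat_character (Z.to_nat q) (fun n => chi (Z.of_nat n)).
Proof.
move=> [hq hper hmul hsup]; split.
- by apply/ltP; lia.
- have n1 : chi 1%Z <> RtoC 0 by apply/hsup; apply: Z.gcd_1_l.
  have := hmul 1%Z 1%Z; rewrite Z.mul_1_l => E.
  have : (chi 1%Z * (chi 1%Z - 1))%C = RtoC 0 by rewrite Cmult_plus_distr_l -E; ring.
  case/Cmult_integral => // E1.
  have -> : chi (Z.of_nat 1) = ((chi 1%Z - 1) + 1)%C by rewrite /=; ring.
  by rewrite E1 Cplus_0_l.
- by move=> m n; rewrite -multE Nat2Z.inj_mul.
- by move=> n; rewrite -plusE Nat2Z.inj_add Z2Nat.id ?hper //; lia.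
Qed.

Lemma nc_per_mul (Q : nat) (f : nat -> C) (n k : nat) :
  (forall n, f (n + Q)%N = f n) -> f (n + k * Q)%N = f n.
Proof.
move=> H; elim: k => [|k IH]; first by rewrite mul0n addn0.
by rewrite mulSn [(Q + _)%N]addnC addnA H.
Qed.

Lemma nc_modn (Q : nat) (f : nat -> C) (n : nat) :
  (forall n, f (n + Q)%N = f n) -> f (n %% Q) = f n.
Proof. by move=> H; rewrite [in RHS](divn_eq n Q) addnC nc_per_mul. Qed.

Lemma nc_pow (Q : nat) (f : nat -> C) (n k : nat) : nat_character Q f ->
  f (expn n k) = Cpow (f n) k.
Proof.
move=> H; elim: k => [|k IH]; first by rewrite expn0 (nc_one _ _ H).
by rewrite expnS (nc_mul _ _ H) IH.
Qed.

(* By pigeonhole two powers of [n] agree modulo [Q], so a nonzero value is a root of unity. *)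
Lemma nc_norm (Q : nat) (f : nat -> C) (n : nat) : nat_character Q f ->
  f n = RtoC 0 \/ Cmod (f n) = 1.
Proof.
move=> H; case: (Req_dec (Cmod (f n)) 0) => [/Cmod_eq_0|ne]; [by left | right].
have fn0 : f n <> RtoC 0 by move=> E; apply: ne; rewrite E Cmod_0.
have hQ := nc_pos _ _ H.
have [i [j [ij E]]] : exists i j : nat, (i < j)%N /\ (expn n i) %% Q = (expn n j) %% Q.
  pose g (i : 'I_Q.+1) : 'I_Q := Ordinal (ltn_pmod (expn n i) hQ).
  have : ~~ injectiveb g.
    by apply/injectiveP => /leq_card; rewrite !card_ord ltnn.
  move=> /injectivePn [x [y xy /(congr1 val) /= E]].
  case: (ltngtP x y) => h; [by exists x, y | by exists y, x | by case/eqP: xy; apply: val_inj].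
have : f (expn n i) = f (expn n j).
  by rewrite -(nc_modn Q f (expn n i)) ?E ?nc_modn //; exact: (nc_per _ _ H).
rewrite !(nc_pow _ _ _ _ H) => E2.
have {}E2 : Cmod (f n) ^ i = Cmod (f n) ^ i * Cmod (f n) ^ (j - i).
  by rewrite -pow_add plusE (subnKC (ltnW ij)) -!Cmod_pow E2.
have c0 : 0 < Cmod (f n) by apply/Cmod_gt_0.
have p0 : 0 < Cmod (f n) ^ i by apply: pow_lt.
have E3 : Cmod (f n) ^ (j - i) = 1.
  by apply: (Rmult_eq_reg_l (Cmod (f n) ^ i)); lra.
have k0 : (j - i)%N <> 0%N by move/eqP; rewrite subn_eq0 leqNgt ij.
case: (Rtotal_order (Cmod (f n)) 1) => [lt|[//|gt]]; exfalso.
  have := pow_lt_1_compat (Cmod (f n)) (j - i) ltac:(lra) ltac:(lia); lra.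
by have := Rlt_pow_R1 (Cmod (f n)) (j - i) ltac:(lra) ltac:(lia); lra.
Qed.

Lemma nc_le1 (Q : nat) (f : nat -> C) (n : nat) : nat_character Q f -> Cmod (f n) <= 1.
Proof. by move=> /nc_norm -/(_ n) [->|->]; rewrite ?Cmod_0; lra. Qed.

Lemma periodic_window (Q : nat) (g : nat -> C) (n : nat) : (forall n, g (n + Q)%N = g n) ->
  \sumC_(n <= d < n + Q) g d = \sumC_(0 <= d < Q) g d.
Proof.
move=> H; elim: n => [|n IH]; first by rewrite add0n.
rewrite -IH addSn.
have A : \sumC_(n <= d < (n + Q).+1) g d = ((\sumC_(n <= d < n + Q) g d) + g n)%C.
  by rewrite big_nat_recr ?leq_addr //= H.
have B : \sumC_(n <= d < (n + Q).+1) g d = (g n + \sumC_(n.+1 <= d < (n + Q).+1) g d)%C.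
  by rewrite big_ltn // ltnS leq_addr.
have -> : \sumC_(n.+1 <= d < (n + Q).+1) g d = (g n + (\sumC_(n.+1 <= d < (n + Q).+1) g d) - g n)%C by ring.
by rewrite -B A; ring.
Qed.

(** A complete period sums to zero, so periods are removed until fewer than Q terms remain. The
    extra B pays for index 0, which belongs to a period but not to the sums starting at 1. *)
Lemma periodic_bounded (Q : nat) (g : nat -> C) (B : R) : (0 < Q)%N ->
  (forall n, g (n + Q)%N = g n) -> (forall n, Cmod (g n) <= B) ->
  \sumC_(0 <= d < Q) g d = RtoC 0 -> bounded_sums g (B * INR Q + B).
Proof.
move=> hQ H hB H0 n.
have S m : Cmod (\sumC_(0 <= d < m) g d) <= B * INR Q.
  have [k] := ubnP m; elim: k m => // k IH m mk.
  case: (leqP Q m) => Qm.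
    rewrite (Csum_split g 0 (m - Q) m) ?leq_subr //.
    have W := periodic_window Q g (m - Q) H; rewrite subnK // H0 in W.
    rewrite W Cplus_0_r; apply: IH.
    rewrite ltnS in mk; apply: leq_trans mk; rewrite ltn_subrL hQ /=.
    exact: leq_trans hQ Qm.
  apply: (Rle_trans _ _ _ (Cmod_sum _ _ _ _)).
  apply: (Rle_trans _ (\sumR_(0 <= d < m) B)); first by apply: Rsum_le.
  rewrite Rsum_const subn0 Rmult_comm; apply: Rmult_le_compat_l.
    by apply: Rle_trans (hB 0%N); apply: Cmod_ge_0.
  by apply: le_INR; apply/leP; apply: ltnW.
have -> : \sumC_(1 <= d < n.+1) g d = ((\sumC_(0 <= d < n.+1) g d) - g 0%N)%C.
  by rewrite [in RHS]big_ltn //; ring.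
by apply: (Rle_trans _ _ _ (Cmod_triangle_sub _ _)); apply: Rplus_le_compat.
Qed.

Lemma coprime_mulmod_inj (b Q x y : nat) : coprime b Q ->
  ((b * x) %% Q = (b * y) %% Q -> x %% Q = y %% Q)%N.
Proof.
move=> cb; wlog yx : x y / (y <= x)%N => [W E|/eqP].
  by case/orP: (leq_total y x) => h; [apply: W | apply/esym; apply: W].
rewrite eqn_mod_dvd ?leq_mul2l ?yx ?orbT // -mulnBr Gauss_dvdr 1?coprime_sym // => h.
by apply/eqP; rewrite eqn_mod_dvd.
Qed.

(** Multiplication by b permutes the residues, hence multiplies the sum by f b while leaving it
    unchanged. *)
Lemma nc_sum_zero (Q : nat) (f : nat -> C) (b : nat) : nat_character Q f ->
  coprime b Q -> f b <> RtoC 1 -> \sumC_(0 <= d < Q) f d = RtoC 0.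
Proof.
move=> H cb fb.
have hQ := nc_pos _ _ H; have per := nc_per _ _ H.
have E : \sumC_(0 <= d < Q) f d = (f b * \sumC_(0 <= d < Q) f d)%C.
  rewrite big_mkord big_distrr /=.
  pose g (i : 'I_Q) : 'I_Q := Ordinal (ltn_pmod (b * i) hQ).
  have gi : injective g.
    move=> x y /(congr1 val) /= /(coprime_mulmod_inj b Q _ _ cb).
    by rewrite !modn_small // => h; apply: val_inj.
  rewrite (reindex_inj gi) /=; apply: eq_bigr => i _.
  by rewrite nc_modn // (nc_mul _ _ H).
have : ((1 - f b) * \sumC_(0 <= d < Q) f d)%C = RtoC 0.
  by rewrite Cmult_plus_distr_r Cmult_1_l {1}E; ring.
case/Cmult_integral => // E0; case: fb.
by rewrite -(Cplus_0_r (f b)) -E0; ring.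
Qed.

(** Fourier inversion on the residues modulo Q. It writes multiplication of an exponential sum by a
    character as a combination of Q translations by multiples of 1 / Q, with coefficients of modulus
    at most 1. *)
Lemma periodic_fourier (Q : nat) (f : nat -> C) : (0 < Q)%N ->
  (forall n, f (n + Q)%N = f n) -> (forall n, Cmod (f n) <= 1) ->
  exists c : nat -> C, (forall b, Cmod (c b) <= 1) /\
    forall n, f n = \sumC_(0 <= b < Q) (c b * e (INR b * (INR n / INR Q))).
Proof.
move=> hQ per f1.
have Qp : 0 < INR Q by apply: lt_0_INR; apply/ltP.
have Qn : RtoC (INR Q) <> RtoC 0 by move=> /RtoC_inj; lra.
exists (fun b => / RtoC (INR Q) * \sumC_(0 <= a < Q) (f a * e (INR b * (- INR a / INR Q))))%C.
split=> [b|n].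
  rewrite Cmod_mult Cmod_inv // Cmod_R Rabs_pos_eq; last by lra.
  apply: (Rmult_le_reg_l (INR Q)) => //; rewrite -Rmult_assoc Rinv_r ?Rmult_1_l ?Rmult_1_r; last by lra.
  apply: (Rle_trans _ _ _ (Cmod_sum _ _ _ _)).
  apply: (Rle_trans _ (\sumR_(0 <= d < Q) 1)); last by rewrite Rsum_const subn0; lra.
  by apply: Rsum_le => a _; rewrite Cmod_mult Cmod_e Rmult_1_r.
have -> : \sumC_(0 <= b < Q) (/ RtoC (INR Q) * (\sumC_(0 <= a < Q) (f a * e (INR b * (- INR a / INR Q)))) * e (INR b * (INR n / INR Q))) =
  (/ RtoC (INR Q) * \sumC_(0 <= a < Q) (f a * \sumC_(0 <= b < Q) e (INR b * (IZR (Z.of_nat n - Z.of_nat a) / INR Q))))%C.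
  have -> : \sumC_(0 <= a < Q) (f a * \sumC_(0 <= b < Q) e (INR b * (IZR (Z.of_nat n - Z.of_nat a) / INR Q))) =
    \sumC_(0 <= a < Q) \sumC_(0 <= b < Q) (f a * e (INR b * (IZR (Z.of_nat n - Z.of_nat a) / INR Q))).
    by apply: eq_bigr => a _; rewrite big_distrr.
  rewrite exchange_big big_distrr /=; apply: eq_bigr => b _.
  rewrite -Cmult_assoc; congr Cmult; rewrite big_distrl /=; apply: eq_bigr => a _.
  rewrite -Cmult_assoc -e_add; congr Cmult; congr e.
  by rewrite minus_IZR -!INR_IZR_INZ; field; lra.
have -> : \sumC_(0 <= a < Q) (f a * \sumC_(0 <= b < Q) e (INR b * (IZR (Z.of_nat n - Z.of_nat a) / INR Q))) =
  (f n * RtoC (INR Q))%C; last by field.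
rewrite big_mkord (bigD1 (Ordinal (ltn_pmod n hQ))) //= [X in Cplus _ X]big1; last first.
  move=> i ni; rewrite e_sum_div //; case: Z.eqb_spec => h; last by ring.
  case/eqP: ni; apply: val_inj => /=.
  have hi := ltn_ord i; have := ltP hi; move: (nat_of_ord i) h hi => {i} i h hi hi'.
  have [k Ek] : (Z.of_nat Q | Z.of_nat n - Z.of_nat i)%Z by apply/Z.mod_divide => //; move/ltP: hQ; lia.
  have : (n %% Q)%N = (i %% Q)%N; last by rewrite [(i %% _)%N]modn_small.
  case: (Z_le_gt_dec 0 k) => hk.
    have -> : n = (Z.to_nat k * Q + i)%N by rewrite -plusE -multE; lia.
    by rewrite modnMDl.
  have -> : i = (Z.to_nat (- k) * Q + n)%N by rewrite -plusE -multE; lia.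
  by rewrite modnMDl.
rewrite Cplus_0_r nc_modn //; congr Cmult.
rewrite e_sum_div //.
have -> // : (Z.modulo (Z.of_nat n - Z.of_nat (n %% Q)) (Z.of_nat Q) =? 0)%Z = true.
apply/Z.eqb_spec; apply/Z.mod_divide; first by move/ltP: hQ; lia.
exists (Z.of_nat (n %/ Q)); rewrite {1}(divn_eq n Q) -plusE -multE; lia.
Qed.

(** * Divisor sums and prime counts *)

(** Replaces the list of prime factors, which depends on n, by one common range, so that complete
    additivity holds term by term. *)
Lemma bigOmega_range (n N : nat) : (0 < n)%N -> (n < N)%N ->
  bigOmega n = (\sum_(0 <= p < N) logn p n)%N.
Proof.
move=> n0 nN; rewrite /bigOmega.
rewrite [RHS](bigID (mem (primes n))) /= [X in addn _ X]big1 ?addn0; last first.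
  move=> p; rewrite mem_primes n0 /= => h.
  by rewrite lognE n0; case: (prime p) h => //= /negbTE ->.
rewrite -[RHS]big_filter; apply: perm_big; apply: uniq_perm.
- exact: primes_uniq.
- by rewrite filter_uniq // iota_uniq.
- move=> p; rewrite mem_filter mem_index_iota leq0n /=.
  case hp : (p \in primes n) => //=; apply/esym; apply: leq_ltn_trans nN.
  by move: hp; rewrite mem_primes => /and3P[_ _ /dvdn_leq]; apply.
Qed.

Lemma bigOmega_mul (m n : nat) : (0 < m)%N -> (0 < n)%N ->
  bigOmega (m * n) = (bigOmega m + bigOmega n)%N.
Proof.
move=> m0 n0; set N := (m * n).+1.
rewrite (bigOmega_range (m * n) N) ?muln_gt0 ?m0 //.
rewrite (bigOmega_range m N) // ?(bigOmega_range n N) // ?ltnS ?leq_pmulr ?leq_pmull //.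
by rewrite -big_split; apply: eq_bigr => p _; rewrite lognM.
Qed.

Definition completely_multiplicative (c : nat -> R) : Prop :=
  c 1%N = 1 /\ forall m n, (0 < m)%N -> (0 < n)%N -> c (m * n)%N = c m * c n.

Lemma liouville_cm : completely_multiplicative liouville.
Proof.
split=> [|m n m0 n0]; first by rewrite /liouville /bigOmega big_nil.
by rewrite /liouville bigOmega_mul // pow_add.
Qed.

Lemma liouville_prime (p : nat) : prime p -> liouville p = -1.
Proof.
move=> hp; rewrite /liouville /bigOmega.
rewrite primes_prime // big_seq1 logn_prime // eqxx /=; ring.
Qed.

Definition divisor_sum (c : nat -> R) (n : nat) : R := \sumR_(d <- divisors n) c d.

Lemma divisor_sum_prime_mul (c : nat -> R) (p n : nat) : completely_multiplicative c ->
  prime p -> (0 < n)%N ->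
  divisor_sum c (p * n) =
    (\sumR_(d <- divisors n | ~~ (p %| d)) c d) + c p * divisor_sum c n.
Proof.
move=> [_ cM] pp n0; have p0 := prime_gt0 pp.
have pn0 : (0 < p * n)%N by rewrite muln_gt0 p0.
rewrite /divisor_sum (bigID (fun d => p %| d)) /= Rplus_comm; congr Rplus.
  rewrite -big_filter -[in RHS]big_filter; apply: perm_big; apply: uniq_perm; rewrite ?filter_uniq ?divisors_uniq //.
  move=> d; rewrite !mem_filter -!dvdn_divisors //.
  case pd : (p %| d) => //=; rewrite Gauss_dvdr //.
  by rewrite coprime_sym prime_coprime // pd.
rewrite big_distrr /= -big_filter.
have -> : \sumR_(i <- divisors n) (c p * c i) = \sumR_(i <- [seq (p * d)%N | d <- divisors n]) c i.
  rewrite big_map big_seq [in RHS]big_seq; apply: eq_bigr => d.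
  by rewrite -dvdn_divisors // => dn; rewrite cM ?(dvdn_gt0 n0 dn).
apply: perm_big; apply: uniq_perm; rewrite ?filter_uniq ?divisors_uniq //.
  rewrite map_inj_uniq ?divisors_uniq // => x y /eqP.
  by rewrite eqn_pmul2l // => /eqP.
move=> d; rewrite mem_filter -dvdn_divisors //; apply/andP/mapP.
  move=> [/dvdnP [k ->] h]; exists k; last by rewrite mulnC.
  by rewrite -dvdn_divisors // -(dvdn_pmul2l p0) mulnC.
move=> [k]; rewrite -dvdn_divisors // => h ->; split; first exact: dvdn_mulr.
by rewrite dvdn_pmul2l.
Qed.

Lemma divisor_sum_coprime_part (c : nat -> R) (p m k : nat) : prime p -> (0 < m)%N -> ~~ (p %| m) ->
  \sumR_(d <- divisors (expn p k * m) | ~~ (p %| d)) c d = divisor_sum c m.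
Proof.
move=> pp m0 pm; rewrite /divisor_sum -big_filter; apply: perm_big.
have n0 : (0 < expn p k * m)%N by rewrite muln_gt0 expn_gt0 prime_gt0.
apply: uniq_perm; rewrite ?filter_uniq ?divisors_uniq // => d.
rewrite mem_filter -!dvdn_divisors //; apply/andP/idP.
  move=> [pd]; rewrite Gauss_dvdr //; apply: coprimeXr.
  by rewrite coprime_sym prime_coprime.
move=> dm; split; last exact: dvdn_mull.
by apply: contra pm => /dvdn_trans; apply.
Qed.

(* Divisors of [p * n] prime to [p] are those of [n], and the others are [p] times a divisor
   of [n]; hence the geometric recursion in [k]. *)
Lemma divisor_sum_prime_power (c : nat -> R) (p m k : nat) : completely_multiplicative c ->
  prime p -> (0 < m)%N -> ~~ (p %| m) ->
  divisor_sum c (expn p k * m) = divisor_sum c m * \sumR_(0 <= i < k.+1) (c p ^ i).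
Proof.
move=> hc pp m0 pm; elim: k => [|k IH].
  by rewrite expn0 mul1n big_nat1 /=; ring.
rewrite expnS -mulnA divisor_sum_prime_mul //; last by rewrite muln_gt0 expn_gt0 prime_gt0.
rewrite divisor_sum_coprime_part // IH [in RHS]big_nat_recl //=.
rewrite Rmult_plus_distr_l Rmult_1_r; congr Rplus.
by rewrite -[in RHS]big_distrr /=; ring.
Qed.

Lemma prime_power_induction (P : nat -> Prop) :
  P 1%N ->
  (forall p k m, prime p -> (0 < k)%N -> (0 < m)%N -> ~~ (p %| m) -> P m -> P (expn p k * m)%N) ->
  forall n, (0 < n)%N -> P n.
Proof.
move=> P1 PS n; have [N] := ubnP n; elim: N n => // N IH n nN n0.
case: (ltngtP n 1) => [|n1|->] //; first by rewrite ltnS leqn0 => /eqP E; rewrite E in n0.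
have pp := pdiv_prime n1; set p := pdiv n in pp.
have E := partnC p n0; rewrite p_part in E.
have k0 : (0 < logn p n)%N by rewrite logn_gt0 mem_primes pp n0 pdiv_dvd.
rewrite -E; apply: PS => //.
  by rewrite -prime_coprime // (pnat_coprime (pnat_id pp)) // part_pnat.
apply: IH; last exact: part_gt0.
rewrite -ltnS; apply: leq_trans nN; rewrite ltnS -{2}E ltn_Pmull ?part_gt0 //.
by rewrite -{1}(expn0 p) ltn_exp2l // prime_gt1.
Qed.

Lemma logn_square (p j : nat) : (0 < j)%N -> logn p (j * j) = (logn p j).*2.
Proof. by move=> j0; rewrite lognM // addnn. Qed.

Lemma square_prime_power (p k m j : nat) : prime p -> (0 < m)%N -> ~~ (p %| m) ->
  (expn p k * m = j * j)%N -> exists i l, k = i.*2 /\ (m = l * l)%N.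
Proof.
move=> pp m0 pm E.
have j0 : (0 < j)%N by case: (j) E => // /eqP; rewrite muln_eq0 expn_eq0; case: (p) pp => // p' _ /=; rewrite (gtn_eqF m0).
have pmE : logn p m = 0%N by apply/eqP; rewrite -leqn0 leqNgt logn_gt0 mem_primes pp m0.
exists (logn p j), (j`_p^')%N; split.
  by rewrite -logn_square // -E lognM // ?expn_gt0 ?prime_gt0 // pfactorK // pmE addn0.
rewrite -partnM // -E partnM ?expn_gt0 ?(prime_gt0 pp) //.
rewrite part_p'nat; last by rewrite pnatNK pnatX pnat_id.
by rewrite mul1n part_pnat_id // p'natE.
Qed.

Lemma sum_powers_m1 (k : nat) : \sumR_(0 <= i < k.+1) ((-1) ^ i) = if odd k then 0 else 1.
Proof.
elim: k => [|k IH]; first by rewrite big_nat1.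
rewrite big_nat_recr //= IH; case ok : (odd k) => /=.
  by rewrite -(odd_double_half k) ok -mul2n -multE -plusE /= pow_1_even; ring.
by rewrite -(odd_double_half k) ok -mul2n add0n -multE pow_1_even; ring.
Qed.

Lemma divisor_sum_1 (c : nat -> R) : c 1%N = 1 -> divisor_sum c 1 = 1.
Proof. by move=> E; rewrite /divisor_sum /= big_seq1. Qed.

(** The identity that 1 * lambda is the indicator of the squares: the factor at p^k is an
    alternating sum of k + 1 signs, equal to 1 for even k and to 0 for odd k. *)
Lemma divisor_sum_liouville (n : nat) : (0 < n)%N ->
  (exists j, (n = j * j)%N /\ divisor_sum liouville n = 1) \/
  (~ (exists j, (n = j * j)%N) /\ divisor_sum liouville n = 0).
Proof.
apply: (prime_power_induction (fun n => _ \/ _)).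
  by left; exists 1%N; split => //; apply: divisor_sum_1; case: liouville_cm.
move=> p k m pp k0 m0 pm IH.
rewrite divisor_sum_prime_power //; last exact: liouville_cm.
rewrite liouville_prime // sum_powers_m1; case ok : (odd k).
  right; rewrite Rmult_0_r; split => // -[j /(square_prime_power _ _ _ _ pp m0 pm) [i [l [Ek _]]]].
  by rewrite Ek odd_double in ok.
have Ek : k = k./2.*2 by rewrite -{1}(odd_double_half k) ok.
case: IH => [[l [El ->]]|[nl ->]].
  left; exists (expn p k./2 * l)%N; split; last by ring.
  by rewrite El mulnACA -expnD addnn -Ek.
right; rewrite Rmult_0_l; split => // -[j /(square_prime_power _ _ _ _ pp m0 pm) [i [l [_ El]]]].
by apply: nl; exists l.
Qed.

Lemma sum_powers_ge0 (x : R) (k : nat) : x = 1 \/ x = 0 \/ x = -1 ->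
  0 <= \sumR_(0 <= i < k.+1) (x ^ i) /\ (~~ odd k -> 1 <= \sumR_(0 <= i < k.+1) (x ^ i)).
Proof.
move=> H; have pos : 0 <= x -> 1 <= \sumR_(0 <= i < k.+1) (x ^ i).
  move=> x0; rewrite big_nat_recl //=.
  have := Rsum_ge0 nat (index_iota 0 k) xpredT (fun i => x * x ^ i).
  by move=> h; have := h (fun i _ => Rmult_le_pos _ _ x0 (pow_le _ _ x0)); lra.
case: H pos => [->|[->|->]] pos; try by have h := pos ltac:(lra); split=> [|_]; lra.
by rewrite sum_powers_m1; case: (odd k) => /=; split => //; lra.
Qed.

(** The factor at p^k is k + 1 or 1 when c p is 1 or 0, and alternates between 1 and 0 when c p is
    -1. It is never negative, and it is at least 1 for the even exponents that occur in a square. *)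
Lemma divisor_sum_ge0 (c : nat -> R) (n : nat) : completely_multiplicative c ->
  (forall m, c m = 1 \/ c m = 0 \/ c m = -1) -> (0 < n)%N ->
  0 <= divisor_sum c n /\ ((exists j, n = j * j)%N -> 1 <= divisor_sum c n).
Proof.
move=> hc h3; apply: (prime_power_induction (fun n => _ /\ _)).
  by rewrite divisor_sum_1; [split => *; lra | case: hc].
move=> p k m pp k0 m0 pm [IH1 IH2].
rewrite divisor_sum_prime_power //.
have [s0 s1] := sum_powers_ge0 (c p) k (h3 p).
split; first by apply: Rmult_le_pos.
move=> [j /(square_prime_power _ _ _ _ pp m0 pm) [i [l [Ek El]]]].
have := IH2 (ex_intro _ l El); have : ~~ odd k by rewrite Ek odd_double.
move=> /s1; nra.
Qed.

Lemma big_multiples (T : Type) (idx : T) (op : Monoid.com_law idx) (m N : nat) (H : nat -> T) :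
  (0 < m)%N ->
  \big[op/idx]_(1 <= n < N.+1 | m %| n) H n = \big[op/idx]_(1 <= d < (N %/ m).+1) H (m * d)%N.
Proof.
move=> m0.
transitivity (\big[op/idx]_(i <- [seq (m * d)%N | d <- index_iota 1 (N %/ m).+1]) H i); last by rewrite big_map.
rewrite -big_filter; apply: perm_big; apply: uniq_perm.
- by rewrite filter_uniq // iota_uniq.
- rewrite map_inj_uniq ?iota_uniq // => x y /eqP.
  by rewrite eqn_pmul2l // => /eqP.
move=> n; rewrite mem_filter mem_index_iota; apply/andP/mapP.
  move=> [/dvdnP [k ->] /andP [k0 kN]]; exists k; last by rewrite mulnC.
  rewrite mem_index_iota ltnS leq_divRL //; rewrite ltnS in kN.
  by move: k0; rewrite muln_gt0 kN => /andP[->].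
move=> [k]; rewrite mem_index_iota ltnS leq_divRL // => /andP [k0 kN] ->.
by rewrite dvdn_mulr // ltnS mulnC kN muln_gt0 k0 m0.
Qed.

Lemma divisor_sum_range (c : nat -> R) (n N : nat) : (0 < n)%N -> (n <= N)%N ->
  divisor_sum c n = \sumR_(1 <= m < N.+1 | m %| n) c m.
Proof.
move=> n0 nN; rewrite /divisor_sum -[RHS]big_filter; apply: perm_big; apply: uniq_perm.
- exact: divisors_uniq.
- by rewrite filter_uniq // iota_uniq.
move=> d; rewrite mem_filter mem_index_iota -dvdn_divisors //; case dn : (d %| n) => //=.
by rewrite ltnS (dvdn_gt0 n0 dn) (leq_trans (dvdn_leq n0 dn) nN).
Qed.

Lemma divisor_sum_convolution (c : nat -> R) (G : nat -> C) (N : nat) :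
  \sumC_(1 <= m < N.+1) (RtoC (c m) * \sumC_(1 <= d < (N %/ m).+1) G (m * d)%N) =
  \sumC_(1 <= n < N.+1) (RtoC (divisor_sum c n) * G n).
Proof.
transitivity (\sumC_(1 <= m < N.+1) \sumC_(1 <= n < N.+1 | m %| n) (RtoC (c m) * G n)).
  rewrite big_nat [RHS]big_nat; apply: eq_bigr => m /andP[m0 _].
  by rewrite -big_multiples // big_distrr.
rewrite (exchange_big_dep xpredT) //= big_nat [RHS]big_nat; apply: eq_bigr => n /andP[n0 nN].
by rewrite (divisor_sum_range c n N) // RtoC_sum big_distrl.
Qed.

(** Summed form of the previous identity, for an arbitrary function of the product m d. It is what
    evaluates [Msum] as a sum over squares. *)
Lemma liouville_convolution (G : nat -> C) (N : nat) :
  \sumC_(1 <= m < N.+1) (RtoC (liouville m) * \sumC_(1 <= d < (N %/ m).+1) G (m * d)%N) =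
  \sumC_(1 <= k < N.+1 | (k * k <= N)%N) G (k * k)%N.
Proof.
rewrite divisor_sum_convolution.
transitivity (\sumC_(1 <= n < N.+1) \sumC_(1 <= k < N.+1 | (k * k == n)%N) G (k * k)%N).
  rewrite big_nat [RHS]big_nat; apply: eq_bigr => n /andP[n0]; rewrite ltnS => nN.
  case: (divisor_sum_liouville n n0) => [[j [Ej ->]]|[nj ->]].
    have j0 : (0 < j)%N by rewrite lt0n; apply: contraTneq n0 => j0; rewrite Ej j0.
    have jN : (j < N.+1)%N by rewrite ltnS; apply: leq_trans nN; rewrite Ej leq_pmulr.
    rewrite Cmult_1_l (eq_bigl (fun k => k == j)).
      by rewrite big_nat1_eq j0 jN -Ej.
    by move=> k; rewrite /= Ej !mulnn eqn_sqr.
  rewrite Cmult_0_l big1 // => k /eqP E; case: nj; by exists k.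
rewrite (exchange_big_dep_nat (fun k => (k * k <= N)%N)) /=; last first.
  by move=> n k /andP[_ nN] _ _ /eqP ->; rewrite -ltnS.
rewrite big_nat_cond [RHS]big_nat_cond; apply: eq_bigr => k /andP[/andP[k0 kN] kkN].
rewrite (eq_bigl (fun n => n == (k * k)%N)); last by move=> n; rewrite eq_sym.
by rewrite big_nat1_eq ltnS kkN muln_gt0 k0.
Qed.

(** * A lower bound of Chebyshev type for the number of primes *)

Definition prime_count (N : nat) : nat := count prime (iota 0 N.+1).

(** By Legendre's formula the exponent is a sum over k of floor(2n / p^k) - 2 floor(n / p^k). Each
    term is 0 or 1 and vanishes once p^k > 2n, so at most log_p(2n) terms count. *)
Lemma logn_central_bin (p n : nat) : prime p -> (0 < n)%N ->
  (expn p (logn p 'C(2 * n, n)) <= 2 * n)%N.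
Proof.
move=> pp n0; have p1 := prime_gt1 pp.
have n20 : (0 < 2 * n)%N by rewrite muln_gt0.
suff H : (logn p 'C(2 * n, n) <= trunc_log p (2 * n))%N.
  by apply: leq_trans (trunc_logP p1 n20); rewrite leq_exp2l.
have nn : (n <= 2 * n)%N by rewrite leq_pmull.
have b0 : (0 < 'C(n.*2, n))%N by rewrite bin_gt0 -addnn leq_addr.
have := bin_fact nn; rewrite mul2n -{2}addnn addnK => /(congr1 (logn p)).
rewrite !lognM ?muln_gt0 ?fact_gt0 // !logn_fact // => E.
have S : (\sum_(1 <= k < n.+1) n %/ p ^ k = \sum_(1 <= k < n.*2.+1) n %/ p ^ k)%N.
  rewrite [RHS](big_cat_nat (n := n.+1)) //=; last by rewrite ltnS -mul2n.
  rewrite [X in (_ + X)%N]big_nat [X in (_ + X)%N]big1 ?addn0 // => k /andP[nk _].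
  rewrite divn_small //; apply: leq_trans nk _; apply: ltnW; exact: ltn_expl.
have {S}E : (logn p 'C(n.*2, n) = \sum_(1 <= k < n.*2.+1) (n.*2 %/ p ^ k - (n %/ p ^ k + n %/ p ^ k)))%N.
  rewrite sumnB; last first.
    move=> k _; rewrite leq_divRL ?expn_gt0 ?prime_gt0 // mulnDl -addnn.
    by apply: leq_add; apply: leq_divM.
  by rewrite big_split /= -S -E addnK.
set T := trunc_log p n.*2 in E *.
have n2p : (0 < n.*2)%N by rewrite double_gt0.
have TM : (T < n.*2.+1)%N.
  by rewrite ltnS; apply: ltnW; apply: leq_trans (trunc_logP p1 n2p); apply: ltn_expl.
rewrite E.
apply: (@leq_trans (\sum_(1 <= k < n.*2.+1) (k <= T)%N)).
  apply: leq_sum => k _.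
  have pk : (0 < expn p k)%N by rewrite expn_gt0 prime_gt0.
  case kT : (k <= T)%N => /=.
    rewrite leq_subLR -ltnS ltn_divLR // -addnn {1 2}(divn_eq n (expn p k)).
    have := ltn_pmod n pk; move: (n %% _)%N (n %/ _)%N => r q rp.
    rewrite addn1 !mulSn mulnDl addnACA [X in (_ < X)%N]addnA addnC.
    by rewrite ltn_add2r -addSn leq_add // ltnW.
  rewrite divn_small ?sub0n //.
  move/negbT: kT; rewrite -ltnNge => kT.
  by apply: leq_trans (trunc_log_ltn _ p1) _; rewrite leq_exp2l.
rewrite (big_cat_nat (n := T.+1)) //= [X in (_ + X)%N]big_nat [X in (_ + X)%N]big1 ?addn0; last first.
  by move=> k /andP[Tk _]; rewrite leqNgt Tk.
apply: (@leq_trans (\sum_(1 <= k < T.+1) 1)%N); first by apply: leq_sum => k _; exact: leq_b1.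
by rewrite sum_nat_const_nat subn1 muln1.
Qed.

Lemma central_bin_ge (n : nat) : (expn 2 n <= 'C(n.*2, n))%N.
Proof.
elim: n => [|n IH]; first by rewrite bin0.
rewrite doubleS binS.
have -> : 'C(n.*2.+1, n.+1) = 'C(n.*2.+1, n).
  have nn : (n <= n.*2.+1)%N by rewrite leqW // -addnn leq_addr.
  by rewrite -(bin_sub nn) subSn -?addnn ?addnK ?leq_addr.
rewrite addnn expnS mul2n leq_double; apply: leq_trans IH _.
by case: n => // n; rewrite [in X in (_ <= X)%N]binS leq_addr.
Qed.

Lemma central_bin_le (n : nat) : (0 < n)%N -> ('C(n.*2, n) <= expn n.*2 (prime_count n.*2))%N.
Proof.
move=> n0.
have b0 : (0 < 'C(n.*2, n))%N by rewrite bin_gt0 -addnn leq_addr.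
rewrite {1}(prod_prime_decomp b0) prime_decompE big_map /=.
apply: (@leq_trans (\prod_(p <- primes 'C(n.*2, n)) n.*2)).
  rewrite big_seq [X in (_ <= X)%N]big_seq; apply: leq_prod => p.
  by rewrite mem_primes => /and3P[pp _ _]; have := logn_central_bin p n pp n0; rewrite mul2n.
rewrite big_const_seq count_predT iter_muln_1 leq_pexp2l ?double_gt0 //.
rewrite /prime_count -size_filter; apply: uniq_leq_size; first exact: primes_uniq.
move=> p pC; have := pC; rewrite mem_primes => /and3P[pp _ _].
rewrite mem_filter pp mem_iota add0n ltnS /=.
have := logn_central_bin p n pp n0; rewrite mul2n; apply: leq_trans.
rewrite -{1}(expn1 p) leq_exp2l ?prime_gt1 //.
by rewrite logn_gt0.
Qed.

Lemma INR_expn (m k : nat) : INR (expn m k) = INR m ^ k.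
Proof. by elim: k => //= k IH; rewrite expnS -multE mult_INR IH. Qed.

Lemma ln_pow_nat (x : R) (k : nat) : 0 < x -> ln (x ^ k) = INR k * ln x.
Proof.
move=> hx; elim: k => [|k IH]; first by rewrite /= ln_1; ring.
by rewrite -tech_pow_Rmult ln_mult ?IH ?S_INR; [ring | | apply: pow_lt].
Qed.

(** Logarithms of 2^n <= C(2n, n) <= (2n)^pi(2n); on the right each prime power in the binomial
    coefficient is at most 2n. *)
Lemma chebyshev_lower (n : nat) : (0 < n)%N ->
  INR n * ln 2 <= INR (prime_count n.*2) * ln (INR n.*2).
Proof.
move=> n0.
have h2 : 0 < INR n.*2 by apply: lt_0_INR; apply/ltP; rewrite double_gt0.
rewrite -!ln_pow_nat //; last by lra.
apply: ln_le; first by apply: pow_lt; lra.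
have -> : 2 = INR 2 by rewrite /=; ring.
rewrite -!INR_expn; apply: le_INR; apply/leP.
by apply: leq_trans (central_bin_ge n) (central_bin_le n n0).
Qed.

(** * Euler products and non-vanishing *)

(** These properties, unlike periodicity, survive the twist by n^(-i t) that moves a point of the
    line Re s = 1 to the real axis. *)
Record cmult (f : nat -> C) : Prop := {
  cm_one : f 1%N = RtoC 1;
  cm_mul : forall m n, (0 < m)%N -> (0 < n)%N -> f (m * n)%N = (f m * f n)%C;
  cm_le1 : forall n, (0 < n)%N -> Cmod (f n) <= 1 }.

(* Bounds [sum_(d > m) d^(-sigma)]; the value at [m = 0] bounds the whole series. *)
Definition zeta_tail (sigma : R) (m : nat) : R :=
  if m is 0%N then 1 + / (sigma - 1) else Rpower (INR m) (1 - sigma) / (sigma - 1).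

Lemma INR_pos (d : nat) : (0 < d)%N -> 0 < INR d.
Proof. by move=> /ltP/lt_0_INR. Qed.

Lemma Rpower_le_neg (x y a : R) : 0 < x <= y -> 0 <= a -> Rpower y (- a) <= Rpower x (- a).
Proof.
move=> [hx hxy] ha; rewrite /Rpower; apply: exp_le_exp.
have := ln_le x y hx hxy; nra.
Qed.

Lemma is_derive_Rpower (x a : R) : 0 < x ->
  is_derive (fun y => Rpower y a) x (a * Rpower x (a - 1)).
Proof. by move=> hx; apply/is_derive_Reals; apply: derivable_pt_lim_power. Qed.

Lemma Rpower_telescope (sigma : R) (d : nat) : 1 < sigma -> (0 < d)%N ->
  Rpower (INR d.+1) (- sigma) <=
    Rpower (INR d) (1 - sigma) / (sigma - 1) - Rpower (INR d.+1) (1 - sigma) / (sigma - 1).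
Proof.
move=> hs hd; have d0 := INR_pos d hd.
have := cderive_bound (fun t => RtoC (t * Rpower (INR d.+1) (- sigma))) (fun t => RtoC (Rpower (INR d.+1) (- sigma)))
  (fun t => - (Rpower t (1 - sigma) / (sigma - 1))) (fun t => Rpower t (- sigma)) (INR d) (INR d.+1)
  ltac:(rewrite S_INR; lra).
have ES : INR d.+1 - INR d = 1 by rewrite S_INR; ring.
rewrite -RtoC_minus -Rmult_minus_distr_r ES Rmult_1_l Cmod_R Rabs_pos_eq; last by left; apply: exp_pos.
set l := Rpower _ (- sigma) => H.
have {}H : l <= - (Rpower (INR d.+1) (1 - sigma) / (sigma - 1)) - - (Rpower (INR d) (1 - sigma) / (sigma - 1)).
  apply: H => t ht.
  - apply: cderive_RtoC; have := is_derive_scal_l (fun x => x) t 1 l (is_derive_id t).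
    by rewrite /scal /= /mult /= Rmult_1_l.
  - have -> : Rpower t (- sigma) = - / (sigma - 1) * ((1 - sigma) * Rpower t (1 - sigma - 1)).
      by have -> : 1 - sigma - 1 = - sigma by [ring]; field; lra.
    apply: (is_derive_ext (fun x => - / (sigma - 1) * Rpower x (1 - sigma))).
      by move=> x; have E' : forall a b : R, - a * b = - (b * a) by [move=> a b; ring]; apply: E'.
    by apply: is_derive_scal; apply: is_derive_Rpower; lra.
  - by apply: Rpower_le_neg; lra.
lra.
Qed.

Lemma Rpower_1_l (a : R) : Rpower 1 a = 1.
Proof. by rewrite /Rpower ln_1 Rmult_0_r exp_0. Qed.

Lemma zeta_tail_bound (sigma : R) (m n : nat) : 1 < sigma -> (m <= n)%N ->
  \sumR_(m.+1 <= d < n.+1) Rpower (INR d) (- sigma) <= zeta_tail sigma m.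
Proof.
move=> hs.
have pos : (0 < m <= n)%N -> \sumR_(m.+1 <= d < n.+1) Rpower (INR d) (- sigma) <= Rpower (INR m) (1 - sigma) / (sigma - 1).
  move=> /andP[m0 mn].
  rewrite big_add1 /=.
  apply: (Rle_trans _ (\sumR_(m <= d < n) (Rpower (INR d) (1 - sigma) / (sigma - 1) - Rpower (INR d.+1) (1 - sigma) / (sigma - 1)))).
    apply: Rsum_le_nat => d /andP[md _]; apply: Rpower_telescope => //.
    exact: leq_trans md.
  rewrite (Rsum_telescope (fun d => Rpower (INR d) (1 - sigma) / (sigma - 1))) //.
  have : 0 <= Rpower (INR n) (1 - sigma) / (sigma - 1); last by lra.
  by apply: Rdiv_le_0_compat; [left; apply: exp_pos | lra].
case: m pos => [|m] pos mn; last by apply: pos.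
have ip : 0 < / (sigma - 1) by apply: Rinv_0_lt_compat; lra.
case: n pos mn => [|n] pos mn; first by rewrite big_geq //=; lra.
rewrite big_ltn //= Rpower_1_l; apply: Rplus_le_compat_l.
rewrite big_add1 /=.
apply: (Rle_trans _ (\sumR_(1 <= d < n.+1) (Rpower (INR d) (1 - sigma) / (sigma - 1) - Rpower (INR d.+1) (1 - sigma) / (sigma - 1)))).
  by apply: Rsum_le_nat => d /andP[md _]; apply: Rpower_telescope.
rewrite (Rsum_telescope (fun d => Rpower (INR d) (1 - sigma) / (sigma - 1))) // [INR 1]/= Rpower_1_l /Rdiv Rmult_1_l.
have : 0 <= Rpower (INR n.+1) (1 - sigma) * / (sigma - 1); last by lra.
by apply: Rmult_le_pos; [left; apply: exp_pos | lra].
Qed.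

Lemma zeta_tail_lim (sigma : R) : 1 < sigma -> is_lim_seq (zeta_tail sigma) 0.
Proof.
move=> hs; apply/is_lim_seq_incr_1.
apply: (is_lim_seq_ext (fun n => / (sigma - 1) * Rpower (INR n.+1) (- (sigma - 1)))).
  move=> n; rewrite /zeta_tail; have -> : 1 - sigma = - (sigma - 1) by ring.
  by rewrite Rmult_comm.
have := is_lim_seq_scal_l _ (/ (sigma - 1)) _ (is_lim_seq_Rpower_neg (sigma - 1) ltac:(lra)).
by rewrite /= Rmult_0_r.
Qed.

Lemma dser_abs_bound (f : nat -> C) (s : C) (P : pred nat) (m n : nat) :
  (forall n, (0 < n)%N -> Cmod (f n) <= 1) -> 1 < Re s -> (m <= n)%N ->
  Cmod (\sumC_(m.+1 <= d < n.+1 | P d) (f d * cpow (INR d) (- s))) <= zeta_tail (Re s) m.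
Proof.
move=> f1 hs mn.
apply: (Rle_trans _ _ _ (Cmod_sum _ _ _ _)).
apply: (Rle_trans _ (\sumR_(m.+1 <= d < n.+1) Rpower (INR d) (- Re s))); last exact: zeta_tail_bound.
rewrite big_mkcond; apply: Rsum_le_nat => d /andP[md _].
have p0 : 0 < Rpower (INR d) (- Re s) by apply: exp_pos.
case: (P d); last by lra.
rewrite Cmod_mult Cmod_cpow -[Re (- s)%C]/(- Re s).
by have := f1 d (leq_ltn_trans (leq0n m) md); nra.
Qed.

Lemma dser_abs_cv (f : nat -> C) (s : C) :
  (forall n, (0 < n)%N -> Cmod (f n) <= 1) -> 1 < Re s ->
  Ccv (dser f s) (Clim (dser f s)) /\ forall m, Cmod (Clim (dser f s) - dser f s m)%C <= zeta_tail (Re s) m.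
Proof.
move=> f1 hs; apply: Ccv_Clim; last exact: zeta_tail_lim.
move=> m n /leP mn; rewrite /dser Csum_partial_sub //.
by have := dser_abs_bound f s xpredT m n f1 hs mn.
Qed.

(* [n] has no prime factor up to [P]; dividing out the Euler factors up to [P] from a Dirichlet
   series leaves the sum over such [n]. *)
Definition rough (P n : nat) : bool := all (fun q => ~~ (prime q && (q %| n))) (iota 0 P.+1).

Lemma roughS (P n : nat) : rough P.+1 n = rough P n && ~~ (prime P.+1 && (P.+1 %| n)).
Proof. by rewrite /rough -addn1 iotaD all_cat /= andbT. Qed.

Lemma rough_small (P n : nat) : (1 < n <= P)%N -> rough P n = false.
Proof.
move=> /andP[n1 nP]; apply/negbTE/allPn; exists (pdiv n).
  by rewrite mem_iota add0n ltnS (leq_trans (pdiv_leq (ltnW n1)) nP).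
by rewrite negbK pdiv_prime // pdiv_dvd.
Qed.

Lemma rough_1 (P : nat) : rough P 1.
Proof. by apply/allP => q _; rewrite dvdn1; case: eqP => [->|]; rewrite ?andbF. Qed.

Lemma rough_mul_prime (P d : nat) : prime P.+1 -> rough P (P.+1 * d) = rough P d.
Proof.
move=> pp; apply: eq_in_all => q; rewrite mem_iota add0n ltnS => /andP[_ qP].
case pq : (prime q) => //=; rewrite Gauss_dvdr // prime_coprime //.
by rewrite dvdn_prime2 // neq_ltn ltnS qP.
Qed.

Definition euler_factor (f : nat -> C) (s : C) (P : nat) : C :=
  \big[Cmult/RtoC 1]_(0 <= p < P.+1 | prime p) (1 - f p * cpow (INR p) (- s))%C.

Lemma euler_factorS (f : nat -> C) (s : C) (P : nat) :
  euler_factor f s P.+1 = (euler_factor f s P *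
    (if prime P.+1 then 1 - f P.+1 * cpow (INR P.+1) (- s) else RtoC 1))%C.
Proof. by rewrite /euler_factor big_mkcond big_nat_recr //= -big_mkcond. Qed.

Lemma filterlim_divn (p : nat) : (0 < p)%N -> filterlim (fun n => n %/ p)%N eventually eventually.
Proof.
move=> p0 Q [N HN]; exists (N * p)%N => n /leP hn; apply: HN; apply/leP.
by rewrite leq_divRL.
Qed.

(** The sieve of Eratosthenes: for the next prime p, the P-rough multiples of p up to N contribute
    f(p) p^(-s) times the P-rough sum up to N / p. Removing them multiplies the limit by 1 - f(p)
    p^(-s). *)
Lemma rough_sum_lim (f : nat -> C) (s : C) (P : nat) : cmult f -> 1 < Re s ->
  Ccv (fun N => \sumC_(1 <= n < N.+1 | rough P n) (f n * cpow (INR n) (- s)))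
    (Clim (dser f s) * euler_factor f s P)%C.
Proof.
move=> hf hs; elim: P => [|P IH].
  have [cv _] := dser_abs_cv f s (cm_le1 _ hf) hs.
  have -> : (Clim (dser f s) * euler_factor f s 0)%C = Clim (dser f s).
    by rewrite /euler_factor big_mkcond big_nat1 /= Cmult_1_r.
  apply: Ccv_ext cv => N; rewrite /dser; apply: eq_bigl => n.
  by rewrite /rough /=.
rewrite euler_factorS; case pp : (prime P.+1); last first.
  rewrite Cmult_1_r; apply: Ccv_ext IH => N; apply: eq_bigl => n.
  by rewrite roughS pp andbT.
set g := fun n => (f n * cpow (INR n) (- s))%C; rewrite -/(g P.+1).
have L := Ccv_minus _ _ _ _ IH (Ccv_scal (g P.+1) _ _ (Ccv_subseq _ _ _ (filterlim_divn P.+1 (prime_gt0 pp)) IH)).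
have -> : (Clim (dser f s) * (euler_factor f s P * (1 - g P.+1)))%C =
  (Clim (dser f s) * euler_factor f s P - g P.+1 * (Clim (dser f s) * euler_factor f s P))%C by ring.
apply: Ccv_ext L => N.
have -> : \sumC_(1 <= n < N.+1 | rough P n) (g n) =
  ((\sumC_(1 <= n < N.+1 | rough P.+1 n) (g n)) + \sumC_(1 <= n < N.+1 | P.+1 %| n) (if rough P n then g n else RtoC 0))%C.
  rewrite (bigID (fun n => ~~ (P.+1 %| n))) /=; congr Cplus.
    by apply: eq_bigl => n; rewrite roughS pp.
  by rewrite -big_mkcondr; apply: eq_bigl => n; rewrite negbK andbC.
rewrite big_multiples ?prime_gt0 //.
have -> : \sumC_(1 <= d < (N %/ P.+1).+1) (if rough P (P.+1 * d) then g (P.+1 * d)%N else RtoC 0) =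
   (g P.+1 * \sumC_(1 <= n < (N %/ P.+1).+1 | rough P n) (g n))%C.
  rewrite big_distrr [RHS]big_mkcond /= big_nat [RHS]big_nat; apply: eq_bigr => d /andP[d0 _].
  rewrite rough_mul_prime //; case: (rough P d) => //.
  rewrite /g (cm_mul _ hf) // -multE mult_INR cpow_mul; [by ring | |]; exact: INR_pos.
rewrite /g; ring.
Qed.

(** Apart from n = 1, every P-rough number exceeds P, so the deviation from 1 is a tail of the
    series starting beyond P. *)
Lemma euler_product_bound (f : nat -> C) (s : C) (P : nat) : cmult f -> 1 < Re s ->
  Cmod (Clim (dser f s) * euler_factor f s P - 1)%C <= zeta_tail (Re s) P.
Proof.
move=> hf hs.
have L := Ccv_minus _ _ _ _ (rough_sum_lim f s P hf hs) (Ccv_const (RtoC 1)).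
apply: (Ccv_le_bound _ _ _ P.+1 L) => N /leP hN.
have -> : \sumC_(1 <= n < N.+1 | rough P n) (f n * cpow (INR n) (- s)) =
  (1 + \sumC_(P.+1 <= n < N.+1 | rough P n && (n != 1)%N) (f n * cpow (INR n) (- s)))%C.
  rewrite (bigID (fun n => n == 1)%N) /=; congr Cplus.
    rewrite (eq_bigl (fun n => n == 1)%N); last by move=> n; case: eqP => [->|]; rewrite ?rough_1 ?andbF.
    by rewrite big_nat1_eq /= ltnS (leq_ltn_trans _ hN) // (cm_one _ hf) /= cpow_1 Cmult_1_l.
  rewrite (big_cat_nat (n := P.+1)) //=; last exact: leqW.
  rewrite [X in Cplus X _]big_nat_cond [X in Cplus X _]big1 ?Cplus_0_l // => n /andP[/andP[n0 nP] /andP[r n1]].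
  by rewrite rough_small // in r; rewrite ltn_neqAle eq_sym n1 n0.
have -> : forall z : C, (1 + z - 1)%C = z by move=> z; ring.
by apply: dser_abs_bound => //; [exact: (cm_le1 _ hf) | apply: ltnW].
Qed.

Lemma dser_neq0 (f : nat -> C) (s : C) : cmult f -> 1 < Re s -> Clim (dser f s) <> RtoC 0.
Proof.
move=> hf hs E.
have := is_lim_seq_le (fun _ => 1) (zeta_tail (Re s)) 1 0 _ (is_lim_seq_const 1) (zeta_tail_lim _ hs).
have H : forall n : nat, 1 <= zeta_tail (Re s) n.
  move=> P; have := euler_product_bound f s P hf hs; rewrite E Cmult_0_l.
  by have -> : (0 - 1)%C = (- (1))%C by [ring]; rewrite Cmod_m1.
by move=> /(_ H) /=; lra.
Qed.

(* [(1 + r + r^2)^3 - (1 - 2 r c + r^2)^2 (1 - 2 r (2 c^2 - 1) + r^2)] has a double zero at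
   [c = -1/2]. *)
Lemma euler_factor_ineq_real (r c : R) : 0 <= r <= 1 -> -1 <= c <= 1 ->
  (1 - r) ^ 3 * ((1 - 2 * r * c + r ^ 2) ^ 2 * (1 - 2 * r * (2 * c ^ 2 - 1) + r ^ 2)) <= 1.
Proof.
move=> hr hc.
set X := _ ^ 2 * _.
have E : (1 + r + r ^ 2) ^ 3 - X =
  (1 + 2 * c) ^ 2 * (r * ((2 * r * c - (1 + r ^ 2 + r)) ^ 2 + (1 + r ^ 2) * r)) by rewrite /X; ring.
have XE : X <= (1 + r + r ^ 2) ^ 3.
  have : 0 <= (1 + 2 * c) ^ 2 * (r * ((2 * r * c - (1 + r ^ 2 + r)) ^ 2 + (1 + r ^ 2) * r)); last by lra.
  apply: Rmult_le_pos; first exact: pow2_ge_0.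
  apply: Rmult_le_pos; first by lra.
  by have := pow2_ge_0 (2 * r * c - (1 + r ^ 2 + r)); nra.
have r3 : 0 <= (1 - r) ^ 3 by apply: pow_le; lra.
apply: (Rle_trans _ _ _ (Rmult_le_compat_l _ _ _ r3 XE)).
rewrite -Rpow_mult_distr.
have -> : (1 - r) * (1 + r + r ^ 2) = 1 - r ^ 3 by ring.
have rc : 0 <= r ^ 3 <= 1 by split; [apply: pow_le; lra | rewrite -(pow1 3); apply: pow_incr; lra].
by rewrite -[X in _ <= X](pow1 3); apply: pow_incr; lra.
Qed.

Lemma Cmod2_one_sub (z : C) (r : R) : Cmod z = 1 ->
  Cmod (1 - z * RtoC r)%C ^ 2 = 1 - 2 * r * Re z + r ^ 2.
Proof.
move=> hz; have := Cmod2_alt z; rewrite hz => E.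
rewrite Cmod2_alt.
have -> : Re (1 - z * RtoC r)%C = 1 - Re z * r by rewrite /Re /Cmult /=; ring.
have -> : Im (1 - z * RtoC r)%C = - (Im z * r) by rewrite /Im /Cmult /=; ring.
have -> : (1 - Re z * r) ^ 2 + (- (Im z * r)) ^ 2 = 1 - 2 * r * Re z + (Re z ^ 2 + Im z ^ 2) * r ^ 2 by ring.
by rewrite -E; ring.
Qed.

Lemma euler_factor_ineq (z : C) (r : R) : z = RtoC 0 \/ Cmod z = 1 -> 0 <= r <= 1 ->
  Cmod (1 - RtoC r)%C ^ 3 * (Cmod (1 - z * RtoC r)%C ^ 4 * Cmod (1 - z * z * RtoC r)%C ^ 2) <= 1.
Proof.
move=> hz hr.
have -> : Cmod (1 - RtoC r)%C = 1 - r by rewrite -RtoC_minus Cmod_R Rabs_pos_eq; lra.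
case: hz => [->|hz].
  have -> : (1 - 0 * RtoC r)%C = RtoC 1 by ring.
  have -> : (1 - 0 * 0 * RtoC r)%C = RtoC 1 by ring.
  rewrite Cmod_1 !pow1 !Rmult_1_r -[X in _ <= X](pow1 3); apply: pow_incr; lra.
have -> : Cmod (1 - z * RtoC r)%C ^ 4 = (Cmod (1 - z * RtoC r)%C ^ 2) ^ 2 by ring.
rewrite !Cmod2_one_sub //; last by rewrite Cmod_mult hz; ring.
have -> : Re (z * z)%C = 2 * Re z ^ 2 - 1.
  have := Cmod2_alt z; rewrite hz => E.
  have -> : Re (z * z)%C = 2 * Re z ^ 2 - (Re z ^ 2 + Im z ^ 2) by rewrite /Re /Im /Cmult /=; ring.
  by rewrite -E; ring.
apply: euler_factor_ineq_real => //.
by have := re_le_Cmod z; rewrite hz => /Rabs_le_between.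
Qed.

Definition Cone (n : nat) : C := RtoC 1.

Lemma cmult_one : cmult Cone.
Proof.
split=> // [m n _ _|n _]; rewrite /Cone; first by rewrite Cmult_1_l.
by rewrite Cmod_1; lra.
Qed.

Lemma cmult_sqr (f : nat -> C) : cmult f -> cmult (fun n => f n * f n)%C.
Proof.
move=> hf; split.
- by rewrite (cm_one _ hf) Cmult_1_l.
- by move=> m n m0 n0; rewrite (cm_mul _ hf) //; ring.
- move=> n n0; rewrite Cmod_mult; have := cm_le1 _ hf n n0; have := Cmod_ge_0 (f n); nra.
Qed.

Lemma euler_products_ineq (f : nat -> C) (sigma : R) (P : nat) : 0 <= sigma ->
  (forall p, prime p -> f p = RtoC 0 \/ Cmod (f p) = 1) ->
  Cmod (euler_factor Cone (RtoC sigma) P) ^ 3 * (Cmod (euler_factor f (RtoC sigma) P) ^ 4 *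
    Cmod (euler_factor (fun n => f n * f n)%C (RtoC sigma) P) ^ 2) <= 1.
Proof.
move=> hs hf; elim: P => [|P IH].
  have E f0 s : euler_factor f0 s 0 = RtoC 1 by rewrite /euler_factor big_mkcond big_nat1.
  by rewrite !E Cmod_1 !pow1 !Rmult_1_l; lra.
rewrite !euler_factorS; case pp : (prime P.+1); last by rewrite !Cmult_1_r.
have E : cpow (INR P.+1) (- RtoC sigma) = RtoC (Rpower (INR P.+1) (- sigma)) by rewrite -RtoC_opp cpow_Rpower.
have r0 : 0 <= Rpower (INR P.+1) (- sigma) <= 1.
  split; first by left; apply: exp_pos.
  rewrite -[X in _ <= X](Rpower_O (INR P.+1)); last exact: INR_pos.
  apply: Rle_Rpower; last by lra.
  by apply: (le_INR 1); apply/leP.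
rewrite E -[Cone P.+1]/(RtoC 1) Cmult_1_l !Cmod_mult.
have := euler_factor_ineq (f P.+1) _ (hf _ pp) r0.
rewrite !Rpow_mult_distr.
have p1 k x : 0 <= Cmod x ^ k by apply: pow_le; apply: Cmod_ge_0.
move=> h.
have := Rmult_le_compat _ _ _ _ _ _ IH h; rewrite Rmult_1_l => H.
apply: Rle_trans (H _ _); first by right; ring.
  by apply: Rmult_le_pos => //; apply: Rmult_le_pos.
by apply: Rmult_le_pos => //; apply: Rmult_le_pos.
Qed.

(** * Non-vanishing on the line Re s = 1 *)

Lemma Cmod_lim (u : nat -> C) (l : C) : Ccv u l -> is_lim_seq (fun n => Cmod (u n)) (Cmod l).
Proof.
move=> H; apply/is_lim_seq_spec => eps; have /is_lim_seq_spec /(_ eps) [N HN] := H.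
exists N => n /HN; rewrite Rminus_0_r Rabs_pos_eq; last exact: Cmod_ge_0.
have := Cmod_triangle_rev (u n) l; have := Cmod_triangle_rev l (u n); rewrite (Cmod_sub_sym l) => h1 h2 h3.
by apply: Rabs_def1; lra.
Qed.

Lemma euler_product_lim (f : nat -> C) (s : C) : cmult f -> 1 < Re s ->
  is_lim_seq (fun P => Cmod (Clim (dser f s) * euler_factor f s P)%C) 1.
Proof.
move=> hf hs.
have H : Ccv (fun P => Clim (dser f s) * euler_factor f s P)%C (RtoC 1).
  apply: (Ccv_le _ _ (zeta_tail (Re s)) 0) => [n _|]; last exact: zeta_tail_lim.
  exact: euler_product_bound.
by have := Cmod_lim _ _ H; rewrite Cmod_1.
Qed.

(** The exponents come from 3 + 4 cos x + 2 cos 2x = (1 + 2 cos x)^2 >= 0, the first-order form of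
    the inequality for Euler factors. A zero of the middle series contributes a fourth power, which
    outweighs the third power of the pole of zeta. *)
Lemma three_four_two (f : nat -> C) (sigma : R) : cmult f -> 1 < sigma ->
  (forall p, prime p -> f p = RtoC 0 \/ Cmod (f p) = 1) ->
  1 <= Cmod (Clim (dser Cone (RtoC sigma))) ^ 3 * (Cmod (Clim (dser f (RtoC sigma))) ^ 4 *
    Cmod (Clim (dser (fun n => f n * f n)%C (RtoC sigma))) ^ 2).
Proof.
move=> hf hs hp.
have L1 := euler_product_lim Cone (RtoC sigma) cmult_one hs.
have L2 := euler_product_lim f (RtoC sigma) hf hs.
have L3 := euler_product_lim _ (RtoC sigma) (cmult_sqr f hf) hs.
have pw u k : is_lim_seq u 1 -> is_lim_seq (fun n => u n ^ k) 1.
  move=> hu; elim: k => [|k IH]; first exact: is_lim_seq_const.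
  by have := is_lim_seq_mult' _ _ _ _ hu IH; rewrite Rmult_1_l.
have L := is_lim_seq_mult' _ _ _ _ (pw _ 3%N L1) (is_lim_seq_mult' _ _ _ _ (pw _ 4%N L2) (pw _ 2%N L3)).
rewrite !Rmult_1_l in L.
set A := Cmod _ ^ 3 * _.
apply: (is_lim_seq_le _ (fun _ => A) 1 A _ L (is_lim_seq_const A)) => P.
have := euler_products_ineq f sigma P ltac:(lra) hp.
rewrite !Cmod_mult !Rpow_mult_distr.
have p1 k x : 0 <= Cmod x ^ k by apply: pow_le; apply: Cmod_ge_0.
have A0 : 0 <= A by apply: Rmult_le_pos => //; apply: Rmult_le_pos.
move=> /(Rmult_le_compat_l _ _ _ A0); rewrite Rmult_1_r; apply: Rle_trans.
by right; rewrite /A; ring.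
Qed.

Lemma cderive_comp (phi : R -> C) (g : R -> R) (t dg : R) (d : C) :
  cderive phi (g t) d -> is_derive g t dg -> cderive (fun x => phi (g x)) t (RtoC dg * d)%C.
Proof.
move=> [a b] hg; split.
  have -> : Re (RtoC dg * d)%C = dg * Re d by rewrite /Re /Cmult /=; ring.
  exact: (is_derive_comp (fun x => Re (phi x)) g).
have -> : Im (RtoC dg * d)%C = dg * Im d by rewrite /Im /Cmult /=; ring.
exact: (is_derive_comp (fun x => Im (phi x)) g).
Qed.

Lemma cderive_cpow (a : C) (x : R) : 0 < x ->
  cderive (fun y => cpow y a) x (a * cpow x (a - 1))%C.
Proof.
move=> hx; have := cderive_comp (fun t => Cexp (a * RtoC t)) ln x (/ x) _ (cderive_Cexp a (ln x)) (is_derive_ln x hx).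
have x0 : RtoC x <> RtoC 0 by move=> /RtoC_inj; lra.
have -> // : (RtoC (/ x) * (a * Cexp (a * RtoC (ln x))))%C = (a * cpow x (a - 1))%C.
rewrite /Cminus cpow_add cpow_opp cpow_id // RtoC_inv; last by lra.
by rewrite -/(cpow x a); ring.
Qed.

(** Each n^(-s) is compared with the integral of x^(-s) over [n, n + 1], whose primitive is [psi].
    The errors are bounded by increments of the majorant [v] and telescope to at most |s|; each of
    the two end values of [psi] costs at most 1 / |Im s|. *)
Lemma zeta_partial_bound (s : C) (N : nat) : 1 <= Re s -> Im s <> 0 ->
  Cmod (dser Cone s N) <= Cmod s + 2 / Rabs (Im s).
Proof.
move=> hs ht.
have tp : 0 < Rabs (Im s) by apply: Rabs_pos_lt.
have s1 : Rabs (Im s) <= Cmod (1 - s)%C.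
  have := im_le_Cmod (1 - s)%C; rewrite -[Im (1 - s)%C]/(0 + - Im s) Rplus_0_l Rabs_Ropp; lra.
have s1n : (1 - s)%C <> RtoC 0 by apply/Cmod_gt_0; lra.
pose psi x := (/ (1 - s) * cpow x (1 - s))%C.
pose v d := Cmod s / Re s * Rpower (INR d) (- Re s).
have step n : (0 < n)%N -> Cmod (psi (INR n.+1) - psi (INR n) - cpow (INR n) (- s))%C <= v n - v n.+1.
  move=> n0; have np := INR_pos n n0.
  pose th x := (psi x - RtoC x * cpow (INR n) (- s))%C.
  have -> : (psi (INR n.+1) - psi (INR n) - cpow (INR n) (- s))%C = (th (INR n.+1) - th (INR n))%C.
    by rewrite /th S_INR RtoC_plus; ring.
  have := cderive_bound th (fun x => cpow x (- s) - cpow (INR n) (- s))%C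
    (fun x => x * (v n - v n.+1)) (fun _ => v n - v n.+1) (INR n) (INR n.+1) ltac:(rewrite S_INR; lra).
  have -> : INR n.+1 * (v n - v n.+1) - INR n * (v n - v n.+1) = v n - v n.+1 by rewrite S_INR; ring.
  apply => x hx.
  - apply: cderive_minus.
      have := cderive_scal (/ (1 - s))%C _ x _ (cderive_cpow (1 - s)%C x ltac:(lra)).
      have -> // : (/ (1 - s) * ((1 - s) * cpow x (1 - s - 1)))%C = cpow x (- s).
      have -> : (1 - s - 1)%C = (- s)%C by ring.
      by field.
    have := cderive_mult RtoC (fun _ => cpow (INR n) (- s)) x (RtoC 1) (RtoC 0)
      (cderive_RtoC (fun x => x) x 1 (is_derive_id x)) (cderive_const _ x).
    by have -> : (1 * cpow (INR n) (- s) + RtoC x * 0)%C = cpow (INR n) (- s) by ring.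
  - by have := is_derive_scal_l (fun x => x) x 1 (v n - v n.+1) (is_derive_id x); rewrite /scal /= /mult /= Rmult_1_l.
  - have lnx : ln (INR n) <= ln x by apply: ln_le; lra.
    have := Cexp_ray_bound s (ln (INR n)) (ln x) ltac:(lra) lnx.
    rewrite -!/(cpow _ _) => h; apply: (Rle_trans _ _ _ h).
    have : Rpower (INR n.+1) (- Re s) <= Rpower x (- Re s) by apply: Rpower_le_neg; lra.
    rewrite /v /Rpower => h2.
    have sp : 0 <= Cmod s / Re s by apply: Rdiv_le_0_compat; [exact: Cmod_ge_0 | lra].
    by have := Rmult_le_compat_l _ _ _ sp h2; lra.
have E : (dser Cone s N = psi (INR N.+1) - psi 1 -
   \sumC_(1 <= n < N.+1) (psi (INR n.+1) - psi (INR n) - cpow (INR n) (- s)))%C.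
  rewrite /dser; elim: (N) => [|n IH]; first by rewrite !big_geq //=; ring.
  by rewrite big_nat_recr //= IH [in RHS]big_nat_recr //= /Cone; ring.
rewrite E.
have B : Cmod (\sumC_(1 <= n < N.+1) (psi (INR n.+1) - psi (INR n) - cpow (INR n) (- s))) <= Cmod s.
  apply: (Rle_trans _ _ _ (Cmod_sum _ _ _ _)).
  apply: (Rle_trans _ (\sumR_(1 <= n < N.+1) (v n - v n.+1))).
    by apply: Rsum_le_nat => n /andP[n0 _]; apply: step.
  rewrite (Rsum_telescope v) // /v Rpower_1_l Rmult_1_r.
  have h1 : 0 <= Cmod s / Re s * Rpower (INR N.+1) (- Re s).
    apply: Rmult_le_pos; last by left; apply: exp_pos.
    by apply: Rdiv_le_0_compat; [exact: Cmod_ge_0 | lra].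
  have : Cmod s / Re s <= Cmod s; last by lra.
  by apply/Rle_div_l; [lra | have := Cmod_ge_0 s; nra].
have psib n : Cmod (psi (INR n.+1)) <= / Rabs (Im s).
  rewrite /psi Cmod_mult Cmod_inv // Cmod_cpow.
  have -> : Re (1 - s)%C = 1 - Re s by [].
  have h1 : / Cmod (1 - s)%C <= / Rabs (Im s) by apply: Rinv_le_contravar.
  have h2 : Rpower (INR n.+1) (1 - Re s) <= 1.
    apply: (Rle_trans _ (Rpower (INR n.+1) 0)); last by right; apply: Rpower_O; apply: INR_pos.
    by apply: Rle_Rpower; [apply: (le_INR 1); apply/leP | lra].
  have h3 : 0 < Rpower (INR n.+1) (1 - Re s) by apply: exp_pos.
  have h4 : 0 < / Cmod (1 - s)%C by apply: Rinv_0_lt_compat; lra.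
  nra.
have B1 := psib N; have B2 := psib 0%N.
have := Cmod_triangle_sub (psi (INR N.+1) - psi 1)%C (\sumC_(1 <= n < N.+1) (psi (INR n.+1) - psi (INR n) - cpow (INR n) (- s))).
have := Cmod_triangle_sub (psi (INR N.+1)) (psi 1); rewrite [INR 1]/= in B2.
rewrite /Rdiv; lra.
Qed.

(** Subtracting the mean [mu] leaves coefficients with bounded partial sums. The mean itself
    contributes [mu] times partial sums of zeta, which are bounded off the real axis and absent when
    [mu] is 0. *)
Lemma dser_periodic_bound (Q : nat) (g : nat -> C) (s : C) (N : nat) : (0 < Q)%N ->
  (forall n, g (n + Q)%N = g n) -> (forall n, Cmod (g n) <= 1) -> 1 <= Re s ->
  Im s <> 0 \/ \sumC_(0 <= d < Q) g d = RtoC 0 ->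
  Cmod (dser g s N) <= 4 * (2 * INR Q + 2) * Cmod s + 2 / Rabs (Im s) + Cmod s.
Proof.
move=> hQ per g1 hs hcase.
have Qp := INR_pos Q hQ; have s0 := Cmod_ge_0 s.
pose mu := (/ RtoC (INR Q) * \sumC_(0 <= d < Q) g d)%C.
have Qn : RtoC (INR Q) <> RtoC 0 by move=> /RtoC_inj; lra.
have mu1 : Cmod mu <= 1.
  rewrite /mu Cmod_mult Cmod_inv // Cmod_R Rabs_pos_eq; last by lra.
  apply: (Rmult_le_reg_l (INR Q)) => //; rewrite -Rmult_assoc Rinv_r ?Rmult_1_l ?Rmult_1_r; last by lra.
  apply: (Rle_trans _ _ _ (Cmod_sum _ _ _ _)).
  apply: (Rle_trans _ (\sumR_(0 <= d < Q) 1)); last by rewrite Rsum_const subn0; lra.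
  by apply: Rsum_le.
pose h n := (g n - mu)%C.
have hb : bounded_sums h (2 * INR Q + 2).
  apply: periodic_bounded => //.
  - by move=> n; rewrite /h per.
  - by move=> n; apply: (Rle_trans _ _ _ (Cmod_triangle_sub _ _)); have := g1 n; lra.
  - by rewrite /h Csum_minus Csum_const subn0 /mu; field.
have E : dser g s N = (dser h s N + mu * dser Cone s N)%C.
  rewrite /dser big_distrr -big_split; apply: eq_bigr => d _ /=.
  by rewrite /h /Cone; ring.
have B1 : Cmod (dser h s N) <= 2 * (2 * INR Q + 2) * Cmod s.
  have := dser_partial_bound h _ s 0 N hb ltac:(lra) isT; rewrite Rpower_1_l Rmult_1_r => H.
  apply: (Rle_trans _ _ _ H); apply: Rmult_le_compat_l; first by lra.
  by apply/Rle_div_l; [lra | nra].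
have B2 : Cmod (mu * dser Cone s N)%C <= Cmod s + 2 / Rabs (Im s).
  have inv0 : 0 <= 2 / Rabs (Im s).
    (* Division by 0 yields 0, so the bound stays meaningful when Im s = 0; there the mean
       vanishes. *)
    case: (Req_dec (Im s) 0) => [->|ne]; first by rewrite Rabs_R0 /Rdiv Rinv_0; lra.
    by apply: Rdiv_le_0_compat; [lra | exact: Rabs_pos_lt].
  case: hcase => [ht|h0]; last first.
    by rewrite /mu h0 Cmult_0_r Cmult_0_l Cmod_0; lra.
  rewrite Cmod_mult; have := zeta_partial_bound s N hs ht; have := Cmod_ge_0 (dser Cone s N).
  have := Cmod_ge_0 mu; nra.
rewrite E; apply: (Rle_trans _ _ _ (Cmod_triangle _ _)).
have : 0 <= INR Q * Cmod s by apply: Rmult_le_pos; lra.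
lra.
Qed.

Lemma L_series_cv (q : Z) (chi : Z -> C) (L : C -> C) (s : C) : is_dirichlet_L q chi L ->
  1 < Re s -> Ccv (dser (fun n => chi (Z.of_nat n)) s) (L s).
Proof.
move=> HL hs; have := is_series_Ccv _ _ (dL_series _ _ _ HL s hs) => H.
apply/is_lim_seq_incr_1; apply: is_lim_seq_ext H => n.
congr (Cmod (_ - _)%C); rewrite /dser [in RHS]big_add1 /=.
by apply: eq_bigr => k _.
Qed.

Lemma nc_cmult (Q : nat) (f : nat -> C) : nat_character Q f -> cmult f.
Proof.
move=> H; split.
- exact: nc_one H.
- by move=> m n _ _; apply: (nc_mul _ _ H).
- by move=> n _; apply: nc_le1 H.
Qed.

Lemma cmult_twist (f : nat -> C) (t : R) : cmult f -> cmult (fun n => f n * cpow (INR n) (- (0, t)))%C.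
Proof.
move=> hf; split.
- by rewrite (cm_one _ hf) /= cpow_1 Cmult_1_l.
- move=> m n m0 n0; rewrite (cm_mul _ hf) // -multE mult_INR cpow_mul; try exact: INR_pos.
  by ring.
- move=> n n0; rewrite Cmod_mult Cmod_cpow.
  have -> : Re (- (0, t))%C = 0 by rewrite /Re /=; ring.
  by rewrite Rpower_O ?Rmult_1_r; [apply: cm_le1 | apply: INR_pos].
Qed.

(** A zero at 1 + i t makes the series of g(n) = chi(n) n^(-i t) at sigma at most a constant times
    sigma - 1, while zeta is at most 2 / (sigma - 1). The series of g^2 is that of chi^2 near 1 + 2
    i t, and the case hypothesis keeps it away from a pole. Then [three_four_two] gives 1 <= K
    (sigma - 1), which fails near 1. *)
Lemma no_zero_line_one_case (q : Z) (chi : Z -> C) (L : C -> C) (rho : C) :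
  dirichlet_character q chi -> is_dirichlet_L q chi L -> L_domain q chi rho ->
  Re rho = 1 ->
  Im rho <> 0 \/ \sumC_(0 <= d < Z.to_nat q) (chi (Z.of_nat d) * chi (Z.of_nat d)) = RtoC 0 ->
  L rho <> RtoC 0.
Proof.
move=> hchi HL Hdom hre hcase L0.
set Q := Z.to_nat q in hcase; pose f n := chi (Z.of_nat n).
have hf : nat_character Q f by apply: dirichlet_nat_character.
have hrho : rho = (RtoC 1 + (0, Im rho))%C by rewrite /Cplus /= Rplus_0_r Rplus_0_l -hre; case: (rho).
pose g n := (f n * cpow (INR n) (- (0, Im rho)))%C.
have hg : cmult g by apply: cmult_twist; apply: nc_cmult hf.
have gp p : prime p -> g p = RtoC 0 \/ Cmod (g p) = 1.
  move=> pp; case: (nc_norm _ _ p hf) => h; [left | right]; rewrite /g.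
    by rewrite h Cmult_0_l.
  rewrite Cmod_mult h Cmod_cpow Rmult_1_l.
  have -> : Re (- (0, Im rho))%C = 0 by rewrite /Re /=; ring.
  by apply: Rpower_O; apply: INR_pos; apply: prime_gt0.
have [a [r [C1 [hr HT]]]] := analytic_taylor _ _ (dL_analytic _ _ _ HL rho Hdom).
have a0 : a 0%N = RtoC 0.
  have := HT 1%N (RtoC 0); rewrite Cmod_0 big_nat1 Cplus_0_r L0 => /(_ hr).
  rewrite /Rdiv Rmult_0_l /= Rmult_0_l Rmult_0_r => h.
  have /Cmod_eq_0 E : Cmod (0 - a 0%N * 1)%C = 0 by have := Cmod_ge_0 (0 - a 0%N * 1)%C; lra.
  by have -> : a 0%N = (- (0 - a 0%N * 1))%C by [ring]; rewrite E; ring.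
have C1p := taylor_C0_ge0 _ _ _ _ _ hr HT.
have LD sigma : 1 < sigma -> sigma - 1 < r ->
   Cmod (Clim (dser g (RtoC sigma))) <= C1 / r * (sigma - 1).
  move=> s1 sr.
  have cv := L_series_cv q chi L (rho + RtoC (sigma - 1))%C HL.
  have -> : Clim (dser g (RtoC sigma)) = L (rho + RtoC (sigma - 1))%C.
    apply: (Ccv_unique (dser g (RtoC sigma))).
      by case: (dser_abs_cv g (RtoC sigma) (cm_le1 _ hg) s1).
    apply: Ccv_ext (cv _) => [n|]; last by rewrite -[Re _]/(Re rho + (sigma - 1)); lra.
    apply: eq_bigr => d _; rewrite /g -Cmult_assoc -cpow_add; congr Cmult; congr cpow.
    by move: hrho; set it := (0, Im rho) => ->; rewrite RtoC_minus; ring.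
  have := HT 1%N (RtoC (sigma - 1)); rewrite Cmod_R Rabs_pos_eq; last by lra.
  move=> /(_ sr); rewrite big_nat1 a0.
  have -> : forall z : C, (z - 0 * RtoC (sigma - 1) ^ 0)%C = z by move=> z /=; ring.
  by rewrite pow_1 => h; apply: (Rle_trans _ _ _ h); right; field; lra.
pose s2 sigma := (RtoC sigma + (0, (2 * Im rho)%R))%C.
pose B := 4 * (2 * INR Q + 2) * (2 + 2 * Rabs (Im rho)) + 2 / Rabs (2 * Im rho) + (2 + 2 * Rabs (Im rho)).
have D2 sigma : 1 < sigma <= 2 -> Cmod (Clim (dser (fun n => g n * g n)%C (RtoC sigma))) <= B.
  move=> hs.
  have [cv _] := dser_abs_cv _ (RtoC sigma) (cm_le1 _ (cmult_sqr _ hg)) (proj1 hs).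
  apply: (Ccv_le_bound _ _ _ 0 cv) => N _.
  have -> : dser (fun n => g n * g n)%C (RtoC sigma) N = dser (fun n => f n * f n)%C (s2 sigma) N.
    apply: eq_bigr => d _; cbv beta; rewrite /g /s2.
    have -> : (- (RtoC sigma + (0, (2 * Im rho)%R)))%C = (- (0, Im rho) + (- (0, Im rho)) + (- RtoC sigma))%C.
      by rewrite /Cplus /Copp /=; congr (_, _); ring.
    by rewrite !cpow_add; ring.
  have im2 : Im (s2 sigma) = 2 * Im rho by rewrite /s2 /Im /=; ring.
  have := dser_periodic_bound Q (fun n => f n * f n)%C (s2 sigma) N (nc_pos _ _ hf).
  rewrite im2 => H.
  apply: (Rle_trans _ _ _ (H _ _ _ _)).
  - by move=> n; rewrite (nc_per _ _ hf).
  - by move=> n; rewrite Cmod_mult; have := nc_le1 _ _ n hf; have := Cmod_ge_0 (f n); nra.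
  - by rewrite /s2 /Re /=; lra.
  - by case: hcase; [left; lra | right].
  have : Cmod (s2 sigma) <= 2 + 2 * Rabs (Im rho).
    apply: (Rle_trans _ _ _ (Cmod_le_Re_Im _)); rewrite im2 -[Re _]/(sigma + 0).
    rewrite Rabs_mult (Rabs_pos_eq 2) ?(Rabs_pos_eq (sigma + 0)); lra.
  have Q0 := INR_pos Q (nc_pos _ _ hf).
  rewrite /B; nra.
have main sigma : 1 < sigma <= 2 -> sigma - 1 < r -> 1 <= 8 * (C1 / r) ^ 4 * B ^ 2 * (sigma - 1).
  move=> hs sr; have := three_four_two g sigma hg (proj1 hs) gp.
  have h1 : Cmod (Clim (dser Cone (RtoC sigma))) <= 2 / (sigma - 1).
    have [_ ] := dser_abs_cv Cone (RtoC sigma) (cm_le1 _ cmult_one) (proj1 hs).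
    move=> /(_ 0%N); rewrite /dser big_geq // /zeta_tail -[Re _]/sigma.
    have -> : forall z : C, (z - 0)%C = z by move=> z; ring.
    move=> h; apply: (Rle_trans _ _ _ h).
    have : 1 <= / (sigma - 1) by rewrite -{1}Rinv_1; apply: Rinv_le_contravar; lra.
    by rewrite /Rdiv; lra.
  have h2 := LD sigma (proj1 hs) sr; have h3 := D2 sigma hs.
  have p3 := pow_incr _ _ 3 (conj (Cmod_ge_0 _) h1).
  have p4 := pow_incr _ _ 4 (conj (Cmod_ge_0 _) h2).
  have p2 := pow_incr _ _ 2 (conj (Cmod_ge_0 _) h3).
  have ps x k : 0 <= Cmod x ^ k by apply: pow_le; apply: Cmod_ge_0.
  move=> h; apply: (Rle_trans _ _ _ h).
  have H := Rmult_le_compat _ _ _ _ (ps _ _) (Rmult_le_pos _ _ (ps _ _) (ps _ _)) p3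
     (Rmult_le_compat _ _ _ _ (ps _ _) (ps _ _) p4 p2).
  apply: (Rle_trans _ _ _ H); right.
  by field; lra.
pose K := 8 * (C1 / r) ^ 4 * B ^ 2.
have K0 : 0 <= K.
  apply: Rmult_le_pos; last exact: pow2_ge_0.
  by apply: Rmult_le_pos; [lra | apply: pow_le; apply: Rdiv_le_0_compat].
(* Inside the range of [main], and small enough that K t <= 1/2. *)
set t := Rmin 1 (Rmin (r / 2) (/ (2 * (K + 1)))).
have ip : 0 < / (2 * (K + 1)) by apply: Rinv_0_lt_compat; lra.
have tp : 0 < t by apply: Rmin_glb_lt; [lra | apply: Rmin_glb_lt; lra].
have t1 : t <= 1 by apply: Rmin_l.
have t2 : t <= r / 2 by apply: Rle_trans (Rmin_r _ _) (Rmin_l _ _).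
have t3 : t <= / (2 * (K + 1)) by apply: Rle_trans (Rmin_r _ _) (Rmin_r _ _).
have := main (1 + t) ltac:(lra) ltac:(lra).
have -> : 1 + t - 1 = t by ring.
rewrite -/K => h.
have := Rmult_le_compat_l (K + 1) _ _ ltac:(lra) t3.
have -> : (K + 1) * / (2 * (K + 1)) = / 2 by field; lra.
nra.
Qed.

(* The coefficients of [(1 - kappa 2^(-s)) L(s)]: [kappa = 2] removes the pole of zeta, while
   [kappa = 0] leaves a nonprincipal character alone. *)
Definition twist2 (kappa : C) (f : nat -> C) (n : nat) : C :=
  (f n - kappa * (if 2 %| n then f (n %/ 2)%N else 0))%C.

Lemma sum_twist2 (kappa : C) (f : nat -> C) (F : nat -> C) (N : nat) :
  \sumC_(1 <= n < N.+1) (twist2 kappa f n * F n) =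
  ((\sumC_(1 <= n < N.+1) (f n * F n)) - kappa * \sumC_(1 <= d < (N %/ 2).+1) (f d * F (2 * d)%N))%C.
Proof.
have -> : \sumC_(1 <= d < (N %/ 2).+1) (f d * F (2 * d)%N) =
  \sumC_(1 <= n < N.+1 | 2 %| n) (f (n %/ 2)%N * F n).
  by rewrite big_multiples //; apply: eq_bigr => d _; rewrite mulKn.
rewrite big_distrr [X in (_ - X)%C]big_mkcond -Csum_minus; apply: eq_bigr => n _ /=.
by rewrite /twist2; case: (2 %| n); ring.
Qed.

Lemma dser_twist2 (kappa : C) (f : nat -> C) (s : C) (N : nat) :
  dser (twist2 kappa f) s N = (dser f s N - kappa * cpow 2 (- s) * dser f s (N %/ 2))%C.
Proof.
rewrite /dser (sum_twist2 kappa f (fun n => cpow (INR n) (- s))) -Cmult_assoc; congr (_ - _ * _)%C.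
rewrite big_distrr big_nat [RHS]big_nat; apply: eq_bigr => d /andP[d0 _] /=.
rewrite -multE mult_INR cpow_mul; [| rewrite /=; lra | exact: INR_pos].
have -> : INR 2 = 2 by rewrite /=; ring.
ring.
Qed.

(** Both sides agree for Re s > 1 and have Taylor expansions along a path to rho, so the identity
    theorem carries the equality into Re s > 0. At a zero of L it says that the twisted series
    converges to 0. *)
Lemma L_continuation (q : Z) (chi : Z -> C) (L : C -> C) (rho kappa : C) (C0 : R) :
  is_dirichlet_L q chi L -> L_domain q chi rho -> 0 < Re rho ->
  bounded_sums (twist2 kappa (fun n => chi (Z.of_nat n))) C0 ->
  ((1 - kappa * cpow 2 (- rho)) * L rho)%C =
    Clim (dser (twist2 kappa (fun n => chi (Z.of_nat n))) rho).
Proof.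
move=> HL Hdom hre HB.
set f := fun n => chi (Z.of_nat n) in HB *; set eta := twist2 kappa f in HB *.
pose Phi z := ((1 - kappa * cpow 2 (- z)) * L z - Clim (dser eta z))%C.
have two : forall s, 1 < Re s -> Phi s = RtoC 0.
  move=> s hs; have cv := L_series_cv q chi L s HL hs.
  have c2 := Ccv_minus _ _ _ _ cv (Ccv_scal (kappa * cpow 2 (- s))%C _ _ (Ccv_subseq _ _ _ (filterlim_divn 2 isT) cv)).
  have [c3 _] := dser_cv eta C0 s HB ltac:(lra).
  have E := Ccv_unique _ _ _ c3 (Ccv_ext _ _ _ (fun n => esym (dser_twist2 kappa f s n)) c2).
  by rewrite /Phi E; ring.
(* The path starts away from the height of rho, on the side given by the sign of Im rho. Its points
   therefore have nonzero imaginary part before the end and miss the possible pole at 1; the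
   endpoint itself is covered by [Hdom]. *)
have [sg sgp] : exists sg, forall t, 0 <= t < 1 -> Im rho + sg * (1 - t) <> 0.
  by case: (Rle_lt_dec 0 (Im rho)) => h; [exists 1 | exists (-1)] => t ht E; nra.
pose z1 : C := (Re rho + 2, Im rho + sg); pose v : C := (-2, - sg).
have path t : (z1 + RtoC t * v)%C = (Re rho + 2 * (1 - t), Im rho + sg * (1 - t)).
  by rewrite /z1 /v /Cplus /Cmult /RtoC /=; congr (_, _); ring.
have E1 : (z1 + v)%C = rho.
  by have := path 1; rewrite Cmult_1_l => ->; case: (rho) => a b /=; congr (_, _); ring.
have H : Phi (z1 + v)%C = RtoC 0.
  (* For t < 1/2 the real part Re rho + 2 (1 - t) exceeds 1, where L is given by its series. *)
  apply: (identity_on_segment Phi z1 v (1 / 2)); last 1 first.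
  - by move=> t ht; apply: two; rewrite path /Re /= -/(Re rho); lra.
  - by move=> [] h; lra.
  - by lra.
  - move=> t ht; apply: taylor_minus; last first.
      by apply: dser_taylor HB _; rewrite path /Re /= -/(Re rho); lra.
    apply: taylor_mult.
      by apply: (taylor_exp (RtoC 1) kappa (ln 2)); have := ln_lt_2; lra.
    apply: analytic_taylor; apply: (dL_analytic _ _ _ HL).
    case: (Rle_lt_dec 1 t) => ht1.
      have -> : t = 1 by lra.
      by rewrite Cmult_1_l E1.
    by rewrite path => -[_ []] _; apply: sgp; lra.
rewrite E1 /Phi in H.
have -> : ((1 - kappa * cpow 2 (- rho)) * L rho)%C =
  ((1 - kappa * cpow 2 (- rho)) * L rho - Clim (dser eta rho) + Clim (dser eta rho))%C by ring.
by rewrite H Cplus_0_l.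
Qed.

(** * Non-vanishing at 1 for real characters *)

Lemma pow_le_pow_lt1 (x : R) (m n : nat) : 0 <= x <= 1 -> (m <= n)%N -> x ^ n <= x ^ m.
Proof.
move=> hx mn; rewrite -(subnKC mn) -plusE pow_add.
have h1 : 0 <= x ^ m by apply: pow_le; lra.
have h2 : x ^ (n - m) <= 1 by rewrite -(pow1 (n - m)); apply: pow_incr.
nra.
Qed.

Definition geom (x : R) (n : nat) : R := \sumR_(0 <= j < n) x ^ j.

Lemma geomE (x : R) (n : nat) : (1 - x) * geom x n = 1 - x ^ n.
Proof.
rewrite /geom; elim: n => [|n IH]; first by rewrite big_geq //=; ring.
by rewrite big_nat_recr //= Rmult_plus_distr_l IH; ring.
Qed.

Lemma geom_ge (x : R) (n : nat) : 0 <= x <= 1 -> INR n * x ^ n <= geom x n.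
Proof.
move=> hx; have := Rsum_const 0 n (x ^ n); rewrite subn0 => <-.
by apply: Rsum_le_nat => j /andP[_ jn]; apply: pow_le_pow_lt1 => //; apply: ltnW.
Qed.

Lemma geomS (x : R) (n : nat) : geom x n.+1 = 1 + x * geom x n.
Proof. by rewrite /geom big_nat_recl //= big_distrr. Qed.

(** The arithmetic-geometric mean inequality for 1, x, ..., x^n with x = y^2. Writing x as a square
    keeps the geometric mean x^(n/2) = y^n an integral power. *)
Lemma geom_sqr_ge (y : R) (n : nat) : 0 <= y <= 1 -> INR n.+1 * y ^ n <= geom (y ^ 2) n.+1.
Proof.
move=> hy; elim: n => [|n IH].
  by rewrite geomS /geom big_geq //=; lra.
rewrite geomS.
have yn : 0 <= y ^ n by apply: pow_le; lra.
have H1 : y ^ 2 * (INR n.+1 * y ^ n) <= y ^ 2 * geom (y ^ 2) n.+1.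
  by apply: Rmult_le_compat_l => //; apply: pow2_ge_0.
have H2 := geomE y n.+1; have H3 := geom_ge y n.+1 hy.
have H4 : (1 - y) * (INR n.+1 * y ^ n.+1) <= 1 - y ^ n.+1 by rewrite -H2; apply: Rmult_le_compat_l; lra.
rewrite (S_INR n.+1).
have -> : (INR n.+1 + 1) * y ^ n.+1 = (1 - y) * (INR n.+1 * y ^ n.+1) + y ^ n.+1 + y ^ 2 * (INR n.+1 * y ^ n).
  by rewrite -tech_pow_Rmult; ring.
lra.
Qed.

(** The gap between the Lambert term x^n / (1 - x^n) and its approximation 1 / (n (1 - x)) near x =
    1. It is nonnegative and decreasing in n, so partial summation against bounded character sums
    applies. *)
Definition lambert_weight (x : R) (n : nat) : R := / (INR n * (1 - x)) - x ^ n / (1 - x ^ n).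

Lemma lambert_weightE (x : R) (n : nat) : 0 < x < 1 -> (0 < n)%N ->
  0 < geom x n /\ lambert_weight x n = (/ INR n - x ^ n / geom x n) / (1 - x).
Proof.
move=> hx hn; have n0 := INR_pos n hn.
have gp : 0 < geom x n.
  case: n hn n0 => // n _ _; rewrite geomS.
  have : 0 <= geom x n; last by nra.
  by apply: Rsum_ge0 => j _; apply: pow_le; lra.
split=> //; rewrite /lambert_weight -geomE.
by field; repeat split; lra.
Qed.

Lemma lambert_weight_ge0 (x : R) (n : nat) : 0 < x < 1 -> (0 < n)%N -> 0 <= lambert_weight x n.
Proof.
move=> hx hn; have n0 := INR_pos n hn; have [gp ->] := lambert_weightE x n hx hn.
apply: Rdiv_le_0_compat; last by lra.
have := geom_ge x n ltac:(lra) => h.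
have -> : / INR n - x ^ n / geom x n = (geom x n - INR n * x ^ n) / (INR n * geom x n) by field; lra.
by apply: Rdiv_le_0_compat; [lra | apply: Rmult_lt_0_compat].
Qed.

(** With G_n = 1 + x + ... + x^(n-1), the decrease amounts to n (n + 1) x^n <= G_n G_(n+1). The mean
    inequality gives G_n G_(n+1) >= n (n + 1) y^(2n-1), and y^(2n-1) >= y^(2n) = x^n. *)
Lemma lambert_weight_decr (y : R) (n : nat) : 0 < y < 1 -> (0 < n)%N ->
  lambert_weight (y ^ 2) n.+1 <= lambert_weight (y ^ 2) n.
Proof.
move=> hy hn; have hx : 0 < y ^ 2 < 1 by simpl; nra.
have n0 := INR_pos n hn; have n1 := INR_pos n.+1 isT.
have [g0 E0] := lambert_weightE _ n hx hn; have [g1 E1] := lambert_weightE _ n.+1 hx isT.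
have D : lambert_weight (y ^ 2) n - lambert_weight (y ^ 2) n.+1 =
  (geom (y ^ 2) n * geom (y ^ 2) n.+1 - INR n * INR n.+1 * (y ^ 2) ^ n) /
  (INR n * INR n.+1 * geom (y ^ 2) n * geom (y ^ 2) n.+1 * (1 - y ^ 2)).
  have gS := geomS (y ^ 2) n.
  rewrite E0 E1 -tech_pow_Rmult.
  rewrite S_INR in n1 *.
  have -> : forall G G' X : R, G' = 1 + y ^ 2 * G -> 0 < G -> 0 < G' ->
    (/ INR n - X / G) / (1 - y ^ 2) - (/ (INR n + 1) - y ^ 2 * X / G') / (1 - y ^ 2) =
    (G * G' - INR n * (INR n + 1) * X) / (INR n * (INR n + 1) * G * G' * (1 - y ^ 2)) => //.
  move=> G G' X EG hG hG'.
  have -> : y ^ 2 * X / G' = X / G - X / (G * G').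
    have -> : y ^ 2 = (G' - 1) / G by rewrite EG; field; lra.
    by field; lra.
  by field; repeat split; lra.
have h : 0 <= (geom (y ^ 2) n * geom (y ^ 2) n.+1 - INR n * INR n.+1 * (y ^ 2) ^ n) /
  (INR n * INR n.+1 * geom (y ^ 2) n * geom (y ^ 2) n.+1 * (1 - y ^ 2)); last by lra.
apply: Rdiv_le_0_compat; last by repeat apply: Rmult_lt_0_compat => //; lra.
case: n hn n0 n1 g0 E0 g1 E1 D => // n _ n0 n1 g0 _ g1 _ _.
have a := geom_sqr_ge y n ltac:(lra); have b := geom_sqr_ge y n.+1 ltac:(lra).
have yp k : 0 < y ^ k by apply: pow_lt; lra.
have := Rmult_le_compat _ _ _ _ _ _ a b.
have -> : INR n.+1 * y ^ n * (INR n.+2 * y ^ n.+1) = INR n.+1 * INR n.+2 * (y ^ n * y ^ n.+1) by ring.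
have E : (y ^ 2) ^ n.+1 = y * (y ^ n * y ^ n.+1).
  have -> : y ^ 2 = y * y by ring.
  by rewrite Rpow_mult_distr -tech_pow_Rmult; ring.
move=> H.
have {}H := H (Rmult_le_pos _ _ (Rlt_le _ _ n0) (Rlt_le _ _ (yp n))) (Rmult_le_pos _ _ (Rlt_le _ _ n1) (Rlt_le _ _ (yp n.+1))).
rewrite E; have := yp n; have := yp n.+1.
move: (y ^ n) (y ^ n.+1) H => A B H B0 A0.
have : INR n.+1 * INR n.+2 * (y * (A * B)) <= INR n.+1 * INR n.+2 * (A * B); last by lra.
apply: Rmult_le_compat_l; first by apply: Rmult_le_pos; lra.
have : 0 < A * B by apply: Rmult_lt_0_compat.
nra.
Qed.

Lemma is_lim_seq_mul_pow (y : R) : 0 < y < 1 -> is_lim_seq (fun n => INR n * (y ^ 2) ^ n) 0.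
Proof.
move=> hy.
have L : is_lim_seq (fun n => / (1 - y) * y ^ n) 0.
  have := is_lim_seq_scal_l _ (/ (1 - y)) _ (is_lim_seq_geom y _); rewrite /= Rmult_0_r; apply.
  by rewrite Rabs_pos_eq; lra.
apply: (is_lim_seq_0_le _ _ 0 _ L) => n _.
have yn : 0 <= y ^ n by apply: pow_le; lra.
split; first by apply: Rmult_le_pos; [exact: pos_INR | apply: pow_le; apply: pow2_ge_0].
have -> : (y ^ 2) ^ n = y ^ n * y ^ n by rewrite -Rpow_mult_distr; congr pow; ring.
rewrite -Rmult_assoc; apply: Rmult_le_compat_r => //.
apply: (Rle_trans _ _ _ (geom_ge y n ltac:(lra))).
apply: (Rmult_le_reg_l (1 - y)); first by lra.
by rewrite geomE Rinv_r; lra.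
Qed.

Lemma lambert_inner (x : R) (m k : nat) : 0 < x < 1 -> (0 < m)%N ->
  \sumR_(1 <= d < k.+1) (x ^ (m * d)%N) = x ^ m / (1 - x ^ m) - x ^ (m * k.+1)%N / (1 - x ^ m).
Proof.
move=> hx hm.
have [_ xm] := pow_lt_1_compat x m ltac:(lra) (ltP hm).
elim: k => [|k IH]; first by rewrite big_geq // muln1; field; lra.
rewrite big_nat_recr //= IH (mulnS m k.+1) -plusE pow_add; field; lra.
Qed.

(** Each Lambert term is 1 / (n (1 - x)) minus its weight, and cutting the inner geometric sums at N
    / m leaves the last summand. The weights decrease from the value 1 at n = 1, whence 2 C0. *)
Lemma lambert_bound (c : nat -> R) (C0 y : R) (N : nat) :
  bounded_sums (fun n => RtoC (c n)) C0 -> (forall n, Rabs (c n) <= 1) -> 0 < y < 1 ->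
  \sumR_(1 <= n < N.+1) (divisor_sum c n * (y ^ 2) ^ n) <=
    Cmod (\sumC_(1 <= n < N.+1) (RtoC (c n) * RtoC (/ INR n))) / (1 - y ^ 2) + 2 * C0
    + INR N * (y ^ 2) ^ N / (1 - y ^ 2).
Proof.
move=> HB c1 hy; set x := y ^ 2.
have hx : 0 < x < 1 by rewrite /x /=; nra.
have xm m : (0 < m)%N -> x ^ m <= x.
  by move=> hm; rewrite -[X in _ <= X]pow_1; apply: pow_le_pow_lt1 => //; lra.
have E : RtoC (\sumR_(1 <= n < N.+1) (divisor_sum c n * x ^ n)) =
  ((RtoC (/ (1 - x)) * \sumC_(1 <= n < N.+1) (RtoC (c n) * RtoC (/ INR n)))
   - (\sumC_(1 <= n < N.+1) (RtoC (c n) * RtoC (lambert_weight x n)))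
   - \sumC_(1 <= m < N.+1) (RtoC (c m) * RtoC (x ^ (m * (N %/ m).+1)%N / (1 - x ^ m))))%C.
  rewrite RtoC_sum.
  transitivity (\sumC_(1 <= n < N.+1) (RtoC (divisor_sum c n) * RtoC (x ^ n))).
    by apply: eq_bigr => n _; rewrite RtoC_mult.
  rewrite -(divisor_sum_convolution c (fun n => RtoC (x ^ n))) big_distrr -!Csum_minus.
  rewrite big_nat [RHS]big_nat; apply: eq_bigr => m /andP[m0 _] /=.
  rewrite -RtoC_sum lambert_inner // /lambert_weight.
  have := xm m m0; have := INR_pos m m0 => h1 h2.
  by rewrite -!RtoC_mult -!RtoC_minus; congr RtoC; field; lra.
have B1 : Cmod (\sumC_(1 <= n < N.+1) (RtoC (c n) * RtoC (lambert_weight x n))) <= 2 * C0.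
  have := dirichlet_test (fun n => RtoC (c n)) (fun n => RtoC (lambert_weight x n)) (lambert_weight x) C0 HB.
  have l1 : lambert_weight x 1 = 1 by rewrite /lambert_weight /=; field; lra.
  move=> H; have := H _ _ 0%N N isT; rewrite l1 Rmult_1_r; apply => d d0.
    by rewrite Cmod_R Rabs_pos_eq; [lra | apply: lambert_weight_ge0].
  rewrite -RtoC_minus Cmod_R Rabs_pos_eq; first by lra.
  by have := lambert_weight_decr y d hy d0; rewrite -/x; lra.
have B2 : Cmod (\sumC_(1 <= m < N.+1) (RtoC (c m) * RtoC (x ^ (m * (N %/ m).+1)%N / (1 - x ^ m)))) <=
   INR N * x ^ N / (1 - x).
  apply: (Rle_trans _ _ _ (Cmod_sum _ _ _ _)).
  apply: (Rle_trans _ (\sumR_(1 <= m < N.+1) (x ^ N / (1 - x)))); last first.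
    by rewrite Rsum_const subn1 [_.-1]/=; right; field; lra.
  apply: Rsum_le_nat => m /andP[m0 mN].
  have h1 := xm m m0.
  have h2 : x ^ (m * (N %/ m).+1) <= x ^ N.
    by apply: pow_le_pow_lt1; [lra | rewrite mulnC; apply: ltnW; apply: ltn_ceil].
  have p0 k : 0 < x ^ k by apply: pow_lt; lra.
  have q0 : 0 <= x ^ (m * (N %/ m).+1) / (1 - x ^ m) by apply: Rdiv_le_0_compat; [left; apply: p0 | lra].
  rewrite Cmod_mult !Cmod_R (Rabs_pos_eq (_ / _)) //.
  apply: (Rle_trans _ (1 * (x ^ N / (1 - x)))); last by lra.
  apply: Rmult_le_compat => //; first exact: Rabs_pos.
  apply: Rmult_le_compat => //; first by left; apply: p0.
    by left; apply: Rinv_0_lt_compat; lra.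
  by apply: Rinv_le_contravar; lra.
set S := \sumR_(_ <= _ < _) _ in E *.
have : S <= Cmod (RtoC S) by rewrite Cmod_R; apply: Rle_abs.
rewrite E => H; apply: (Rle_trans _ _ _ H).
apply: (Rle_trans _ _ _ (Cmod_triangle_sub _ _)); apply: Rplus_le_compat => //.
apply: (Rle_trans _ _ _ (Cmod_triangle_sub _ _)); apply: Rplus_le_compat => //.
rewrite Cmod_mult Cmod_R Rabs_pos_eq; first by rewrite /Rdiv Rmult_comm; lra.
by left; apply: Rinv_0_lt_compat; lra.
Qed.

Lemma bernoulli_lower (y : R) (n : nat) : 0 <= y <= 1 -> 1 - INR n * (1 - y) <= y ^ n.
Proof.
move=> hy; elim: n => [|n IH]; first by rewrite /=; lra.
have h : 0 <= y ^ n <= 1 by split; [apply: pow_le; lra | rewrite -(pow1 n); apply: pow_incr].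
rewrite S_INR -tech_pow_Rmult; nra.
Qed.

(* Monsky's argument: the Lambert series [sum c(n) x^n / (1 - x^n) = sum (1 * c)(n) x^n] is
   unbounded as [x -> 1] since [1 * c >= 1] on squares, while [sum c(n) / n = 0] would bound it. *)
Lemma real_character_sum_neq0 (c : nat -> R) (C0 : R) : completely_multiplicative c ->
  (forall m, c m = 1 \/ c m = 0 \/ c m = -1) ->
  bounded_sums (fun n => RtoC (c n)) C0 ->
  ~ Ccv (fun N => \sumC_(1 <= n < N.+1) (RtoC (c n) * RtoC (/ INR n))) (RtoC 0).
Proof.
move=> hc c3 HB H0.
have C0p := bounded_sums_ge0 _ _ HB.
have c1 n : Rabs (c n) <= 1.
  by case: (c3 n) => [->|[->|->]]; rewrite /Rabs; case: Rcase_abs; lra.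
have low K y : 0 < y < 1 -> \sumR_(1 <= k < K.+1) ((y ^ 2) ^ (k * k)%N) <=
    \sumR_(1 <= n < (K * K).+1) (divisor_sum c n * (y ^ 2) ^ n).
  move=> hy; have xp k : 0 <= (y ^ 2) ^ k by apply: pow_le; apply: pow2_ge_0.
  elim: K => [|K IH]; first by rewrite !big_geq //; lra.
  rewrite [X in X <= _]Rsum_recr // [X in _ <= X]Rsum_recr //.
  have -> : \sumR_(1 <= n < K.+1 * K.+1) (divisor_sum c n * (y ^ 2) ^ n) =
    (\sumR_(1 <= n < (K * K).+1) (divisor_sum c n * (y ^ 2) ^ n)) +
    \sumR_((K * K).+1 <= n < K.+1 * K.+1) (divisor_sum c n * (y ^ 2) ^ n).
    by rewrite (big_cat_nat (n := (K * K).+1)) // ltn_mul.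
  have [_ /(_ (ex_intro _ K.+1 erefl)) h1] := divisor_sum_ge0 c (K.+1 * K.+1)%N hc c3 isT.
  have h2 : 0 <= \sumR_((K * K).+1 <= n < K.+1 * K.+1) (divisor_sum c n * (y ^ 2) ^ n).
    rewrite big_nat_cond; apply: Rsum_ge0 => n /andP[/andP[n0 _] _].
    apply: Rmult_le_pos => //; case: (divisor_sum_ge0 c n hc c3) => //.
    exact: leq_ltn_trans n0.
  have := xp (K.+1 * K.+1)%N; set X := (y ^ 2) ^ _ => hX.
  have : X <= divisor_sum c (K.+1 * K.+1) * X by nra.
  by move: IH; rewrite /X; lra.
have up K y : 0 < y < 1 -> \sumR_(1 <= k < K.+1) ((y ^ 2) ^ (k * k)%N) <= 2 * C0.
  move=> hy.
  have L : is_lim_seq (fun N => Cmod (\sumC_(1 <= n < N.+1) (RtoC (c n) * RtoC (/ INR n))) / (1 - y ^ 2) + 2 * C0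
    + INR N * (y ^ 2) ^ N / (1 - y ^ 2)) (2 * C0).
    have l1 := Cmod_lim _ _ H0; rewrite Cmod_0 in l1.
    have l2 := is_lim_seq_scal_r _ (/ (1 - y ^ 2)) _ l1.
    have l3 := is_lim_seq_scal_r _ (/ (1 - y ^ 2)) _ (is_lim_seq_mul_pow y hy).
    rewrite [Rbar_mult _ _]/= Rmult_0_l in l2; rewrite [Rbar_mult _ _]/= Rmult_0_l in l3.
    have := is_lim_seq_plus' _ _ _ _ (is_lim_seq_plus' _ _ _ _ l2 (is_lim_seq_const (2 * C0))) l3.
    by rewrite Rplus_0_l Rplus_0_r.
  apply: (is_lim_seq_le_loc (fun _ => _) _ _ (2 * C0) _ (is_lim_seq_const _) L).
  exists (K * K)%N => N /leP hN.
  apply: (Rle_trans _ _ _ (low K y hy)).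
  apply: (Rle_trans _ _ _ _ (lambert_bound c C0 y N HB c1 hy)).
  rewrite [X in _ <= X](Rsum_split _ 1 (K * K).+1 N.+1) //.
  have : 0 <= \sumR_((K * K).+1 <= n < N.+1) (divisor_sum c n * (y ^ 2) ^ n); last by lra.
  rewrite big_nat_cond; apply: Rsum_ge0 => n /andP[/andP[n0 _] _].
  apply: Rmult_le_pos; last by apply: pow_le; apply: pow2_ge_0.
  by case: (divisor_sum_ge0 c n hc c3) => //; exact: leq_ltn_trans n0.
have [K hK] : exists K : nat, 4 * C0 + 1 < INR K.
  have [K hK] := INR_unbounded (4 * C0 + 1); by exists K.
have K1 : 1 <= INR K by lra.
(* By Bernoulli's inequality y^(2 K^2) >= 1 - 2 K^2 / (4 K^2) = 1/2. So the K squares contribute at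
   least K / 2, more than the upper bound 2 C0. *)
set y := 1 - / (4 * (INR K * INR K)).
have K2 : 0 < 4 * (INR K * INR K) by nra.
have i1 : 0 < / (4 * (INR K * INR K)) by apply: Rinv_0_lt_compat.
have i2 : / (4 * (INR K * INR K)) <= / 4 by apply: Rinv_le_contravar; nra.
have hy : 0 < y < 1 by rewrite /y; lra.
have hb : / 2 <= (y ^ 2) ^ (K * K)%N.
  rewrite -pow_mult; apply: (Rle_trans _ _ _ _ (bernoulli_lower y _ ltac:(lra))).
  rewrite multE -!multE !mult_INR /y [INR 2]/=; right; field; lra.
have := up K y hy.
have : \sumR_(1 <= k < K.+1) (/ 2) <= \sumR_(1 <= k < K.+1) ((y ^ 2) ^ (k * k)%N).
  apply: Rsum_le_nat => k /andP[k0 kK]; apply: (Rle_trans _ _ _ hb).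
  apply: pow_le_pow_lt1; last by rewrite leq_mul.
  by rewrite /=; nra.
rewrite Rsum_const subn1 [_.-1]/=; lra.
Qed.

Lemma Zgcd1_coprime (a q : Z) : (0 <= a)%Z -> (0 < q)%Z -> Z.gcd a q = 1%Z ->
  coprime (Z.to_nat a) (Z.to_nat q).
Proof.
move=> ha hq g1.
have [u [v Euv]] := Z.gcd_bezout _ _ _ g1.
rewrite /coprime; apply/eqP.
set g := gcdn _ _.
have [k1 Ek1] : exists k, Z.to_nat a = (k * g)%N by apply/dvdnP; apply: dvdn_gcdl.
have [k2 Ek2] : exists k, Z.to_nat q = (k * g)%N by apply/dvdnP; apply: dvdn_gcdr.
have D : (Z.of_nat g | 1)%Z.
  rewrite -Euv; apply: Z.divide_add_r; apply: Z.divide_mul_r.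
    by exists (Z.of_nat k1); rewrite -Nat2Z.inj_mul multE -Ek1 Z2Nat.id; lia.
  by exists (Z.of_nat k2); rewrite -Nat2Z.inj_mul multE -Ek2 Z2Nat.id; lia.
have := Z.divide_1_r_nonneg _ (Zle_0_nat g) D; lia.
Qed.

Lemma nonprincipal_witness (q : Z) (chi : Z -> C) : dirichlet_character q chi ->
  ~ principal_character q chi ->
  exists b : nat, coprime b (Z.to_nat q) /\ chi (Z.of_nat b) <> RtoC 1.
Proof.
move=> hchi hn; have [hq hper _ _] := hchi.
have hf := dirichlet_nat_character _ _ hchi.
apply: NNPP => H; apply: hn => a ha.
apply: NNPP => h1; apply: H.
have hm : (0 <= a mod q < q)%Z by apply: Z.mod_pos_bound.
exists (Z.to_nat (a mod q)); split; last first.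
  rewrite Z2Nat.id; last by lia.
  have per k : forall x, chi (x + Z.of_nat k * q)%Z = chi x.
    elim: k => [|k IH] x; first by congr chi; lia.
    by rewrite -[RHS](IH x) -[RHS]hper; congr chi; lia.
  have E : a = (a mod q + q * (a / q))%Z by have := Z.div_mod a q; lia.
  move=> E1; apply: h1; rewrite -E1; case: (Z_le_gt_dec 0 (a / q)) => hd.
    transitivity (chi (a mod q + Z.of_nat (Z.to_nat (a / q)) * q)%Z); last exact: per.
    by congr chi; rewrite Z2Nat.id //; lia.
  transitivity (chi (a + Z.of_nat (Z.to_nat (- (a / q))) * q)%Z); first by rewrite per.
  by congr chi; rewrite Z2Nat.id; lia.
apply: Zgcd1_coprime; [lia | lia |].
rewrite Z.gcd_mod; last by lia.
by rewrite Z.gcd_comm; exact: ha.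
Qed.

Lemma nonprincipal_bounded (q : Z) (chi : Z -> C) : dirichlet_character q chi ->
  ~ principal_character q chi ->
  bounded_sums (fun n => chi (Z.of_nat n)) (1 * INR (Z.to_nat q) + 1).
Proof.
move=> hchi hn; have hf := dirichlet_nat_character _ _ hchi.
have [b [cb hb]] := nonprincipal_witness q chi hchi hn.
apply: periodic_bounded.
- exact: nc_pos hf.
- exact: nc_per hf.
- by move=> n; apply: nc_le1 hf.
- exact: nc_sum_zero hf cb hb.
Qed.

(** A principal character is induced from modulus 1, so primitivity leaves zeta alone as an
    L-function with a pole. The twist with kappa = 2 is designed for exactly this case. *)
Lemma primitive_principal (q : Z) (chi : Z -> C) : primitive_character q chi ->
  principal_character q chi -> q = 1%Z /\ forall a, chi a = RtoC 1.
Proof.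
move=> [hchi hprim] hp; have q0 := dc_modulus _ _ hchi.
have q1 : q = 1%Z.
  apply: NNPP => hq; apply: hprim; exists 1%Z, (fun _ => RtoC 1).
  split; first by exists q; lia.
  split; first by lia.
  split; last by move=> a ha; rewrite hp.
  split=> //.
  - by move=> a b; rewrite Cmult_1_l.
  - by move=> a; rewrite Z.gcd_1_r; split => // _ /RtoC_inj; lra.
by split=> // a; apply: hp; rewrite q1 Z.gcd_1_r.
Qed.

Lemma nat_character_sqr (Q : nat) (f : nat -> C) : nat_character Q f ->
  nat_character Q (fun n => f n * f n)%C.
Proof.
move=> H; split.
- exact: nc_pos H.
- by rewrite (nc_one _ _ H) Cmult_1_l.
- by move=> m n; rewrite (nc_mul _ _ H); ring.
- by move=> n; rewrite (nc_per _ _ H).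
Qed.

Lemma twist2_0 (f : nat -> C) (n : nat) : twist2 (RtoC 0) f n = f n.
Proof. by rewrite /twist2 Cmult_0_l; ring. Qed.

(** If chi^2 does not sum to zero over a period, orthogonality forces chi^2 to be 1 wherever chi is
    nonzero, so chi is real. A zero at 1 would then make the sum of c(n) / n vanish, against
    [real_character_sum_neq0]. *)
Lemma no_zero_at_one_real (q : Z) (chi : Z -> C) (L : C -> C) :
  dirichlet_character q chi -> is_dirichlet_L q chi L -> ~ principal_character q chi ->
  \sumC_(0 <= d < Z.to_nat q) (chi (Z.of_nat d) * chi (Z.of_nat d)) <> RtoC 0 ->
  L (RtoC 1) <> RtoC 0.
Proof.
move=> hchi HL hnp hsum L0.
have hf := dirichlet_nat_character _ _ hchi; set f := fun n => chi (Z.of_nat n) in hf.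
have hB := nonprincipal_bounded q chi hchi hnp.
have q0 := dc_modulus _ _ hchi.
have sq n : f n = RtoC 0 \/ (f n * f n)%C = RtoC 1.
  case: (nc_norm _ _ n hf) => [|h1]; [by left | right].
  apply: NNPP => h; apply: hsum.
  apply: (nc_sum_zero _ _ n (nat_character_sqr _ _ hf)) => //.
  rewrite -(Nat2Z.id n); apply: Zgcd1_coprime => //; first by lia.
  by apply/(dc_support _ _ hchi) => E; move: h1; rewrite /f E Cmod_0; lra.
pose c n := Re (f n).
have c3 n : f n = RtoC (c n) /\ (c n = 1 \/ c n = 0 \/ c n = -1).
  case: (sq n) => [E|E]; first by rewrite /c E /=; auto.
  have : ((f n - 1) * (f n + 1))%C = RtoC 0.
    have -> : ((f n - 1) * (f n + 1))%C = (f n * f n - 1)%C by ring.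
    by rewrite E; ring.
  case/Cmult_integral => E1.
    have E2 : f n = RtoC 1 by have -> : f n = (f n - 1 + 1)%C by [ring]; rewrite E1; ring.
    by rewrite /c E2 /=; auto.
  have E2 : f n = RtoC (-1).
    have -> : -1 = - (1) by ring.
    by have -> : f n = (f n + 1 - 1)%C by [ring]; rewrite E1 RtoC_opp; ring.
  by rewrite /c E2 /=; auto.
apply: (real_character_sum_neq0 c (1 * INR (Z.to_nat q) + 1)).
- split; first by rewrite /c (nc_one _ _ hf).
  move=> m n _ _; apply: RtoC_inj; rewrite RtoC_mult.
  by rewrite -(proj1 (c3 _)) -(proj1 (c3 _)) -(proj1 (c3 _)) (nc_mul _ _ hf).
- by move=> m; case: (c3 m).
- move=> n; have := hB n; congr (Cmod _ <= _).
  by apply: eq_bigr => d _; case: (c3 d).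
have Hdom : L_domain q chi (RtoC 1) by case.
have hB0 : bounded_sums (twist2 (RtoC 0) f) (1 * INR (Z.to_nat q) + 1).
  by move=> n; have := hB n; congr (Cmod _ <= _); apply: eq_bigr => d _; rewrite twist2_0.
have := L_continuation q chi L (RtoC 1) (RtoC 0) _ HL Hdom ltac:(rewrite /=; lra) hB0.
rewrite L0 Cmult_0_r => E.
have [cv _] := dser_cv _ _ (RtoC 1) hB0 ltac:(rewrite /=; lra).
rewrite -E in cv; apply: Ccv_ext cv => N.
rewrite /dser big_nat [RHS]big_nat; apply: eq_bigr => d /andP[d0 _].
have dp := INR_pos d d0.
by rewrite twist2_0 (proj1 (c3 d)) cpow_opp cpow_id // RtoC_inv; [| lra].
Qed.

Lemma no_zero_right (q : Z) (chi : Z -> C) (L : C -> C) (rho : C) :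
  dirichlet_character q chi -> is_dirichlet_L q chi L -> L_domain q chi rho ->
  1 <= Re rho -> L rho <> RtoC 0.
Proof.
move=> hchi HL Hdom hre.
have hf := dirichlet_nat_character _ _ hchi.
case: (Req_dec (Re rho) 1) => hr1; last first.
  have hr : 1 < Re rho by lra.
  have cv := L_series_cv _ _ _ rho HL hr.
  have [cv2 _] := dser_abs_cv _ rho (cm_le1 _ (nc_cmult _ _ hf)) hr.
  rewrite (Ccv_unique _ _ _ cv cv2); apply: dser_neq0 => //.
  exact: nc_cmult hf.
case: (Req_dec (Im rho) 0) => him; last by apply: (no_zero_line_one_case q chi L rho) => //; left.
case: (classic (\sumC_(0 <= d < Z.to_nat q) (chi (Z.of_nat d) * chi (Z.of_nat d)) = RtoC 0)) => hs.
  by apply: (no_zero_line_one_case q chi L rho) => //; right.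
have E : rho = RtoC 1 by move: hr1 him; case: (rho) => a b /= -> ->.
rewrite E in Hdom *; apply: no_zero_at_one_real hs => //.
by move=> hp; apply: Hdom.
Qed.

(** * Duality and the large sieve for Farey fractions *)

Lemma cderive_e (k t : R) : cderive (fun x => e (k * x)) t (RtoC (2 * PI * k) * Ci * e (k * t))%C.
Proof.
have := cderive_Cexp (RtoC (2 * PI * k) * Ci)%C t.
have E x : Cexp (RtoC (2 * PI * k) * Ci * RtoC x) = e (k * x).
  rewrite /e; congr Cexp.
  by have -> : 2 * PI * (k * x) = (2 * PI * k) * x by [ring]; rewrite (RtoC_mult _ x); ring.
by rewrite E; apply: cderive_ext.
Qed.

Lemma continuous_cderive_Re (phi : R -> C) (t : R) (d : C) :
  cderive phi t d -> continuous (fun x => Re (phi x)) t /\ continuous (fun x => Im (phi x)) t.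
Proof.
move=> [h1 h2]; split.
  by apply: (ex_derive_continuous (V := R_NormedModule)); exists (Re d).
by apply: (ex_derive_continuous (V := R_NormedModule)); exists (Im d).
Qed.

Lemma is_RInt_e_nonzero (z : C) (k : Z) : (k <> 0)%Z ->
  is_RInt (fun x => Re (z * e (IZR k * x))%C) 0 1 0.
Proof.
move=> hk; have k0 : IZR k <> 0 by apply: not_0_IZR.
have pk : 2 * PI * IZR k <> 0 by have := PI_RGT_0 => pp /Rmult_integral [|//]; lra.
pose w := (z / (RtoC (2 * PI * IZR k) * Ci))%C.
have cn : (RtoC (2 * PI * IZR k) * Ci)%C <> RtoC 0.
  move=> /(congr1 Cmod); rewrite Cmod_mult Cmod_Ci Cmod_R Cmod_0 Rmult_1_r => /Rabs_eq_0; lra.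
have D t : cderive (fun x => w * e (IZR k * x))%C t (z * e (IZR k * t))%C.
  have := cderive_scal w _ t _ (cderive_e (IZR k) t).
  have -> // : (w * (RtoC (2 * PI * IZR k) * Ci * e (IZR k * t)))%C = (z * e (IZR k * t))%C.
  have -> : (w * (RtoC (2 * PI * IZR k) * Ci * e (IZR k * t)))%C = (w * (RtoC (2 * PI * IZR k) * Ci) * e (IZR k * t))%C by ring.
  congr Cmult; rewrite /w; move: cn; move: (RtoC _ * Ci)%C => c cn.
  by field.
have := is_RInt_derive (fun x => Re (w * e (IZR k * x))%C) (fun x => Re (z * e (IZR k * x))%C) 0 1.
rewrite Rmult_0_r Rmult_1_r e_Z e_0 => H.
have {H} : is_RInt (fun x => Re (z * e (IZR k * x))%C) 0 1 (minus (Re (w * RtoC 1)%C) (Re (w * RtoC 1)%C)).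
  apply: H => x _; first by case: (D x).
  by case: (continuous_cderive_Re _ _ _ (cderive_scal z _ x _ (cderive_e (IZR k) x))).
by rewrite minus_eq_zero.
Qed.

Lemma is_RInt_e (z : C) (k : Z) :
  is_RInt (fun x => Re (z * e (IZR k * x))%C) 0 1 (if Z.eqb k 0 then Re z else 0).
Proof.
case: Z.eqb_spec => [->|]; last exact: is_RInt_e_nonzero.
have := @is_RInt_const R_NormedModule 0 1 (Re z).
have -> : scal (1 - 0) (Re z) = Re z by rewrite /scal /= /mult /=; ring.
by apply: is_RInt_ext => x _; rewrite Rmult_0_l e_0 Cmult_1_r.
Qed.

Lemma is_RInt_sum (I : Type) (r : seq I) (P : pred I) (f : I -> R -> R) (v : I -> R) (a b : R) :
  (forall i, P i -> is_RInt (f i) a b (v i)) ->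
  is_RInt (fun x => \sumR_(i <- r | P i) f i x) a b (\sumR_(i <- r | P i) v i).
Proof.
move=> H; elim: r => [|i r IH].
  rewrite big_nil; have := @is_RInt_const R_NormedModule a b 0.
  have -> : scal (b - a) (0 : R_NormedModule) = 0 by rewrite /scal /= /mult /=; ring.
  by apply: is_RInt_ext => x _; rewrite big_nil.
rewrite big_cons; case Pi : (P i).
  apply: (is_RInt_ext (fun x => f i x + \sumR_(j <- r | P j) f j x)).
    by move=> x _; rewrite big_cons Pi.
  by apply: (is_RInt_plus (V := R_NormedModule)) => //; apply: H.
by apply: is_RInt_ext IH => x _; rewrite big_cons Pi.
Qed.

Definition expsum (a : nat -> C) (N : nat) (x : R) : C :=
  \sumC_(1 <= n < N.+1) (a n * e (INR n * x)).

Lemma cderive_expsum (a : nat -> C) (N : nat) (x : R) : exists d, cderive (expsum a N) x d.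
Proof.
elim: N => [|N [d IH]].
  exists (RtoC 0); apply: (cderive_ext (fun _ => RtoC 0)); last exact: cderive_const.
  by move=> y; rewrite /expsum big_geq.
eexists; apply: (cderive_ext (fun y => expsum a N y + a N.+1 * e (INR N.+1 * y))%C).
  by move=> y; rewrite /expsum [in RHS]big_nat_recr.
by apply: cderive_plus; [exact: IH | apply: cderive_scal; apply: cderive_e].
Qed.

Lemma continuous_Cmod_expsum (a : nat -> C) (N : nat) (x : R) :
  continuous (fun y => Cmod (expsum a N y)) x.
Proof.
have [d /continuous_cderive_Re [h1 h2]] := cderive_expsum a N x.
apply: (continuous_ext (fun y => sqrt (Re (expsum a N y) * Re (expsum a N y) + Im (expsum a N y) * Im (expsum a N y)))).
  by move=> y; rewrite /Cmod; congr sqrt; rewrite /Re /Im /=; ring.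
apply: continuous_sqrt_comp.
by apply: (continuous_plus (V := R_NormedModule)); apply: (continuous_mult (K := R_AbsRing)).
Qed.

(** Orthogonality writes the sum of a_n b_n as the integral of A(x) B(-x), which is at most the sup
    norm of B times the L1 norm of A. The rotation [u] makes the integral real. *)
Lemma expsum_duality (a b : nat -> C) (N : nat) (B : R) :
  (forall x, Cmod (expsum b N (- x)) <= B) ->
  Cmod (\sumC_(1 <= n < N.+1) (a n * b n)) <= B * RInt (fun x => Cmod (expsum a N x)) 0 1.
Proof.
move=> HB; set T := \sumC_(_ <= _ < _) _.
have [u [u1 uT]] := unimodular_rotation T.
pose G x := \sumR_(1 <= n < N.+1) \sumR_(1 <= m < N.+1)
  Re (u * (a n * b m) * e (IZR (Z.of_nat n - Z.of_nat m) * x))%C.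
have GE x : G x = Re (u * (expsum a N x * expsum b N (- x)))%C.
  rewrite /G /expsum big_distrl big_distrr Re_sum; apply: eq_bigr => n _; cbv beta.
  rewrite -[RHS]/(Re (u * (a n * e (INR n * x) * _))%C) big_distrr big_distrr Re_sum; apply: eq_bigr => m _; congr Re.
  have -> : e (IZR (Z.of_nat n - Z.of_nat m) * x) = (e (INR n * x) * e (INR m * - x))%C.
    by rewrite -e_add; congr e; rewrite minus_IZR -!INR_IZR_INZ; ring.
  by rewrite /=; ring.
have IG : is_RInt G 0 1 (Cmod T).
  have -> : Cmod T = \sumR_(1 <= n < N.+1) \sumR_(1 <= m < N.+1)
    (if Z.eqb (Z.of_nat n - Z.of_nat m) 0 then Re (u * (a n * b m))%C else 0).
    have -> : Cmod T = Re (u * T)%C by rewrite uT.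
    rewrite /T big_distrr Re_sum big_nat [RHS]big_nat; apply: eq_bigr => n hn; cbv beta.
    rewrite (eq_bigr (fun m => if m == n then Re (u * (a n * b m))%C else 0)); last first.
      move=> m _; case: Z.eqb_spec => h; case: eqP => h' //; exfalso; [apply: h' | apply: h]; lia.
    by rewrite -big_mkcond big_nat1_eq hn.
  by apply: is_RInt_sum => n _; apply: is_RInt_sum => m _; apply: is_RInt_e.
have IS : ex_RInt (fun x => Cmod (expsum a N x)) 0 1.
  by apply: (ex_RInt_continuous (V := R_CompleteNormedModule)) => x _; apply: continuous_Cmod_expsum.
have H := is_RInt_scal (V := R_NormedModule) _ 0 1 B _ (RInt_correct _ _ _ IS).
apply: (is_RInt_le _ _ 0 1 _ _ ltac:(lra) IG H) => x _.
rewrite GE -[X in _ <= X]/(B * Cmod (expsum a N x)); have := re_le_Cmod (u * (expsum a N x * expsum b N (- x)))%C.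
rewrite !Cmod_mult u1 Rmult_1_l.
have := Rle_abs (Re (u * (expsum a N x * expsum b N (- x)))%C).
have := Rmult_le_compat_l _ _ _ (Cmod_ge_0 (expsum a N x)) (HB x); lra.
Qed.

(** * Kernel bounds and separated points *)

Lemma sin_ge_quarter (x : R) : 0 <= x <= PI / 2 -> x / 4 <= sin x.
Proof.
move=> hx; have pp := PI_RGT_0; have p4 := PI_4.
case: (Rle_lt_dec x (PI / 3)) => h.
  have [c []] := MVT_gen sin 0 x cos (fun y _ => is_derive_sin y) (fun y _ => continuity_sin y).
  rewrite Rmin_left ?Rmax_right; try lra.
  move=> hc; rewrite sin_0 !Rminus_0_r => ->.
  have : cos (PI / 3) <= cos c by apply: cos_decr_1; lra.
  by rewrite cos_PI3; nra.
have : sin (PI / 3) <= sin x by apply: sin_incr_1; lra.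
rewrite sin_PI3; have : 1 <= sqrt 3 by rewrite -{1}sqrt_1; apply: sqrt_le_1; lra.
lra.
Qed.

Lemma sin_PI_ge (f : R) : 0 <= f <= 1 -> Rmin f (1 - f) / 2 <= sin (PI * f).
Proof.
move=> hf; have pp := PI_RGT_0; have p2 := PI2_1.
case: (Rle_lt_dec f (1 / 2)) => h.
  rewrite Rmin_left; last by lra.
  have := sin_ge_quarter (PI * f) ltac:(nra); nra.
rewrite Rmin_right; last by lra.
have -> : PI * f = PI - PI * (1 - f) by ring.
rewrite sin_PI_x.
have := sin_ge_quarter (PI * (1 - f)) ltac:(nra); nra.
Qed.

Lemma harmonic_le (N : nat) : (0 < N)%N -> \sumR_(1 <= d < N.+1) / INR d <= 1 + ln (INR N).
Proof.
elim: N => // N IH _; case: N IH => [|N] IH.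
  by rewrite big_nat1 [INR 1]/= ln_1 Rinv_1; lra.
rewrite Rsum_recr //; have := IH isT.
have n1 := INR_pos N.+1 isT; have n2 := INR_pos N.+2 isT.
have : / INR N.+2 <= ln (INR N.+2) - ln (INR N.+1); last by lra.
have := exp_ineq1_le (ln (INR N.+1 / INR N.+2)).
have q : 0 < INR N.+1 / INR N.+2 by apply: Rdiv_lt_0_compat.
rewrite exp_ln // ln_div //.
have -> : INR N.+1 / INR N.+2 = 1 - / INR N.+2 by rewrite (S_INR N.+1); field; rewrite -S_INR; lra.
lra.
Qed.

(** The geometric sums of e(n x) are at most 1 / |sin (pi x)|. Weights whose steps are D / n have
    total variation about D log N, so such a kernel decays like that of a monotone weight up to a
    logarithm. *)
Lemma expsum_abel (w : nat -> C) (N : nat) (D x : R) : (0 < N)%N ->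
  (forall n, (0 < n <= N)%N -> Cmod (w n) <= D) ->
  (forall n, (0 < n < N)%N -> Cmod (w n - w n.+1)%C <= D / INR n) ->
  Cmod (expsum w N x) * Rabs (sin (PI * x)) <= D * (2 + ln (INR N)).
Proof.
move=> N0 Hw Hd.
have D0 : 0 <= D by apply: Rle_trans (Hw 1%N _); [exact: Cmod_ge_0 | rewrite N0].
pose E k := \sumC_(1 <= d < k.+1) e (INR d * x).
have HE k : Cmod (E k) * Rabs (sin (PI * x)) <= 1.
  have EE : ((1 - e x) * E k)%C = (e x * (1 - Cpow (e x) k))%C.
    rewrite -Cgeom /E big_add1 /= Cmult_assoc [(e x * _)%C]Cmult_comm -Cmult_assoc; congr Cmult.
    rewrite big_distrr; apply: eq_bigr => d _ /=.
    by rewrite -Cpow_S -e_mul_nat.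
  have := f_equal Cmod EE; rewrite !Cmod_mult Cmod_1_sub_e Cmod_e Rmult_1_l => H.
  have : Cmod (1 - Cpow (e x) k)%C <= 2.
    apply: (Rle_trans _ _ _ (Cmod_triangle_sub _ _)).
    by rewrite Cmod_1 Cmod_pow Cmod_e pow1; lra.
  by rewrite -H; lra.
(* Cutting [w] to 0 beyond N removes the boundary term in [Abel_identity]; the jump at N contributes
   |w N| <= D to the variation. *)
pose b d := if (d <= N)%N then w d else RtoC 0.
have -> : expsum w N x = \sumC_(1 <= d < N.+1) (E d * (b d - b d.+1)).
  have -> : expsum w N x = \sumC_(1 <= d < N.+1) (e (INR d * x) * b d).
    rewrite /expsum big_nat [RHS]big_nat; apply: eq_bigr => d /andP[_]; rewrite ltnS /b => ->.
    by ring.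
  have bN : b N.+1 = RtoC 0 by rewrite /b ltnn.
  rewrite (Abel_identity (fun d => e (INR d * x)) b 0 N) // bN.
  rewrite [\sumC_(1 <= d < 1) _]big_geq // /E; ring.
have s0 := Rabs_pos (sin (PI * x)).
apply: (Rle_trans _ ((\sumR_(1 <= d < N.+1) Cmod (E d * (b d - b d.+1))%C) * Rabs (sin (PI * x)))).
  by apply: Rmult_le_compat_r => //; apply: Cmod_sum.
rewrite big_distrl /=.
apply: (Rle_trans _ (\sumR_(1 <= d < N.+1) Cmod (b d - b d.+1)%C)).
  apply: Rsum_le => d _; rewrite Cmod_mult.
  by have := HE d; have := Cmod_ge_0 (b d - b d.+1)%C; nra.
rewrite Rsum_recr // /b leqnn ltnn.
have -> : forall z : C, (z - 0)%C = z by move=> z; ring.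
have h1 := Hw N ltac:(by rewrite N0 leqnn).
have h2 : \sumR_(1 <= d < N) Cmod ((if (d <= N)%N then w d else RtoC 0) - (if (d < N)%N then w d.+1 else RtoC 0))%C
   <= \sumR_(1 <= d < N.+1) (D * / INR d).
  have [M EM] : exists M, N = M.+1 by exists N.-1; rewrite prednK.
  rewrite Rsum_recr // -[X in X <= _]Rplus_0_r; apply: Rplus_le_compat; last first.
    by apply: Rmult_le_pos => //; left; apply: Rinv_0_lt_compat; apply: INR_pos.
  apply: Rsum_le_nat => d /andP[d0 dN]; rewrite dN (ltnW dN).
  by apply: Hd; rewrite d0.
have h3 := harmonic_le N N0.
rewrite -big_distrr /= in h2.
have := Rmult_le_compat_l _ _ _ D0 h3; lra.
Qed.

Lemma Rsum_subset (I : eqType) (s t : seq I) (G : I -> R) : uniq s -> uniq t ->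
  {subset s <= t} -> (forall i, 0 <= G i) -> \sumR_(i <- s) G i <= \sumR_(i <- t) G i.
Proof.
move=> us ut st G0.
have -> : \sumR_(i <- s) G i = \sumR_(i <- t | i \in s) G i.
  rewrite -[RHS]big_filter; apply: perm_big; apply: uniq_perm => //; first exact: filter_uniq.
  by move=> i; rewrite mem_filter; case si : (i \in s) => //=; rewrite st.
rewrite big_mkcond; apply: Rsum_le => i _.
by case: ifP => _; have := G0 i; lra.
Qed.

Definition frac (y : R) : R := y - IZR (Int_part y).

Lemma frac_bound (y : R) : 0 <= frac y < 1.
Proof. by rewrite /frac; have := base_Int_part y; lra. Qed.

Lemma abs_sin_frac (y : R) : Rabs (sin (PI * y)) = Rabs (sin (PI * frac y)).
Proof.
have E : forall z, Cmod (1 - e z)%C = 2 * Rabs (sin (PI * z)) by exact: Cmod_1_sub_e.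
have : Cmod (1 - e (frac y))%C = Cmod (1 - e y)%C by rewrite /frac /Rminus -opp_IZR e_addZ.
by rewrite !E; lra.
Qed.

Definition cell (Q : nat) (y : R) : nat := Z.to_nat (Int_part (INR Q * frac y)).

Lemma cell_bound (Q : nat) (y : R) : (0 < Q)%N ->
  (cell Q y < Q)%N /\ INR (cell Q y) <= INR Q * frac y < INR (cell Q y) + 1.
Proof.
move=> hQ; have Qp := INR_pos Q hQ; have f0 := frac_bound y.
have [b1 b2] := base_Int_part (INR Q * frac y).
have q0 : 0 <= INR Q * frac y by apply: Rmult_le_pos; lra.
have z0 : (0 <= Int_part (INR Q * frac y))%Z.
  by have : (-1 < Int_part (INR Q * frac y))%Z; [apply: lt_IZR; lra | lia].
have E : INR (cell Q y) = IZR (Int_part (INR Q * frac y)) by rewrite /cell INR_IZR_INZ Z2Nat.id.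
split; last by rewrite E; lra.
by apply/ltP; apply: INR_lt; rewrite E; nra.
Qed.

(* Modulo 1 the points [x i - al] lie in distinct cells of length [1 / Q]; in the [l]-th cell
   [1 / |sin (PI y)|] is at most [2 Q / min (l, Q - 1 - l)]. *)
Lemma separated_sum_bound (I : eqType) (r : seq I) (x : I -> R) (K : R -> R) (Q : nat) (B1 B2 : R) :
  (0 < Q)%N -> uniq r -> 0 <= B1 -> 0 <= B2 ->
  (forall i j (k : Z), i \in r -> j \in r -> i != j -> 1 <= INR Q * Rabs (x i - x j - IZR k)) ->
  (forall y, 0 <= K y <= B1) -> (forall y, K y * Rabs (sin (PI * y)) <= B2) ->
  forall al, \sumR_(i <- r) K (x i - al) <= 2 * B1 + 4 * B2 * INR Q * (1 + ln (INR Q)).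
Proof.
move=> hQ ur B10 B20 sep K1 K2 al.
have Qp := INR_pos Q hQ.
(* The cells touching an integer receive the trivial bound [B1], since 1 / |sin (pi y)| is unbounded
   there. *)
pose A l := if l == 0%N then B1 else 2 * B2 * INR Q * / INR l.
have A0 l : 0 <= A l.
  rewrite /A; case: eqP => // h; apply: Rmult_le_pos; first by apply: Rmult_le_pos; lra.
  by left; apply: Rinv_0_lt_compat; apply: INR_pos; case: l h.
(* A point may be closer to either end of the period; adding the bounds counted from both ends
   avoids deciding which. *)
pose G l := A l + A (Q - l.+1)%N.
have KG y : K y <= G (cell Q y).
  have [c1 [c2 c3]] := cell_bound Q y hQ; set l := cell Q y in c1 c2 c3 *.
  have f0 := frac_bound y.
  have hs := sin_PI_ge (frac y) ltac:(lra).
  have h2 := K2 y; rewrite abs_sin_frac in h2.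
  have kp := K1 y.
  have key m : (0 < m)%N -> INR m <= INR Q * Rmin (frac y) (1 - frac y) -> K y <= 2 * B2 * INR Q * / INR m.
    move=> m0 hm; have mp := INR_pos m m0.
    apply/Rle_div_r => //.
    have h3 : K y * sin (PI * frac y) <= B2.
      by apply: Rle_trans h2; apply: Rmult_le_compat_l; [lra | apply: Rle_abs].
    have h4 : INR m / (2 * INR Q) <= sin (PI * frac y).
      apply: Rle_trans hs; apply/Rle_div_l; first by lra.
      by lra.
    have h5 : K y * (INR m / (2 * INR Q)) <= B2.
      by apply: Rle_trans h3; apply: Rmult_le_compat_l; lra.
    have -> : K y * INR m = K y * (INR m / (2 * INR Q)) * (2 * INR Q) by field; lra.
    nra.
  have r1 : INR (Q - l.+1) <= INR Q * (1 - frac y).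
    rewrite -minusE minus_INR; last by apply/leP.
    by rewrite S_INR; lra.
  rewrite /G; case: (Rle_lt_dec (frac y) (1 - frac y)) => h.
    have := A0 (Q - l.+1)%N; rewrite {2}/A; case: eqP => hl; first by lra.
    have := key l; rewrite Rmin_left // => kk; have := kk ltac:(by case: (l) hl) c2; lra.
  have := A0 l; rewrite [X in _ <= _ + X]/A; case: eqP => hl; first by lra.
  have := key (Q - l.+1)%N; rewrite Rmin_right; last by lra.
  by move=> kk; have := kk ltac:(by case: (Q - l.+1)%N hl) r1; lra.
apply: (Rle_trans _ (\sumR_(i <- r) G (cell Q (x i - al)))); first by apply: Rsum_le.
have inj : {in r &, injective (fun i => cell Q (x i - al))}.
  move=> i j ri rj /= E; apply/eqP; apply/negP => /negP nij.
  have [_ h1] := cell_bound Q (x i - al) hQ; have [_ h2] := cell_bound Q (x j - al) hQ.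
  rewrite E in h1.
  have := sep i j (Int_part (x i - al) - Int_part (x j - al))%Z ri rj nij.
  rewrite minus_IZR.
  have -> : x i - x j - (IZR (Int_part (x i - al)) - IZR (Int_part (x j - al))) =
    frac (x i - al) - frac (x j - al) by rewrite /frac; ring.
  rewrite -(Rabs_pos_eq (INR Q)) -?Rabs_mult; last by lra.
  rewrite Rmult_minus_distr_l /Rabs; case: Rcase_abs; lra.
have -> : \sumR_(i <- r) G (cell Q (x i - al)) = \sumR_(l <- [seq cell Q (x i - al) | i <- r]) G l.
  by rewrite big_map.
apply: (Rle_trans _ (\sumR_(0 <= l < Q) G l)).
  apply: Rsum_subset.
  - by rewrite map_inj_in_uniq.
  - exact: iota_uniq.
  - by move=> l /mapP [i _ ->]; rewrite mem_index_iota leq0n /=; case: (cell_bound Q (x i - al) hQ).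
  - by move=> l; rewrite /G; have := A0 l; have := A0 (Q - l.+1)%N; lra.
rewrite /G big_split /=.
have -> : \sumR_(0 <= i < Q) A (Q - i.+1)%N = \sumR_(0 <= i < Q) A i.
  by rewrite [RHS]big_nat_rev /= add0n.
have SA : \sumR_(0 <= i < Q) A i <= B1 + 2 * B2 * INR Q * (1 + ln (INR Q)).
  have [M EM] : exists M, Q = M.+1 by exists Q.-1; rewrite prednK.
  have -> : \sumR_(0 <= i < Q) A i = B1 + \sumR_(1 <= i < Q) A i by rewrite EM big_ltn.
  apply: Rplus_le_compat_l.
  apply: (Rle_trans _ (\sumR_(1 <= i < Q.+1) (2 * B2 * INR Q * / INR i))).
    rewrite Rsum_recr // -[X in X <= _]Rplus_0_r; apply: Rplus_le_compat; last first.
      by have := A0 Q; rewrite /A (gtn_eqF hQ).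
    by apply: Rsum_le_nat => i /andP[i0 _]; rewrite /A (gtn_eqF i0); lra.
  rewrite -big_distrr /=; apply: Rmult_le_compat_l; last exact: harmonic_le.
  by apply: Rmult_le_pos; lra.
lra.
Qed.

(** The difference is a fraction with denominator p p' <= P^2. Its numerator can only vanish if p
    divides a p', hence p = p', and then a and a' agree modulo p and so coincide. *)
Lemma farey_separated (p a p' a' P : nat) (k : Z) : prime p -> prime p' ->
  (0 < a < p)%N -> (0 < a' < p')%N -> (p <= P)%N -> (p' <= P)%N -> (p, a) != (p', a') ->
  1 <= INR (P * P) * Rabs (INR a / INR p - INR a' / INR p' - IZR k).
Proof.
move=> pp pp' /andP[a0 ap] /andP[a0' ap'] pP pP' ne.
have p0 := INR_pos p (prime_gt0 pp); have p0' := INR_pos p' (prime_gt0 pp').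
set z := (Z.of_nat a * Z.of_nat p' - Z.of_nat a' * Z.of_nat p - k * Z.of_nat p * Z.of_nat p')%Z.
have Ez : INR a / INR p - INR a' / INR p' - IZR k = IZR z / (INR p * INR p').
  by rewrite /z !minus_IZR !mult_IZR -!INR_IZR_INZ; field; lra.
have z0 : z <> 0%Z.
  move=> hz; have hp := prime_gt0 pp; have hp' := prime_gt0 pp'.
  have E : (Z.of_nat a * Z.of_nat p' = Z.of_nat p * (Z.of_nat a' + k * Z.of_nat p'))%Z by rewrite /z in hz; lia.
  move/ltP: (hp) => hp1; move/ltP: (hp') => hp1'; move/ltP: (a0) => a1; move/ltP: (a0') => a1'.
  move/ltP: (ap) => ap1; move/ltP: (ap') => ap1'.
  have t0 : (0 <= Z.of_nat a' + k * Z.of_nat p')%Z by nia.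
  have En : (a * p' = p * Z.to_nat (Z.of_nat a' + k * Z.of_nat p'))%N.
    by apply: Nat2Z.inj; rewrite -!multE !Nat2Z.inj_mul Z2Nat.id.
  have : p %| a * p' by rewrite En dvdn_mulr.
  rewrite Euclid_dvdM // => /orP[/dvdn_leq|].
    by move=> /(_ a0); rewrite leqNgt ap.
  rewrite dvdn_prime2 // => /eqP Epp; subst p'.
  have E2 : (Z.of_nat a = Z.of_nat a' + k * Z.of_nat p)%Z by nia.
  have k0 : k = 0%Z by nia.
  by case/eqP: ne; congr pair; lia.
have z1 : 1 <= Rabs (IZR z) by rewrite -abs_IZR; apply: IZR_le; lia.
have P1 : INR p <= INR P by apply: le_INR; apply/leP.
have P2 : INR p' <= INR P by apply: le_INR; apply/leP.
have pq : 0 < INR p * INR p' by apply: Rmult_lt_0_compat.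
rewrite Ez Rabs_div; last by lra.
rewrite (Rabs_pos_eq (INR p * _)); last by lra.
rewrite -multE mult_INR /Rdiv -Rmult_assoc; apply/Rle_div_r => //.
have : INR p * INR p' <= INR P * INR P by apply: Rmult_le_compat; lra.
nra.
Qed.

(** * The weights and their Liouville sums *)

(** A relation instead of a function, so that the integer part of X / p can be taken to be [N %/ p]
    by [is_floor_div]. *)
Definition is_floor (X : R) (N : nat) : Prop := INR N <= X < INR N + 1.

Lemma is_floor_div (X : R) (N p : nat) : (0 < p)%N -> is_floor X N -> is_floor (X / INR p) (N %/ p).
Proof.
move=> p0 [h1 h2]; have pp := INR_pos p p0; split.
  apply/Rle_div_r => //; apply: (Rle_trans _ (INR N)) => //.
  by rewrite -mult_INR multE; apply: le_INR; apply/leP; apply: leq_divM.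
apply/Rlt_div_l => //.
have : INR N + 1 <= (INR (N %/ p) + 1) * INR p; last by lra.
rewrite -!S_INR -mult_INR multE; apply: le_INR; apply/leP; exact: ltn_ceil.
Qed.

Lemma Rmax0_step (x : R) (d : nat) :
  0 <= Rmax 0 (x - INR d) - Rmax 0 (x - INR d.+1) <= 1.
Proof. by rewrite S_INR /Rmax; case: Rle_dec => h1; case: Rle_dec => h2; lra. Qed.

Lemma Abel_weight (a : nat -> C) (b : nat -> R) (D : nat) : b D.+1 = 0 ->
  \sumC_(1 <= d < D.+1) (a d * RtoC (b d)) =
  \sumC_(1 <= d < D.+1) ((\sumC_(1 <= k < d.+1) a k) * RtoC (b d - b d.+1)).
Proof.
move=> bD; rewrite (Abel_identity a (fun d => RtoC (b d)) 0 D) // bD.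
rewrite [\sumC_(1 <= d < 1) _]big_geq // Cmult_0_r Cmult_0_l.
have -> : forall z : C, (0 - 0 + z)%C = z by move=> z; ring.
by apply: eq_bigr => d _; rewrite RtoC_minus.
Qed.

(** For D the integer part of x this is the integral of the partial sums of [a] over [0, x]. It is
    continuous in x, unlike a sum with a sharp cut-off. *)
Definition fejer_sum (a : nat -> C) (x : R) (D : nat) : C :=
  \sumC_(1 <= d < D.+1) (a d * RtoC (x - INR d)).

Lemma fejer_sum_max (a : nat -> C) (x : R) (D D' : nat) : is_floor x D -> (D <= D')%N ->
  fejer_sum a x D = \sumC_(1 <= d < D'.+1) (a d * RtoC (Rmax 0 (x - INR d))).
Proof.
move=> [h1 h2] DD; rewrite (Csum_split _ 1 D.+1 D'.+1) //.
rewrite [X in (_ + X)%C]big_nat_cond [X in (_ + X)%C]big1 ?Cplus_0_r; last first.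
  move=> d /andP[/andP[/leP/le_INR hd _] _]; rewrite S_INR in hd.
  by rewrite Rmax_left ?Cmult_0_r //; lra.
rewrite /fejer_sum big_nat [RHS]big_nat; apply: eq_bigr => d /andP[_].
rewrite ltnS => /leP/le_INR hd; rewrite Rmax_right //; lra.
Qed.

Lemma Rpower_le_pos (x y a : R) : 0 < x <= y -> 0 <= a -> Rpower x a <= Rpower y a.
Proof.
move=> [hx hxy] ha; apply: exp_le_exp.
have := ln_le x y hx hxy; nra.
Qed.

(** By parts the sum is at most CA times the sum of d^(-beta) over d <= x, and d^(-beta) <= x^(1 -
    beta) / d. The harmonic sum costs a logarithm but keeps the constant free of beta. *)
Lemma fejer_sum_bound (a : nat -> C) (CA beta x : R) (D : nat) : 0 <= beta < 1 ->
  (forall j, (0 < j)%N -> Cmod (\sumC_(1 <= k < j.+1) a k) <= CA * Rpower (INR j) (- beta)) ->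
  (0 < D)%N -> is_floor x D ->
  Cmod (fejer_sum a x D) <= CA * Rpower x (1 - beta) * (1 + ln x).
Proof.
move=> hb HA D0 hx; have [h1 h2] := hx; have Dp := INR_pos D D0.
have CA0 : 0 <= CA.
  by have := HA 1%N isT; rewrite Rpower_1_l; have := Cmod_ge_0 (\sumC_(1 <= k < 2) a k); lra.
rewrite (fejer_sum_max a x D D hx (leqnn D)) Abel_weight; last first.
  by rewrite S_INR Rmax_left; lra.
apply: (Rle_trans _ _ _ (Cmod_sum _ _ _ _)).
apply: (Rle_trans _ (\sumR_(1 <= d < D.+1) (CA * Rpower x (1 - beta) * / INR d))).
  apply: Rsum_le_nat => d /andP[d0 dD]; have dp := INR_pos d d0.
  have [s0 s1] := Rmax0_step x d.
  rewrite Cmod_mult Cmod_R Rabs_pos_eq //.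
  have dx : INR d <= x by apply: Rle_trans h1; apply: le_INR; apply/leP.
  have : Rpower (INR d) (- beta) <= Rpower x (1 - beta) * / INR d.
    have -> : - beta = (1 - beta) + - (1) by ring.
    rewrite Rpower_plus Rpower_Ropp Rpower_1 //.
    apply: Rmult_le_compat_r; first by left; apply: Rinv_0_lt_compat.
    by apply: Rpower_le_pos; lra.
  move=> H; have := HA d d0 => H2; have := Cmod_ge_0 (\sumC_(1 <= k < d.+1) a k).
  have := Rmult_le_compat_l _ _ _ CA0 H; nra.
rewrite -big_distrr /=; apply: Rmult_le_compat_l.
  by apply: Rmult_le_pos => //; left; apply: exp_pos.
apply: (Rle_trans _ _ _ (harmonic_le D D0)).
by have := ln_le (INR D) x Dp h1; lra.
Qed.

(** As an integral, the difference sees the partial sums between x' and x only. In discrete form,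
    the weights [b] are constant below D', so only d >= D' contributes. *)
Lemma fejer_sum_diff (a : nat -> C) (CA beta x x' : R) (D D' : nat) : 0 <= beta ->
  (forall j, (0 < j)%N -> Cmod (\sumC_(1 <= k < j.+1) a k) <= CA * Rpower (INR j) (- beta)) ->
  (0 < D')%N -> is_floor x D -> is_floor x' D' -> x' <= x ->
  Cmod (fejer_sum a x D - fejer_sum a x' D')%C <= CA * Rpower (INR D') (- beta) * (x - x').
Proof.
move=> hb HA D0 hx hx' xx.
have [h1 h2] := hx; have [h1' h2'] := hx'.
have DD : (D' <= D)%N.
  rewrite -ltnS; apply/ltP; apply: INR_lt; rewrite S_INR; lra.
have D'p := INR_pos D' D0.
have CA0 : 0 <= CA.
  by have := HA 1%N isT; rewrite Rpower_1_l; have := Cmod_ge_0 (\sumC_(1 <= k < 2) a k); lra.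
rewrite (fejer_sum_max a x D D hx (leqnn D)) (fejer_sum_max a x' D' D hx' DD) -Csum_minus.
pose b d := Rmax 0 (x - INR d) - Rmax 0 (x' - INR d).
rewrite (eq_bigr (fun d => a d * RtoC (b d))%C); last by move=> d _; rewrite /b RtoC_minus; ring.
have bD : b D.+1 = 0 by rewrite /b S_INR !Rmax_left; lra.
rewrite Abel_weight //.
apply: (Rle_trans _ _ _ (Cmod_sum _ _ _ _)).
apply: (Rle_trans _ (\sumR_(1 <= d < D.+1) (CA * Rpower (INR D') (- beta) * b d - CA * Rpower (INR D') (- beta) * b d.+1))).
  apply: Rsum_le_nat => d /andP[d0 dD]; have dp := INR_pos d d0.
  have p0 : 0 <= Rpower (INR D') (- beta) by left; apply: exp_pos.
  case: (leqP D' d) => hd.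
    have bdec : 0 <= b d - b d.+1.
      rewrite /b; have := le_INR _ _ (leP hd); rewrite S_INR => h.
      by rewrite /Rmax; do !case: Rle_dec => ?; lra.
    rewrite Cmod_mult Cmod_R Rabs_pos_eq // -Rmult_minus_distr_l.
    apply: Rmult_le_compat_r => //; apply: (Rle_trans _ _ _ (HA d d0)).
    apply: Rmult_le_compat_l => //; apply: Rpower_le_neg => //.
    by split => //; apply: le_INR; apply/leP.
  have E : b d - b d.+1 = 0.
    rewrite /b; have := le_INR _ _ (leP hd); rewrite S_INR => h.
    by rewrite !Rmax_right; lra.
  rewrite E Cmult_0_r Cmod_0.
  have -> : b d.+1 = b d by lra.
  lra.
rewrite (Rsum_telescope (fun d => CA * Rpower (INR D') (- beta) * b d)) // bD Rmult_0_r Rminus_0_r.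
apply: Rmult_le_compat_l; first by apply: Rmult_le_pos => //; left; apply: exp_pos.
rewrite /b; have := le_INR 1 D' (leP D0); rewrite [INR 1]/= => h.
by rewrite !Rmax_right; lra.
Qed.

(* [N] stands for the integer part of [X], so that the range [d <= N / n] is [d n / X <= 1]. *)
Definition weight (eta : nat -> C) (rho : C) (X : R) (N n : nat) : C :=
  \sumC_(1 <= d < (N %/ n).+1)
    (eta d * (cpow (INR d * INR n / X) (- rho) * RtoC (1 - INR d * INR n / X))).

Lemma weight_fejer (eta : nat -> C) (rho : C) (X : R) (N n : nat) : 0 < X -> (0 < n)%N ->
  weight eta rho X N n = (cpow (X / INR n) (rho - 1) *
    fejer_sum (fun d => eta d * cpow (INR d) (- rho)) (X / INR n) (N %/ n))%C.
Proof.
move=> hX n0; have np := INR_pos n n0.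
have xp : 0 < X / INR n by apply: Rdiv_lt_0_compat.
have xn : RtoC (X / INR n) <> RtoC 0 by move=> /RtoC_inj; lra.
rewrite /weight /fejer_sum big_distrr big_nat [RHS]big_nat; apply: eq_bigr => d /andP[d0 _].
have dp := INR_pos d d0.
have -> : INR d * INR n / X = INR d * / (X / INR n) by field; lra.
rewrite cpow_mul //; last by apply: Rinv_0_lt_compat.
rewrite cpow_inv // -[in LHS](cpow_opp (X / INR n) (- rho)).
have -> : (- - rho = (rho - 1) + 1)%C by ring.
rewrite cpow_add cpow_id // RtoC_minus RtoC_mult RtoC_inv; last by lra.
by rewrite RtoC_minus -[RHS]/(cpow (X / INR n) (rho - 1) * _)%C; field.
Qed.

(** The prefactor (X / n)^(rho - 1) has modulus exactly inverse to the growth (X / n)^(1 - Re rho)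
    of the mean, so a logarithm alone remains. This is where the decay of the partial sums pays
    off. *)
Lemma weight_bound (eta : nat -> C) (rho : C) (CA X : R) (N n : nat) : 0 <= Re rho < 1 ->
  (forall j, (0 < j)%N -> Cmod (dser eta rho j) <= CA * Rpower (INR j) (- Re rho)) ->
  is_floor X N -> (0 < n <= N)%N ->
  Cmod (weight eta rho X N n) <= CA * (1 + ln X).
Proof.
move=> hb HA hX /andP[n0 nN].
have np := INR_pos n n0; have [X1 X2] := hX.
have CA0 : 0 <= CA.
  by have := HA 1%N isT; rewrite Rpower_1_l; have := Cmod_ge_0 (dser eta rho 1); lra.
have X0 : 0 < X by have := le_INR _ _ (leP nN); lra.
rewrite weight_fejer // Cmod_mult Cmod_cpow.
have xp : 0 < X / INR n by apply: Rdiv_lt_0_compat.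
have := fejer_sum_bound (fun d => eta d * cpow (INR d) (- rho))%C CA (Re rho) (X / INR n) (N %/ n) hb HA
   ltac:(by rewrite divn_gt0) (is_floor_div X N n n0 hX) => H.
have p0 : 0 < Rpower (X / INR n) (Re (rho - 1)%C) by apply: exp_pos.
apply: (Rle_trans _ _ _ (Rmult_le_compat_l _ _ _ (Rlt_le _ _ p0) H)).
have -> : Rpower (X / INR n) (Re (rho - 1)%C) * (CA * Rpower (X / INR n) (1 - Re rho) * (1 + ln (X / INR n))) =
  CA * (1 + ln (X / INR n)) * (Rpower (X / INR n) (Re (rho - 1)%C) * Rpower (X / INR n) (1 - Re rho)) by ring.
rewrite -Rpower_plus.
have -> : Re (rho - 1)%C + (1 - Re rho) = 0 by rewrite -[Re (rho - 1)%C]/(Re rho + - (1)); ring.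
rewrite Rpower_O // Rmult_1_r; apply: Rmult_le_compat_l => //.
have : ln (X / INR n) <= ln X; last by lra.
apply: ln_le => //; apply/Rle_div_l => //.
by have := le_INR 1 n (leP n0); rewrite [INR 1]/=; nra.
Qed.

Lemma cpow_step (s : C) (X : R) (n : nat) : 0 < Re s <= 1 -> 0 < X -> (0 < n)%N ->
  Cmod (cpow (X / INR n) (- s) - cpow (X / INR n.+1) (- s))%C <=
    Cmod s / Re s * Rpower (X / INR n.+1) (- Re s) / INR n.
Proof.
move=> hs hX n0; have np := INR_pos n n0; have np1 := INR_pos n.+1 isT.
have x0 : 0 < X / INR n by apply: Rdiv_lt_0_compat.
have x1 : 0 < X / INR n.+1 by apply: Rdiv_lt_0_compat.
have xx : X / INR n.+1 <= X / INR n.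
  by apply: Rmult_le_compat_l; [lra | apply: Rinv_le_contravar => //; rewrite S_INR; lra].
have := Cexp_ray_bound s _ _ (proj1 hs) (ln_le _ _ x1 xx).
rewrite -!/(cpow _ _) -!/(Rpower _ _) => H; apply: (Rle_trans _ _ _ H).
have sp : 0 <= Cmod s / Re s by apply: Rdiv_le_0_compat; [exact: Cmod_ge_0 | lra].
set c := Cmod s / Re s in sp *.
rewrite -Rmult_minus_distr_l /Rdiv Rmult_assoc; apply: Rmult_le_compat_l => //.
have -> : Rpower (X * / INR n) (- Re s) = Rpower (X * / INR n.+1) (- Re s) * Rpower (INR n / INR n.+1) (Re s).
  have -> : X * / INR n = (X * / INR n.+1) * / (INR n / INR n.+1) by field; lra.
  have q0 : 0 < INR n / INR n.+1 by apply: Rdiv_lt_0_compat.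
  rewrite -Rpower_mult_distr //; last by apply: Rinv_0_lt_compat.
  congr Rmult; rewrite /Rpower ln_Rinv //; congr exp; ring.
have p0 : 0 < Rpower (X * / INR n.+1) (- Re s) by apply: exp_pos.
have : INR n / INR n.+1 <= Rpower (INR n / INR n.+1) (Re s).
  have q0 : 0 < INR n / INR n.+1 by apply: Rdiv_lt_0_compat.
  have q1 : INR n / INR n.+1 <= 1 by apply/Rle_div_l => //; rewrite S_INR; lra.
  rewrite -{1}(Rpower_1 _ q0) /Rpower; apply: exp_le_exp.
  have : ln (INR n / INR n.+1) <= 0 by rewrite -ln_1; apply: ln_le.
  nra.
have : 1 - INR n / INR n.+1 <= / INR n.
  have -> : 1 - INR n / INR n.+1 = / INR n.+1 by rewrite S_INR; field; rewrite -S_INR; lra.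
  by apply: Rinv_le_contravar => //; rewrite S_INR; lra.
nra.
Qed.

(** Two things change from n to n + 1: the power (X / n)^(rho - 1), by a relative amount of order 1
    / n, and the mean, because X / n moves by X / (n (n + 1)). Both effects are O(log X / n), the
    form required by [expsum_abel]. *)
Lemma weight_step (eta : nat -> C) (rho : C) (CA X : R) (N n : nat) : 0 <= Re rho < 1 ->
  (forall j, (0 < j)%N -> Cmod (dser eta rho j) <= CA * Rpower (INR j) (- Re rho)) ->
  is_floor X N -> (0 < n < N)%N ->
  Cmod (weight eta rho X N n - weight eta rho X N n.+1)%C <=
    CA * (Cmod (1 - rho)%C / (1 - Re rho) + 2) * (1 + ln X) / INR n.
Proof.
move=> hb HA hX /andP[n0 nN].
have np := INR_pos n n0; have np1 := INR_pos n.+1 isT; have [X1 X2] := hX.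
have CA0 : 0 <= CA.
  by have := HA 1%N isT; rewrite Rpower_1_l; have := Cmod_ge_0 (dser eta rho 1); lra.
have X1' : 1 <= X by have := le_INR 1 N (leP (leq_trans n0 (ltnW nN))); rewrite [INR 1]/=; lra.
have lnX : 0 <= ln X by rewrite -ln_1; apply: ln_le; lra.
have X0 : 0 < X by lra.
have x0 : 0 < X / INR n by apply: Rdiv_lt_0_compat.
have x1 : 0 < X / INR n.+1 by apply: Rdiv_lt_0_compat.
have xx : X / INR n.+1 <= X / INR n.
  by apply: Rmult_le_compat_l; [lra | apply: Rinv_le_contravar => //; rewrite S_INR; lra].
have f0 := is_floor_div X N n n0 hX; have f1 := is_floor_div X N n.+1 isT hX.
have D1 : (0 < N %/ n.+1)%N by rewrite divn_gt0.
rewrite !weight_fejer //.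
set a := (fun d => _); set V := fejer_sum a _ _; set V' := fejer_sum a _ _.
have HV' : Cmod V' <= CA * Rpower (X / INR n.+1) (1 - Re rho) * (1 + ln X).
  apply: (Rle_trans _ _ _ (fejer_sum_bound a CA (Re rho) _ _ hb HA D1 f1)).
  apply: Rmult_le_compat_l; first by apply: Rmult_le_pos => //; left; apply: exp_pos.
  have : ln (X / INR n.+1) <= ln X; last by lra.
  apply: ln_le => //; apply/Rle_div_l => //.
  by have := le_INR 1 n.+1 (leP (isT : (0 < n.+1)%N)); rewrite [INR 1]/=; nra.
have HVd : Cmod (V - V')%C <= CA * Rpower (INR (N %/ n.+1)) (- Re rho) * (X / INR n - X / INR n.+1).
  by apply: fejer_sum_diff => //; lra.
have HP := cpow_step (1 - rho)%C X n ltac:(rewrite -[Re _]/(1 - Re rho); lra) X0 n0.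
rewrite -[Re (1 - rho)%C]/(1 - Re rho) in HP.
have En : (- (1 - rho) = rho - 1)%C by ring.
rewrite En in HP.
have -> : (cpow (X / INR n) (rho - 1) * V - cpow (X / INR n.+1) (rho - 1) * V' =
  (cpow (X / INR n) (rho - 1) - cpow (X / INR n.+1) (rho - 1)) * V' + cpow (X / INR n) (rho - 1) * (V - V'))%C by ring.
apply: (Rle_trans _ _ _ (Cmod_triangle _ _)); rewrite !Cmod_mult.
set P1 := Rpower (X / INR n.+1) (1 - Re rho) in HV'.
set P2 := Rpower (X / INR n.+1) (- (1 - Re rho)) in HP.
have P12 : P1 * P2 = 1 by rewrite /P1 /P2 -Rpower_plus Rplus_opp_r Rpower_O.
have c0 : 0 <= Cmod (1 - rho)%C / (1 - Re rho) by apply: Rdiv_le_0_compat; [exact: Cmod_ge_0 | lra].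
have T1 : Cmod (cpow (X / INR n) (rho - 1) - cpow (X / INR n.+1) (rho - 1))%C * Cmod V' <=
   CA * (Cmod (1 - rho)%C / (1 - Re rho)) * (1 + ln X) / INR n.
  apply: (Rle_trans _ _ _ (Rmult_le_compat _ _ _ _ (Cmod_ge_0 _) (Cmod_ge_0 _) HP HV')).
  right.
  have -> : Cmod (1 - rho) / (1 - Re rho) * P2 / INR n * (CA * P1 * (1 + ln X)) =
    CA * (Cmod (1 - rho) / (1 - Re rho)) * (1 + ln X) / INR n * (P1 * P2) by field; lra.
  by rewrite P12 Rmult_1_r.
have T2 : Cmod (cpow (X / INR n) (rho - 1)) * Cmod (V - V')%C <= CA * 2 * (1 + ln X) / INR n.
  rewrite Cmod_cpow -[Re (rho - 1)%C]/(Re rho + - (1)).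
  have p0 : 0 < Rpower (X / INR n) (Re rho + - (1)) by apply: exp_pos.
  apply: (Rle_trans _ _ _ (Rmult_le_compat_l _ _ _ (Rlt_le _ _ p0) HVd)).
  have e1 : X / INR n - X / INR n.+1 = X / INR n.+1 / INR n by rewrite S_INR; field; rewrite -S_INR; lra.
  have e2 : Rpower (X / INR n) (Re rho + - (1)) <= Rpower (X / INR n.+1) (Re rho + - (1)).
    have -> : Re rho + - (1) = - (1 - Re rho) by ring.
    by apply: Rpower_le_neg; lra.
  (* The integer part of a number at least 1 is at least half of it, which costs a factor 2^(Re rho)
     <= 2. *)
  have e3 : Rpower (INR (N %/ n.+1)) (- Re rho) <= 2 * Rpower (X / INR n.+1) (- Re rho).
    have [g1 g2] := f1.
    have d1 : 1 <= INR (N %/ n.+1) by apply: (le_INR 1); apply/leP.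
    apply: (Rle_trans _ (Rpower (X / INR n.+1 * / 2) (- Re rho))).
      by apply: Rpower_le_neg; lra.
    rewrite -Rpower_mult_distr //; last by lra.
    rewrite Rmult_comm; apply: Rmult_le_compat_r; first by left; apply: exp_pos.
    rewrite /Rpower ln_Rinv; last by lra.
    rewrite -{2}(exp_ln 2); last by lra.
    by apply: exp_le_exp; have := ln_lt_2; nra.
  have q0 : 0 < Rpower (INR (N %/ n.+1)) (- Re rho) by apply: exp_pos.
  have q1 : 0 < Rpower (X / INR n.+1) (- Re rho) by apply: exp_pos.
  rewrite e1.
  apply: (Rle_trans _ (Rpower (X / INR n.+1) (Re rho + - (1)) * (CA * (2 * Rpower (X / INR n.+1) (- Re rho)) * (X / INR n.+1 / INR n)))).
    have w0 : 0 < X / INR n.+1 / INR n by apply: Rdiv_lt_0_compat.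
    apply: Rmult_le_compat => //; first by left.
      by apply: Rmult_le_pos; [apply: Rmult_le_pos; lra | lra].
    apply: Rmult_le_compat_r; first by lra.
    by apply: Rmult_le_compat_l.
  have e4 : Rpower (X / INR n.+1) (Re rho + - (1)) * Rpower (X / INR n.+1) (- Re rho) = / (X / INR n.+1).
    by rewrite -Rpower_plus -[in RHS](Rpower_1 _ x1) -Rpower_Ropp; congr Rpower; ring.
  have -> : Rpower (X / INR n.+1) (Re rho + - (1)) * (CA * (2 * Rpower (X / INR n.+1) (- Re rho)) * (X / INR n.+1 / INR n)) =
    CA * 2 * (Rpower (X / INR n.+1) (Re rho + - (1)) * Rpower (X / INR n.+1) (- Re rho)) * (X / INR n.+1) / INR n by field; lra.
  rewrite e4; apply: Rmult_le_compat_r; first by left; apply: Rinv_0_lt_compat.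
  have -> : CA * 2 * / (X / INR n.+1) * (X / INR n.+1) = CA * 2 by field; lra.
  nra.
rewrite /Rdiv in T1 T2 *; lra.
Qed.

(* With [weight] the smoothing [w(t) = sum_d eta(d) u(d t)], [u(z) = z^(-rho) (1 - z)_+], evaluated
   at [t = n / X], the inner sum over [d] turns [sum lambda f w] into a sum of [eta * lambda f], which
   lives on squares when [eta = f]. *)
Definition Msum (f eta : nat -> C) (rho : C) (X : R) (N : nat) : C :=
  \sumC_(1 <= m < N.+1) (RtoC (liouville m) * f m * weight eta rho X N m).

Lemma weight_mul (eta : nat -> C) (rho : C) (X : R) (N p m : nat) : 0 < X -> (0 < p)%N ->
  weight eta rho X N (p * m) = weight eta rho (X / INR p) (N %/ p) m.
Proof.
move=> hX p0; have pp := INR_pos p p0.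
rewrite /weight divnMA; apply: eq_bigr => d _.
have -> // : INR d * INR (p * m) / X = INR d * INR m / (X / INR p).
by rewrite -multE mult_INR; field; lra.
Qed.

Lemma weight_twist2 (kappa : C) (f : nat -> C) (rho : C) (X : R) (N n : nat) : 0 < X -> (0 < n)%N ->
  weight (twist2 kappa f) rho X N n =
  (weight f rho X N n - kappa * weight f rho (X / 2) (N %/ 2) n)%C.
Proof.
move=> hX n0; rewrite /weight.
rewrite (sum_twist2 kappa f (fun d => cpow (INR d * INR n / X) (- rho) * RtoC (1 - INR d * INR n / X))%C).
congr (_ - _ * _)%C.
rewrite -!divnMA mulnC; apply: eq_bigr => d _.
have -> // : INR (2 * d) * INR n / X = INR d * INR n / (X / 2).
by rewrite -multE mult_INR [INR 2]/=; field; lra.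
Qed.

Lemma Msum_twist2 (kappa : C) (f : nat -> C) (rho : C) (X : R) (N : nat) : 0 < X ->
  Msum f (twist2 kappa f) rho X N = (Msum f f rho X N - kappa * Msum f f rho (X / 2) (N %/ 2))%C.
Proof.
move=> hX; rewrite {1 2}/Msum.
have -> : Msum f f rho (X / 2) (N %/ 2) =
  \sumC_(1 <= m < N.+1) (RtoC (liouville m) * f m * weight f rho (X / 2) (N %/ 2) m).
  rewrite [RHS](Csum_split _ 1 (N %/ 2).+1 N.+1) // ?ltnS ?leq_div //.
  rewrite [X in (_ + X)%C]big_nat_cond [X in (_ + X)%C]big1 ?Cplus_0_r // => m /andP[/andP[hm _] _].
  by rewrite /weight divn_small // big_geq // Cmult_0_r.
rewrite big_distrr -Csum_minus big_nat [RHS]big_nat; apply: eq_bigr => m /andP[m0 _] /=.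
by rewrite weight_twist2 //; ring.
Qed.

(** The weight depends on n / X only, so multiples of p rescale X to X / p, and complete
    multiplicativity pulls out lambda(p) f(p). *)
Lemma Msum_dvd (f eta : nat -> C) (rho : C) (X : R) (N p : nat) : cmult f -> 0 < X -> (0 < p)%N ->
  \sumC_(1 <= n < N.+1 | p %| n) (RtoC (liouville n) * f n * weight eta rho X N n) =
  (RtoC (liouville p) * f p * Msum f eta rho (X / INR p) (N %/ p))%C.
Proof.
move=> hf hX p0; rewrite big_multiples // /Msum big_distrr big_nat [RHS]big_nat.
apply: eq_bigr => m /andP[m0 _].
rewrite weight_mul // (cm_mul _ hf) // (proj2 liouville_cm) // RtoC_mult.
by rewrite /=; ring.
Qed.

(** * Sums over squares and the growth of M *)

Definition square_sum (f : nat -> C) (rho : C) (X : R) (N : nat) : C :=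
  \sumC_(1 <= k < N.+1 | (k * k <= N)%N)
    (f k * f k * cpow (INR k) (- (rho + rho)) * RtoC (1 - INR k * INR k / X)).

Lemma Msum_square (f : nat -> C) (rho : C) (X : R) (N : nat) : cmult f -> 0 < X ->
  Msum f f rho X N = (cpow X rho * square_sum f rho X N)%C.
Proof.
move=> hf hX.
pose G n := (f n * (cpow (INR n / X) (- rho) * RtoC (1 - INR n / X)))%C.
have -> : Msum f f rho X N = \sumC_(1 <= m < N.+1) (RtoC (liouville m) * \sumC_(1 <= d < (N %/ m).+1) G (m * d)%N).
  rewrite /Msum big_nat [RHS]big_nat; apply: eq_bigr => m /andP[m0 _].
  rewrite -Cmult_assoc; congr Cmult; rewrite /weight big_distrr big_nat [RHS]big_nat.
  apply: eq_bigr => d /andP[d0 _] /=.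
  rewrite /G (cm_mul _ hf) // -multE mult_INR (Rmult_comm (INR d)); ring.
rewrite liouville_convolution /square_sum big_distrr big_nat_cond [RHS]big_nat_cond.
apply: eq_bigr => k /andP[/andP[k0 _] _] /=; have kp := INR_pos k k0.
rewrite /G (cm_mul _ hf) // -multE mult_INR.
have ix : 0 < / X by apply: Rinv_0_lt_compat.
rewrite [in LHS]/Rdiv !cpow_mul //; last by apply: Rmult_lt_0_compat.
have -> : (- (rho + rho) = - rho + - rho)%C by ring.
have E : (/ cpow X (- rho))%C = cpow X rho by rewrite -cpow_opp; congr cpow; ring.
by rewrite cpow_add cpow_inv // E /Rdiv; ring.
Qed.

Lemma square_sum_lim (f : nat -> C) (rho : C) (eps : R) : cmult f -> 1 / 2 < Re rho -> 0 < eps ->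
  exists X0, 0 < X0 /\ forall X N, is_floor X N -> X0 <= X ->
    Cmod (square_sum f rho X N - Clim (dser (fun k => f k * f k)%C (rho + rho)))%C <= eps.
Proof.
move=> hf hr he.
have hf2 := cmult_sqr f hf.
have re2 : Re (rho + rho)%C = Re rho + Re rho by [].
have hs : 1 < Re (rho + rho)%C by rewrite re2; lra.
set g := fun k => (f k * f k)%C in hf2 *; set s := (rho + rho)%C in re2 hs *.
have /is_lim_seq_spec /(_ (mkposreal (eps / 4) ltac:(lra))) [K HK] := zeta_tail_lim _ hs.
have {}HK : zeta_tail (Re s) K <= eps / 4.
  have := HK K (le_n K); rewrite Rminus_0_r -[X in _ < X]/(eps / 4); have := Rle_abs (zeta_tail (Re s) K); lra.
have K0 := pos_INR K.
(* With the tail beyond K below eps / 4, X must only make the defect of the first K weights small: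
   K^3 / X <= eps / 4. The term K^2 ensures that the squares up to K^2 lie in range. *)
exists (4 * (INR K * (INR K * INR K)) / eps + INR K * INR K + 1).
have q0 : 0 <= 4 * (INR K * (INR K * INR K)) / eps.
  by apply: Rdiv_le_0_compat => //; repeat apply: Rmult_le_pos => //; lra.
split; first by nra.
move=> X N [h1 h2] hX.
have KN : (K * K <= N)%N.
  by rewrite -ltnS; apply/ltP; apply: INR_lt; rewrite S_INR -multE mult_INR; lra.
have X0 : 0 < X by nra.
have KN1 : (K <= N)%N by case: (K) KN => // k; apply: leq_trans; rewrite leq_pmulr.
pose t k := (g k * cpow (INR k) (- s))%C.
have gb k : (0 < k)%N -> Cmod (t k) <= 1.
  move=> k0; rewrite /t Cmod_mult Cmod_cpow -[Re (- s)%C]/(- Re s).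
  have := cm_le1 _ hf2 k k0; have c0 := Cmod_ge_0 (g k).
  have : Rpower (INR k) (- Re s) <= 1.
    rewrite -(Rpower_1_l (- Re s)); apply: Rpower_le_neg; last by lra.
    by split; [lra | apply: (le_INR 1); apply/leP].
  have : 0 < Rpower (INR k) (- Re s) by apply: exp_pos.
  nra.
have E : square_sum f rho X N = (dser g s K
   - (\sumC_(1 <= k < K.+1) (t k * RtoC (INR k * INR k / X)))
   + \sumC_(K.+1 <= k < N.+1 | (k * k <= N)%N) (t k * RtoC (1 - INR k * INR k / X)))%C.
  rewrite /square_sum big_mkcond (Csum_split _ 1 K.+1 N.+1) // -big_mkcond.
  rewrite -[X in (_ + X)%C]big_mkcond; congr Cplus.
  rewrite /dser -Csum_minus big_mkcond big_nat [RHS]big_nat; apply: eq_bigr => k /andP[k0 kK].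
  rewrite (leq_trans _ KN); last by apply: leq_mul; rewrite -ltnS.
  by rewrite RtoC_minus /t /g /s; ring.
have [_ /(_ K) hZ] := dser_abs_cv g s (cm_le1 _ hf2) hs.
have B1 : Cmod (\sumC_(1 <= k < K.+1) (t k * RtoC (INR k * INR k / X))) <= eps / 4.
  apply: (Rle_trans _ _ _ (Cmod_sum _ _ _ _)).
  apply: (Rle_trans _ (\sumR_(1 <= k < K.+1) (INR K * INR K / X))).
    apply: Rsum_le_nat => k /andP[k0 kK]; have kp := INR_pos k k0.
    have kk : INR k <= INR K by apply: le_INR; apply/leP.
    have q : INR k * INR k / X <= INR K * INR K / X.
      by apply: Rmult_le_compat_r; [left; apply: Rinv_0_lt_compat | nra].
    have q' : 0 <= INR k * INR k / X by apply: Rdiv_le_0_compat; nra.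
    rewrite Cmod_mult Cmod_R (Rabs_pos_eq _ q').
    by have := gb k k0; have := Cmod_ge_0 (t k); nra.
  rewrite Rsum_const subn1 [_.-1]/=.
  have -> : INR K * (INR K * INR K / X) = INR K * (INR K * INR K) / X by field; lra.
  apply/Rle_div_l => //.
  have : 4 * (INR K * (INR K * INR K)) / eps <= X by nra.
  by move/(Rle_div_l _ _ _ he); lra.
have B2 : Cmod (\sumC_(K.+1 <= k < N.+1 | (k * k <= N)%N) (t k * RtoC (1 - INR k * INR k / X))) <= zeta_tail (Re s) K.
  apply: Rle_trans (zeta_tail_bound (Re s) K N hs KN1).
  apply: (Rle_trans _ _ _ (Cmod_sum _ _ _ _)).
  rewrite big_mkcond; apply: Rsum_le_nat => k /andP[Kk kN].
  have k0 : (0 < k)%N by apply: leq_ltn_trans Kk.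
  have p0 : 0 < Rpower (INR k) (- Re s) by apply: exp_pos.
  case: ifP => kkN; last by lra.
  rewrite Cmod_mult Cmod_mult Cmod_cpow -[Re (- s)%C]/(- Re s) Cmod_R.
  have kX : INR k * INR k <= X.
    by apply: Rle_trans h1; rewrite -mult_INR; apply: le_INR; apply/leP.
  have kp := INR_pos k k0.
  have q1 : INR k * INR k / X <= 1 by apply/Rle_div_l; lra.
  have q2 : 0 <= INR k * INR k / X by apply: Rdiv_le_0_compat; nra.
  rewrite Rabs_pos_eq; last by lra.
  have g1 := cm_le1 _ hf2 k k0; have g0 := Cmod_ge_0 (g k).
  apply: (Rle_trans _ (1 * Rpower (INR k) (- Re s) * 1)); last by lra.
  apply: Rmult_le_compat; try lra; first by apply: Rmult_le_pos; lra.
  by apply: Rmult_le_compat_r; lra.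
rewrite E.
set A := dser g s K in hZ *; set B := bigop _ _ _ in B1 *; set D := bigop _ _ _ in B2 *.
have -> : (A - B + D - Clim (dser g s) = D - B - (Clim (dser g s) - A))%C by ring.
have := Cmod_triangle_sub (D - B)%C (Clim (dser g s) - A)%C.
have := Cmod_triangle_sub D B; lra.
Qed.

(** Two-sided, since the main term needs a lower bound at X / p and the term to be beaten an upper
    bound at X. *)
Definition M_growth (f eta : nat -> C) (rho : C) (b : R) : Prop :=
  exists c1 c2 y0 : R, 0 < c1 /\ 0 <= c2 /\ 1 <= y0 /\
    forall X N, is_floor X N -> y0 <= X ->
      c1 * Rpower X b <= Cmod (Msum f eta rho X N) <= c2 * Rpower X b.

(** M(X) is asymptotic to T X^rho with T = L(2 rho, f^2) (1 - kappa 2^(-rho)). As 2 Re rho > 1, the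
    first factor is nonzero by its Euler product. [eps] is chosen so that the errors at X and at X /
    2 together cost half of |T|. *)
Lemma M_growth_zero (kappa : C) (f : nat -> C) (rho : C) : cmult f -> 1 / 2 < Re rho ->
  (1 - kappa * cpow 2 (- rho))%C <> RtoC 0 -> M_growth f (twist2 kappa f) rho (Re rho).
Proof.
move=> hf hr hk.
set Z := Clim (dser (fun k => f k * f k)%C (rho + rho)%C).
have Z0 : Z <> RtoC 0.
  apply: dser_neq0; first exact: cmult_sqr.
  by rewrite -[Re _]/(Re rho + Re rho); lra.
set T := (Z * (1 - kappa * cpow 2 (- rho)))%C.
have T0 : 0 < Cmod T by apply/Cmod_gt_0 => /Cmult_integral [].
set u := Cmod (kappa * cpow 2 (- rho))%C; have u0 : 0 <= u by apply: Cmod_ge_0.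
pose eps := Cmod T / (2 * (1 + u)).
have e0 : 0 < eps by apply: Rdiv_lt_0_compat; lra.
have [X0 [X0p H]] := square_sum_lim f rho eps hf hr e0.
exists (Cmod T / 2), (2 * Cmod T), (2 * X0 + 1); split; first by lra.
split; first by lra.
split; first by lra.
move=> X N hX hX0; have Xp : 0 < X by lra.
have h2 := is_floor_div X N 2 isT hX; have E2 : INR 2 = 2 by rewrite /=; ring.
rewrite E2 in h2.
have H1 := H X N hX ltac:(lra); have H2 := H (X / 2) (N %/ 2)%N h2 ltac:(lra).
rewrite -/Z in H1 H2.
have E : Msum f (twist2 kappa f) rho X N = (cpow X rho * (T + ((square_sum f rho X N - Z) -
   kappa * cpow 2 (- rho) * (square_sum f rho (X / 2) (N %/ 2) - Z))))%C.
  rewrite Msum_twist2 // !Msum_square //; last by lra.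
  have -> : cpow (X / 2) rho = (cpow X rho * cpow 2 (- rho))%C.
    by rewrite /Rdiv cpow_mul ?cpow_inv ?cpow_opp; [|lra|lra|apply: Rinv_0_lt_compat; lra].
  by rewrite /T; ring.
rewrite E Cmod_mult Cmod_cpow.
set d := (_ - kappa * _ * _)%C.
have Hd : Cmod d <= Cmod T / 2.
  apply: (Rle_trans _ _ _ (Cmod_triangle_sub _ _)); rewrite Cmod_mult -/u.
  have -> : Cmod T / 2 = eps + u * eps by rewrite /eps; field; lra.
  by apply: Rplus_le_compat => //; apply: Rmult_le_compat_l.
have p0 : 0 < Rpower X (Re rho) by apply: exp_pos.
have := Cmod_triangle T d; have := Cmod_triangle_rev T (- d)%C; rewrite Cmod_opp.
have -> : (T - - d = T + d)%C by ring.
move=> b1 b2; split; nra.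
Qed.

Lemma sum_squares_bounds (m : nat) :
  INR m ^ 3 / 3 <= \sumR_(1 <= k < m.+1) (INR k * INR k) <= (INR m + 1) ^ 3 / 3.
Proof.
elim: m => [|m [IH1 IH2]]; first by rewrite big_geq //=; lra.
rewrite Rsum_recr // S_INR; have := pos_INR m; nra.
Qed.

(** The number of squares up to X, minus the mean of those squares weighted by 1 / X, is about sqrt
    X - sqrt X / 3. The error 4 is generous. *)
Lemma square_sum_trivial (X : R) (N : nat) : is_floor X N -> 1 <= X ->
  exists q : R, square_sum Cone (RtoC 0) X N = RtoC q /\
    Rabs (q - 2 / 3 * sqrt X) <= 4.
Proof.
move=> [h1 h2] X1.
have Xp : 0 < X by lra.
set m := Nat.sqrt N; have [/leP m1 /ltP m2] := PeanoNat.Nat.sqrt_spec N (PeanoNat.Nat.le_0_l N).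
rewrite -/m !multE in m1 m2.
exists (INR m - (\sumR_(1 <= k < m.+1) (INR k * INR k)) / X); split.
  rewrite /square_sum.
  have mN : (m <= N)%N by case: (m) m1 => // k; apply: leq_trans; rewrite leq_pmulr.
  rewrite big_mkcond (Csum_split _ 1 m.+1 N.+1) //.
  rewrite [X in (_ + X)%C]big_nat_cond [X in (_ + X)%C]big1 ?Cplus_0_r; last first.
    move=> k /andP[/andP[hk _] _]; case: ifP => // kk.
    have : (m.+1 * m.+1 <= N)%N by apply: leq_trans kk; apply: leq_mul.
    by rewrite leqNgt m2.
  have Em : INR m = \sumR_(1 <= k < m.+1) 1 by rewrite Rsum_const subn1 Rmult_1_r.
  rewrite [X in X - _]Em /Rdiv big_distrl /=.
  rewrite RtoC_minus !RtoC_sum -Csum_minus big_nat [RHS]big_nat; apply: eq_bigr => k /andP[_ km].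
  rewrite (leq_trans _ m1); last by apply: leq_mul; rewrite -ltnS.
  rewrite /Cone !Cmult_1_l Copp_0.
  by rewrite cpow_0 Cmult_1_l -RtoC_minus.
set s := sqrt X; have s2 : s * s = X by apply: sqrt_sqrt; lra.
have s1 : 1 <= s by rewrite -sqrt_1; apply: sqrt_le_1; lra.
have ms : INR m <= s.
  apply: Rsqr_incr_0_var; last by lra.
  rewrite /Rsqr s2; apply: Rle_trans h1; rewrite -mult_INR multE; apply: le_INR; exact/leP.
have sm : s < INR m + 1.
  apply: Rsqr_incrst_0; try lra; last by have := pos_INR m; lra.
  rewrite /Rsqr s2; apply: (Rlt_le_trans _ _ _ h2).
  by rewrite -!S_INR -mult_INR multE; apply: le_INR; exact/leP.
have m0 := pos_INR m.
have [b1 b2] := sum_squares_bounds m; set S := bigop _ _ _ in b1 b2 *.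
have u : INR m - S / X <= 2 / 3 * s.
  have : (INR m - 2 / 3 * s) * X <= S.
    rewrite -s2; have : 0 <= (s - INR m) * (s - INR m) * (INR m + 2 * s).
      by apply: Rmult_le_pos; [apply: Rle_0_sqr | lra].
    by nra.
  by move/(Rle_div_r _ _ _ Xp); lra.
have l : 2 / 3 * s - 4 <= INR m - S / X.
  have : S <= (INR m - (2 / 3 * s - 4)) * X.
    have h3 : (INR m + 1) ^ 3 <= (s + 1) ^ 3 by apply: pow_incr; lra.
    rewrite -s2; have : (s - 1 - (2 / 3 * s - 4)) * (s * s) <= (INR m - (2 / 3 * s - 4)) * (s * s).
      by apply: Rmult_le_compat_r; [nra | lra].
    by nra.
  by move/(Rle_div_l _ _ _ Xp); lra.
by apply: Rabs_le; lra.
Qed.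

(** The difference of the sums at X and X / 2 is about (2/3) (1 - sqrt 2) sqrt X, near -0.276 sqrt
    X. The errors total 4 + 2 * 4 = 12, at most 0.12 sqrt X once X >= 10000, so the value is
    negative and its modulus exceeds sqrt X / 10. *)
Lemma M_growth_trivial : M_growth Cone (twist2 (RtoC 2) Cone) (RtoC 0) (1 / 2).
Proof.
exists (1 / 10), 1, 10000; split; first by lra.
split; first by lra.
split; first by lra.
move=> X N hX hX0.
have h2 := is_floor_div X N 2 isT hX; have E2 : INR 2 = 2 by rewrite /=; ring.
rewrite E2 in h2.
have [q1 [e1 b1]] := square_sum_trivial X N hX ltac:(lra).
have [q2 [e2 b2]] := square_sum_trivial _ _ h2 ltac:(lra).
have -> : Msum Cone (twist2 (RtoC 2) Cone) (RtoC 0) X N = RtoC (q1 - 2 * q2).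
  rewrite Msum_twist2; last by lra.
  rewrite !Msum_square; [| exact: cmult_one | lra | exact: cmult_one | lra].
  by rewrite !cpow_0 e1 e2 RtoC_minus RtoC_mult; ring.
rewrite Cmod_R.
have -> : Rpower X (1 / 2) = sqrt X by rewrite /Rdiv Rmult_1_l Rpower_sqrt //; lra.
set s := sqrt X in b1 *; set s2 := sqrt (X / 2) in b2 *.
have es : s * s = X by apply: sqrt_sqrt; lra.
have es2 : s2 * s2 = X / 2 by apply: sqrt_sqrt; lra.
have sp : 0 <= s by apply: sqrt_pos.
have s2p : 0 <= s2 by apply: sqrt_pos.
have s100 : 100 <= s by nra.
have l : 7 / 10 * s <= s2 by nra.
have u : s2 <= 72 / 100 * s by nra.
have := Rabs_le_between (q1 - 2 / 3 * s) 4; case=> /(_ b1) c1 _.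
have := Rabs_le_between (q2 - 2 / 3 * s2) 4; case=> /(_ b2) c2 _.
rewrite Rabs_left; lra.
Qed.

(** * The lower bound *)

Lemma nc_coprime_neq0 (Q : nat) (f : nat -> C) (n : nat) : nat_character Q f ->
  (0 < n)%N -> coprime n Q -> f n <> RtoC 0.
Proof.
move=> hf n0 cn fn0.
case: (egcdnP Q n0) => u v E _.
have : f (u * n)%N = RtoC 1.
  rewrite E (eqP cn) addnC (nc_per_mul _ _ _ _ (nc_per _ _ hf)).
  exact: nc_one hf.
rewrite (nc_mul _ _ hf) fn0 Cmult_0_r => /RtoC_inj; lra.
Qed.

(** Ramanujan's sum for a prime modulus. Leaving out a = 0 keeps the fractions for different primes
    apart; the price is the -1 in [ramanujan_sumE], which becomes the subtracted M(X). *)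
Definition ramanujan_sum (p n : nat) : C := \sumC_(1 <= a < p) e (INR a / INR p * INR n).

Lemma ramanujan_sumE (p n : nat) : (0 < p)%N ->
  ramanujan_sum p n = ((if p %| n then RtoC (INR p) else 0) - 1)%C.
Proof.
move=> p0; have pp := INR_pos p p0.
have -> : ramanujan_sum p n = ((\sumC_(0 <= a < p) e (INR a * (IZR (Z.of_nat n) / INR p))) - 1)%C.
  rewrite [in RHS]big_ltn // Rmult_0_l e_0 /ramanujan_sum.
  have -> : forall z : C, (1 + z - 1)%C = z by move=> z; ring.
  apply: eq_bigr => a _; congr e; rewrite -INR_IZR_INZ; field; lra.
rewrite e_sum_div //; congr (_ - _)%C.
have -> // : (Z.modulo (Z.of_nat n) (Z.of_nat p) =? 0)%Z = (p %| n).
have p0' := ltP p0.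
apply/idP/idP.
  move=> /Z.eqb_spec h; have [k Ek] : (Z.of_nat p | Z.of_nat n)%Z by apply/Z.mod_divide => //; lia.
  apply/dvdnP; exists (Z.to_nat k); apply: Nat2Z.inj.
  have k0 : (0 <= k)%Z by nia.
  by rewrite -multE Nat2Z.inj_mul Z2Nat.id.
move=> /dvdnP [k ->]; apply/Z.eqb_spec; apply/Z.mod_divide; first by lia.
by exists (Z.of_nat k); rewrite -multE Nat2Z.inj_mul.
Qed.

Lemma Msum_ramanujan (f eta : nat -> C) (rho : C) (X : R) (N p : nat) : cmult f -> 0 < X -> prime p ->
  \sumC_(1 <= n < N.+1) (RtoC (liouville n) * (f n * weight eta rho X N n * ramanujan_sum p n)) =
  (- (RtoC (INR p) * f p * Msum f eta rho (X / INR p) (N %/ p)) - Msum f eta rho X N)%C.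
Proof.
move=> hf hX pp.
have H := Msum_dvd f eta rho X N p hf hX (prime_gt0 pp).
rewrite liouville_prime // in H.
have -> : (- (RtoC (INR p) * f p * Msum f eta rho (X / INR p) (N %/ p)))%C =
  (RtoC (INR p) * (RtoC (-1) * f p * Msum f eta rho (X / INR p) (N %/ p)))%C.
  by have -> : -1 = - (1) by [ring]; rewrite RtoC_opp; ring.
have E (F : nat -> C) : (RtoC (INR p) * \sumC_(1 <= n < N.+1 | p %| n) F n)%C =
  \sumC_(1 <= n < N.+1) (if p %| n then RtoC (INR p) * F n else 0).
  by rewrite big_distrr big_mkcond.
rewrite -H E /Msum -Csum_minus; apply: eq_bigr => n _.
by rewrite (ramanujan_sumE p n (prime_gt0 pp)) /=; case: (p %| n); ring.
Qed.

Definition farey_pairs (ps : seq nat) : seq (nat * nat) :=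
  [seq (p, a) | p <- ps, a <- index_iota 1 p].

(** The fractions are 1 / P^2 apart and P^2 <= N, so the kernel is summed over separated points.
    With l = ln N the constant 10 is 2 from the trivial bound D N, plus 4 * 2 from (2 + l) (1 + l)
    <= 2 (1 + l)^2. *)
Lemma farey_kernel_bound (w : nat -> C) (N P : nat) (ps : seq nat) (D al : R) :
  (0 < N)%N -> (P * P <= N)%N -> (0 < P)%N -> uniq ps ->
  (forall p, p \in ps -> prime p /\ (p <= P)%N) ->
  (forall n, (0 < n <= N)%N -> Cmod (w n) <= D) ->
  (forall n, (0 < n < N)%N -> Cmod (w n - w n.+1)%C <= D / INR n) ->
  \sumR_(p <- ps) \sumR_(1 <= a < p) Cmod (expsum w N (INR a / INR p - al)) <=
    10 * D * INR N * (1 + ln (INR N)) ^ 2.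
Proof.
move=> N0 PN P0 ups hps Hw Hd.
have Np := INR_pos N N0.
have D0 : 0 <= D by apply: Rle_trans (Hw 1%N _); [exact: Cmod_ge_0 | rewrite N0].
have -> : \sumR_(p <- ps) \sumR_(1 <= a < p) Cmod (expsum w N (INR a / INR p - al)) =
  \sumR_(i <- farey_pairs ps) Cmod (expsum w N (INR i.2 / INR i.1 - al)).
  by rewrite /farey_pairs big_allpairs_dep.
have PP0 : (0 < P * P)%N by rewrite muln_gt0 P0.
have lnN : 0 <= ln (INR N) by apply: ln_INR_ge0.
have mem i : i \in farey_pairs ps -> [/\ prime i.1, (i.1 <= P)%N & (0 < i.2 < i.1)%N].
  move=> /allpairsPdep [p [a [hp ha ->]]]; have [pp pP] := hps p hp; split => //.
  by move: ha; rewrite mem_index_iota.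
have ur : uniq (farey_pairs ps).
  apply: allpairs_uniq_dep => //.
    by move=> p _; apply: iota_uniq.
  by move=> [p a] [p' a'] _ _ /= [-> ->].
have K1 y : 0 <= Cmod (expsum w N y) <= D * INR N.
  split; first exact: Cmod_ge_0.
  apply: (Rle_trans _ _ _ (Cmod_sum _ _ _ _)).
  apply: (Rle_trans _ (\sumR_(1 <= n < N.+1) D)); last by rewrite Rsum_const subn1 [_.-1]/=; lra.
  apply: Rsum_le_nat => n /andP[n0 nN]; rewrite Cmod_mult Cmod_e Rmult_1_r.
  by apply: Hw; rewrite n0.
have K2 y := expsum_abel w N D y N0 Hw Hd.
have B2 : 0 <= D * (2 + ln (INR N)) by apply: Rmult_le_pos; lra.
have B1 : 0 <= D * INR N by apply: Rmult_le_pos; lra.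
have := separated_sum_bound _ (farey_pairs ps) (fun i => INR i.2 / INR i.1)
  (fun y => Cmod (expsum w N y)) (P * P) _ _ PP0 ur B1 B2.
move=> H; have {}H := H _ K1 K2 al.
apply: (Rle_trans _ _ _ (H _)).
  move=> i j k /mem [pi Pi ai] /mem [pj Pj aj] nij.
  apply: farey_separated => //.
have PX : INR (P * P) <= INR N by apply: le_INR; apply/leP.
have PXp := INR_pos _ PP0.
have lnP : 1 + ln (INR (P * P)) <= 1 + ln (INR N) by have := ln_le _ _ PXp PX; lra.
have lnP0 : 0 <= 1 + ln (INR (P * P)) by have := ln_INR_ge0 _ PP0; lra.
have h1 : INR (P * P) * (1 + ln (INR (P * P))) <= INR N * (1 + ln (INR N)).
  by apply: Rmult_le_compat; lra.
have h2 := Rmult_le_compat_l _ _ _ B2 h1.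
set l := ln (INR N) in lnN lnP h1 h2 B2 *.
have h3 : D * (2 + l) * (INR N * (1 + l)) <= 2 * (D * INR N * (1 + l) ^ 2).
  have : 0 <= D * INR N * (1 + l) by apply: Rmult_le_pos; lra.
  nra.
have h4 : D * INR N <= D * INR N * (1 + l) ^ 2.
  rewrite -[X in X <= _]Rmult_1_r; apply: Rmult_le_compat_l => //.
  by simpl; nra.
lra.
Qed.

(** The phases [u] make each prime's sum equal to its modulus, so one application of duality, to the
    combined coefficients [b], handles all primes. Expanding f shifts the evaluation point by j / Q,
    and the kernel bound is uniform in such shifts, whence the factor Q. *)
Lemma twisted_duality (Q : nat) (f w : nat -> C) (N P : nat) (ps : seq nat) (D : R) :
  nat_character Q f ->
  (0 < N)%N -> (P * P <= N)%N -> (0 < P)%N -> uniq ps ->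
  (forall p, p \in ps -> prime p /\ (p <= P)%N) ->
  (forall n, (0 < n <= N)%N -> Cmod (w n) <= D) ->
  (forall n, (0 < n < N)%N -> Cmod (w n - w n.+1)%C <= D / INR n) ->
  \sumR_(p <- ps) Cmod (\sumC_(1 <= n < N.+1) (RtoC (liouville n) * (f n * w n * ramanujan_sum p n)))
    <= INR Q * (10 * D * INR N * (1 + ln (INR N)) ^ 2) *
       RInt (fun x => Cmod (expsum (fun n => RtoC (liouville n)) N x)) 0 1.
Proof.
move=> hf N0 PN P0 ups hps Hw Hd.
pose h p := \sumC_(1 <= n < N.+1) (RtoC (liouville n) * (f n * w n * ramanujan_sum p n)).
have [u Hu] : exists u : nat -> C, forall p, Cmod (u p) = 1 /\ (u p * h p)%C = RtoC (Cmod (h p)).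
  exists (fun p => proj1_sig (constructive_indefinite_description _ (unimodular_rotation (h p)))).
  by move=> p; case: constructive_indefinite_description.
pose b n := (f n * w n * \sumC_(p <- ps) (u p * ramanujan_sum p n))%C.
have E : \sumC_(1 <= n < N.+1) (RtoC (liouville n) * b n) = RtoC (\sumR_(p <- ps) Cmod (h p)).
  rewrite RtoC_sum.
  transitivity (\sumC_(1 <= n < N.+1) \sumC_(p <- ps) (RtoC (liouville n) * (f n * w n * (u p * ramanujan_sum p n)))).
    by apply: eq_bigr => n _; rewrite /b !big_distrr.
  rewrite exchange_big /=; apply: eq_bigr => p _.
  rewrite -(proj2 (Hu p)) /h big_distrr; apply: eq_bigr => n _ /=; ring.
have S0 : 0 <= \sumR_(p <- ps) Cmod (h p) by apply: Rsum_ge0 => p _; apply: Cmod_ge_0.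
have -> : \sumR_(p <- ps) Cmod (h p) = Cmod (\sumC_(1 <= n < N.+1) (RtoC (liouville n) * b n)).
  by rewrite E Cmod_R Rabs_pos_eq.
apply: expsum_duality => x.
have [c [c1 Hc]] := periodic_fourier Q f (nc_pos _ _ hf) (nc_per _ _ hf) (fun n => nc_le1 _ _ n hf).
have -> : expsum b N (- x) = \sumC_(0 <= j < Q) (c j * \sumC_(p <- ps) (u p * \sumC_(1 <= a < p)
   expsum w N (INR a / INR p - (x - INR j / INR Q)))).
  transitivity (\sumC_(0 <= j < Q) \sumC_(p <- ps) \sumC_(1 <= a < p) \sumC_(1 <= n < N.+1)
     (c j * (u p * (w n * e (INR n * (INR a / INR p - (x - INR j / INR Q))))))).
    rewrite [expsum b N _]/expsum (eq_bigr (fun n => \sumC_(0 <= j < Q) \sumC_(p <- ps) \sumC_(1 <= a < p)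
      (c j * (u p * (w n * e (INR n * (INR a / INR p - (x - INR j / INR Q)))))))); last first.
      move=> n _; rewrite /b (Hc n) big_distrl big_distrl big_distrl; apply: eq_bigr => j _.
      rewrite big_distrr big_distrl; apply: eq_bigr => p _.
      rewrite /ramanujan_sum big_distrr big_distrr big_distrl; apply: eq_bigr => a _ /=.
      have -> : e (INR n * (INR a / INR p - (x - INR j / INR Q))) =
        (e (INR j * (INR n / INR Q)) * e (INR a / INR p * INR n) * e (INR n * - x))%C.
        by rewrite -!e_add; congr e; rewrite /Rdiv; ring.
      by ring.
    rewrite exchange_big; apply: eq_bigr => j _; rewrite exchange_big; apply: eq_bigr => p _.
    by rewrite exchange_big.
  apply: eq_bigr => j _; rewrite big_distrr; apply: eq_bigr => p _ /=.
  rewrite big_distrr big_distrr; apply: eq_bigr => a _ /=.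
  by rewrite /expsum !big_distrr.
apply: (Rle_trans _ _ _ (Cmod_sum _ _ _ _)).
have := Rsum_const 0 Q (10 * D * INR N * (1 + ln (INR N)) ^ 2); rewrite subn0 => <-.
apply: Rsum_le => j _; rewrite Cmod_mult.
apply: (Rle_trans _ (1 * \sumR_(p <- ps) \sumR_(1 <= a < p) Cmod (expsum w N (INR a / INR p - (x - INR j / INR Q))))).
  apply: Rmult_le_compat; try exact: Cmod_ge_0; first exact: c1.
  apply: (Rle_trans _ _ _ (Cmod_sum _ _ _ _)); apply: Rsum_le => p _.
  rewrite Cmod_mult (proj1 (Hu p)) Rmult_1_l; exact: Cmod_sum.
rewrite Rmult_1_l; exact: (farey_kernel_bound w N P).
Qed.

(** * Supply of primes and the final comparison *)

(** At most k of the primes are <= k, so a cut at half the count discards at most half of them. A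
    lower bound for the count thus controls both how many primes remain and how large they are. *)
Definition large_primes (P : nat) : seq nat :=
  [seq p <- iota 0 P.+1 | prime p && ((prime_count P) %/ 2 < p)%N].

Lemma large_primes_size (P : nat) : INR (prime_count P) / 2 <= INR (size (large_primes P)).
Proof.
set k := (prime_count P %/ 2)%N.
have H : (prime_count P <= size (large_primes P) + k)%N.
  have -> : large_primes P = [seq p <- [seq p <- iota 0 P.+1 | prime p] | (k < p)%N].
    by rewrite -filter_predI; apply: eq_filter => p; rewrite /= andbC.
  rewrite /prime_count -size_filter; set A := [seq p <- _ | prime p].
  rewrite -(count_predC (fun p => k < p)%N A) size_filter leq_add2l -size_filter.
  apply: leq_trans (_ : size (iota 1 k) <= k)%N; last by rewrite size_iota.
  apply: uniq_leq_size; first by rewrite !filter_uniq // iota_uniq.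
  move=> p; rewrite !mem_filter /= -leqNgt => /and3P[pk pp _].
  by rewrite mem_iota add1n ltnS pk prime_gt0.
have k2 : 2 * INR k <= INR (prime_count P).
  have -> : 2 * INR k = INR (k * 2)%N by rewrite -multE mult_INR [INR 2]/=; ring.
  by apply: le_INR; apply/leP; apply: leq_divM.
have : INR (prime_count P) <= INR (size (large_primes P)) + INR k.
  by rewrite -plus_INR plusE; apply: le_INR; apply/leP.
lra.
Qed.

Lemma one_plus_ln_le (delta X : R) : 0 < delta -> 1 <= X ->
  1 + ln X <= (1 + / delta) * Rpower X delta.
Proof.
move=> hd hX.
have l0 : 0 <= ln X by rewrite -ln_1; apply: ln_le; lra.
have h := exp_ineq1_le (delta * ln X).
have i0 : 0 < / delta by apply: Rinv_0_lt_compat.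
have E : ln X = / delta * (delta * ln X) by field; lra.
have h1 : 1 <= Rpower X delta by rewrite /Rpower -exp_0; apply: exp_le_exp; nra.
have h2 : ln X <= / delta * Rpower X delta.
  by rewrite {1}E; apply: Rmult_le_compat_l; [lra | rewrite /Rpower; lra].
nra.
Qed.

Lemma log_range_large (T : R) : exists X0, 1 <= X0 /\ forall X, X0 <= X -> T <= sqrt X / (16 * (1 + ln X)).
Proof.
(* 80 = 16 * 5, where 1 + ln X <= 5 X^(1/4). *)
set U := 80 * (Rabs T + 1).
have U1 : 1 <= U by rewrite /U; have := Rabs_pos T; lra.
have p1 : 1 <= U ^ 4 by rewrite -(pow1 4); apply: pow_incr; lra.
exists (U ^ 4); split => // X hX.
have X1 : 1 <= X by lra.
have l0 : 0 <= ln X by rewrite -ln_1; apply: ln_le; lra.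
have h := one_plus_ln_le (/ 4) X ltac:(lra) X1.
rewrite Rinv_inv in h.
set y := Rpower X (/ 4) in h.
have y0 : 0 < y by apply: exp_pos.
have ys : sqrt X = y * y.
  by rewrite /y -Rpower_plus -Rpower_sqrt; [congr Rpower; lra | lra].
have yU : U <= y.
  have -> : U = Rpower (U ^ 4) (/ 4).
    rewrite -Rpower_pow; last by lra.
    by rewrite Rpower_mult [INR 4]/= -[X in X = _](Rpower_1 U); [congr Rpower; lra | lra].
  by apply: Rpower_le_pos; lra.
apply/Rle_div_r; first by lra.
rewrite ys.
have a0 := Rabs_pos T; have a1 := Rle_abs T.
have : T * (16 * (1 + ln X)) <= Rabs T * (80 * y).
  apply: (Rle_trans _ (Rabs T * (16 * (1 + ln X)))).
    by apply: Rmult_le_compat_r; lra.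
  by apply: Rmult_le_compat_l; lra.
have : Rabs T * (80 * y) <= U * y by rewrite /U; nra.
have : U * y <= y * y by apply: Rmult_le_compat_r; lra.
lra.
Qed.

Lemma is_floor_Int_part (X : R) : 0 <= X -> is_floor X (Z.to_nat (Int_part X)).
Proof.
move=> hX; have [h1 h2] := base_Int_part X.
have z0 : (0 <= Int_part X)%Z.
  by have : (-1 < Int_part X)%Z; [apply: lt_IZR; lra | lia].
by rewrite /is_floor INR_IZR_INZ Z2Nat.id //; lra.
Qed.

Lemma liouville_sum_expsum (X x : R) :
  liouville_sum X x = expsum (fun n => RtoC (liouville n)) (Z.to_nat (Int_part X)) x.
Proof. by rewrite /liouville_sum sum_n_m_big. Qed.

(** P = 2n, with n half the integer square root m of N. Since ln 2 > 1/2, the factor 16 comes from 8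
    pi(P) (1 + ln X) >= 4n >= 2m - 2 >= sqrt X, the last step using sqrt X >= 4. *)
Lemma prime_supply (X : R) (N : nat) : is_floor X N -> 16 <= X ->
  exists P : nat, (0 < P)%N /\ (P * P <= N)%N /\
    sqrt X / (16 * (1 + ln X)) <= INR (prime_count P) / 2.
Proof.
move=> [h1 h2] hX.
set m := Nat.sqrt N; have [/leP m1 /ltP m2] := PeanoNat.Nat.sqrt_spec N (PeanoNat.Nat.le_0_l N).
rewrite -/m !multE in m1 m2.
set s := sqrt X; have s2 : s * s = X by apply: sqrt_sqrt; lra.
have s0 : 0 <= s by apply: sqrt_pos.
have s4 : 4 <= s by nra.
have sm : s < INR m + 1.
  apply: Rsqr_incrst_0; try lra; last by have := pos_INR m; lra.
  rewrite /Rsqr s2; apply: (Rlt_le_trans _ _ _ h2).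
  by rewrite -!S_INR -mult_INR multE; apply: le_INR; exact/leP.
set n := (m %/ 2)%N.
have m3 : (3 < m.+1)%N by apply/ltP; apply: INR_lt; rewrite [INR m.+1]S_INR [INR 3]/=; lra.
have n0 : (0 < n)%N by rewrite divn_gt0 //; exact: (ltnW (m3 : (2 < m)%N)).
have En : INR m <= 2 * INR n + 1.
  have -> : 2 * INR n + 1 = INR (n.*2.+1) by rewrite S_INR -addnn -plusE plus_INR; lra.
  by apply: le_INR; apply/leP; rewrite {1}(divn_eq m 2) muln2 -[X in (_ <= X)%N]addn1 leq_add2l -ltnS ltn_pmod.
exists n.*2; split; first by rewrite double_gt0.
have nm : (n.*2 <= m)%N by rewrite -muln2 leq_divM.
split; first by apply: leq_trans m1; apply: leq_mul.
have ch := chebyshev_lower n n0.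
have E2 : INR n.*2 = 2 * INR n by rewrite -addnn -plusE plus_INR; lra.
have np := INR_pos n n0; have n1 : 1 <= INR n by apply: (le_INR 1); apply/leP.
have X0 : 0 < X by lra.
have l0 : 0 < ln X by rewrite -ln_1; apply: ln_increasing; lra.
have lX : ln (INR n.*2) <= ln X.
  apply: ln_le; first by lra.
  apply: (Rle_trans _ (INR m)); first by apply: le_INR; exact/leP.
  apply: Rle_trans h1; apply: le_INR; apply/leP; apply: leq_trans m1.
  by rewrite leq_pmulr //; apply: leq_trans n0 (leq_div m 2).
have pc := pos_INR (prime_count n.*2).
have k1 : INR n / 2 <= INR (prime_count n.*2) * (1 + ln X).
  have := ln_lt_2; have : INR (prime_count n.*2) * ln (INR n.*2) <= INR (prime_count n.*2) * (1 + ln X).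
    by apply: Rmult_le_compat_l; lra.
  nra.
apply/Rle_div_l; first by lra.
have -> : INR (prime_count n.*2) / 2 * (16 * (1 + ln X)) = 8 * (INR (prime_count n.*2) * (1 + ln X)) by field.
lra.
Qed.

(** At least t primes, each at least t with t = sqrt X / (16 L) and L = 1 + ln X, contribute X^b
    t^(1-b) apiece, against a test function of size X L^3. Of the five logarithms one comes from the
    weight, two from the kernel, and at most two from t^(2-b). *)
Lemma L1_lower_log (Q : nat) (f eta : nat -> C) (rho : C) (CA b : R) :
  nat_character Q f -> 0 < CA -> 0 <= Re rho < 1 ->
  (forall j, (0 < j)%N -> Cmod (dser eta rho j) <= CA * Rpower (INR j) (- Re rho)) ->
  0 < b < 1 -> M_growth f eta rho b ->
  exists c X0, 0 < c /\ 1 <= X0 /\ forall X, X0 <= X ->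
    c * Rpower X (b / 2) <= (1 + ln X) ^ 5 * RInt (fun x => Cmod (liouville_sum X x)) 0 1.
Proof.
move=> hf CA0 hrho HA hb [c1 [c2 [y0 [c10 [c20 [y01 HM]]]]]].
have hc := nc_cmult _ _ hf.
have Qp := INR_pos Q (nc_pos _ _ hf).
pose C' := Cmod (1 - rho)%C / (1 - Re rho) + 2.
have C'2 : 2 <= C'.
  by rewrite /C'; have : 0 <= Cmod (1 - rho)%C / (1 - Re rho); [apply: Rdiv_le_0_compat; [exact: Cmod_ge_0 | lra] | lra].
(* t >= Q + 1 puts every prime used above Q, so |f p| = 1. The power ensures t^(1-b) >= 2 c2 / c1,
   so that M(X) eats at most half of p |M(X / p)|. *)
have [X1 [X11 HX1]] := log_range_large (INR Q + 1 + Rpower (2 * c2 / c1 + 1) (/ (1 - b))).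
pose A := INR Q * (10 * (CA * C')).
have A0 : 0 < A by rewrite /A; apply: Rmult_lt_0_compat => //; apply: Rmult_lt_0_compat; [lra | nra].
(* X >= y0^2 yields X / p >= y0, because p^2 <= X. *)
exists (c1 / 2 / 256 / A), (X1 + 16 + y0 * y0); split.
  by apply: Rdiv_lt_0_compat => //; lra.
split; first by nra.
move=> X hX.
have X16 : 16 <= X by nra.
have X0 : 0 < X by lra.
have ht := HX1 X ltac:(nra).
set t := sqrt X / (16 * (1 + ln X)) in ht.
set N := Z.to_nat (Int_part X).
have hN : is_floor X N by apply: is_floor_Int_part; lra.
have [P [P0 [PN Hpi]]] := prime_supply X N hN X16.
rewrite -/t in Hpi.
have [h1 h2] := hN.
have l0 : 0 < ln X by rewrite -ln_1; apply: ln_increasing; lra.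
have N0 : (0 < N)%N.
  by apply/ltP; apply: INR_lt; rewrite [INR 0]/=; lra.
have Np := INR_pos N N0.
set L := 1 + ln X in t ht Hpi *.
have L1 : 1 <= L by rewrite /L; lra.
pose w := weight eta rho X N; pose D := CA * C' * L.
have D0 : 0 <= D by rewrite /D; repeat apply: Rmult_le_pos; lra.
have Hw n : (0 < n <= N)%N -> Cmod (w n) <= D.
  move=> hn; apply: (Rle_trans _ _ _ (weight_bound eta rho CA X N n hrho HA hN hn)).
  by rewrite -/L /D; apply: Rmult_le_compat_r; [lra | nra].
have Hd n : (0 < n < N)%N -> Cmod (w n - w n.+1)%C <= D / INR n.
  by move=> hn; apply: (weight_step eta rho CA X N n hrho HA hN hn).
pose ps := large_primes P.
have ups : uniq ps by rewrite filter_uniq // iota_uniq.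
have hps p : p \in ps -> prime p /\ (p <= P)%N.
  by rewrite mem_filter mem_iota add0n ltnS => /andP[/andP[-> _] /andP[_ ->]].
have TD := twisted_duality Q f w N P ps D hf N0 PN P0 ups hps Hw Hd.
set I := RInt _ 0 1 in TD.
have -> : RInt (fun x => Cmod (liouville_sum X x)) 0 1 = I.
  by apply: RInt_ext => x _; rewrite liouville_sum_expsum.
have t1 : INR Q + 1 <= t.
  by apply: Rle_trans ht; have : 0 < Rpower (2 * c2 / c1 + 1) (/ (1 - b)) by [apply: exp_pos]; lra.
have t0 : 0 < t by lra.
have tb : 2 * c2 / c1 <= Rpower t (1 - b).
  have q0 : 0 <= 2 * c2 / c1 by apply: Rdiv_le_0_compat; lra.
  apply: (Rle_trans _ (Rpower (Rpower (2 * c2 / c1 + 1) (/ (1 - b))) (1 - b))).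
    by rewrite Rpower_mult Rinv_l ?Rpower_1; lra.
  apply: Rpower_le_pos; last by lra.
  by split; [apply: exp_pos | lra].
have hp p : p \in ps -> c1 / 2 * Rpower X b * Rpower t (1 - b) <=
   Cmod (\sumC_(1 <= n < N.+1) (RtoC (liouville n) * (f n * w n * ramanujan_sum p n))).
  move=> hpp; have [pp pP] := hps p hpp.
  have p0 := prime_gt0 pp; have ppos := INR_pos p p0.
  have tp : t <= INR p.
    apply: (Rle_trans _ _ _ Hpi).
    move: hpp; rewrite mem_filter => /andP[/andP[_ hk] _].
    have : INR (prime_count P) <= INR (p * 2); last by rewrite -multE mult_INR [INR 2]/=; lra.
    apply: le_INR; apply/leP; apply: ltnW; rewrite -ltn_divLR //.
  have Qlp : (Q < p)%N by apply/ltP; apply: INR_lt; lra.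
  have fp : Cmod (f p) = 1.
    case: (nc_norm _ _ p hf) => // fp0; exfalso.
    apply: (nc_coprime_neq0 Q f p hf p0) => //.
    rewrite prime_coprime //; apply/negP => /(dvdn_leq (nc_pos _ _ hf)).
    by rewrite leqNgt Qlp.
  rewrite /w Msum_ramanujan //.
  have PX : INR P * INR P <= X.
    by apply: Rle_trans h1; rewrite -mult_INR multE; apply: le_INR; exact/leP.
  have pP' : INR p <= INR P by apply: le_INR; exact/leP.
  have y0p : y0 <= X / INR p.
    apply/Rle_div_r => //; have y2 : y0 * y0 <= X by nra.
    case: (Rle_lt_dec (INR p) y0) => h; first by nra.
    by nra.
  have [m1 _] := HM (X / INR p) (N %/ p)%N (is_floor_div X N p p0 hN) y0p.
  have [_ m2] := HM X N hN ltac:(nra).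
  set M1 := Msum _ _ _ (X / INR p) _ in m1 *; set M2 := Msum _ _ _ X _ in m2 *.
  have -> : (- (RtoC (INR p) * f p * M1) - M2 = - ((RtoC (INR p) * f p * M1) - (- M2)))%C by ring.
  rewrite Cmod_opp.
  apply: Rle_trans (Cmod_triangle_rev _ _); rewrite Cmod_opp !Cmod_mult fp Cmod_R Rabs_pos_eq; last by lra.
  have E : Rpower (X / INR p) b * INR p = Rpower X b * Rpower (INR p) (1 - b).
    have -> : 1 - b = 1 + - b by ring.
    rewrite /Rdiv -Rpower_mult_distr //; last by apply: Rinv_0_lt_compat.
    rewrite Rpower_plus Rpower_1 // Rmult_assoc; congr Rmult.
    by rewrite Rmult_comm; congr Rmult; rewrite /Rpower ln_Rinv //; congr exp; ring.
  have XB : 0 < Rpower X b by apply: exp_pos.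
  have pt : Rpower t (1 - b) <= Rpower (INR p) (1 - b) by apply: Rpower_le_pos; lra.
  have c2t : c2 <= c1 / 2 * Rpower t (1 - b).
    by move/(Rle_div_l _ _ _ c10): tb; lra.
  have m1' : c1 * (Rpower X b * Rpower (INR p) (1 - b)) <= INR p * 1 * Cmod M1.
    by rewrite -E; have := Rmult_le_compat_r _ _ _ (Rlt_le _ _ ppos) m1; lra.
  have m3 : c1 * (Rpower X b * Rpower t (1 - b)) <= c1 * (Rpower X b * Rpower (INR p) (1 - b)).
    by apply: Rmult_le_compat_l; [lra | apply: Rmult_le_compat_l; lra].
  have m4 : c2 * Rpower X b <= c1 / 2 * Rpower t (1 - b) * Rpower X b.
    by apply: Rmult_le_compat_r; lra.
  lra.
have S : t * (c1 / 2 * Rpower X b * Rpower t (1 - b)) <= INR Q * (10 * D * INR N * (1 + ln (INR N)) ^ 2) * I.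
  apply: Rle_trans TD.
  apply: (Rle_trans _ (\sumR_(p <- ps) (c1 / 2 * Rpower X b * Rpower t (1 - b)))).
    have c0 : 0 < c1 / 2 * Rpower X b * Rpower t (1 - b).
      by apply: Rmult_lt_0_compat; [apply: Rmult_lt_0_compat; [lra |] |]; apply: exp_pos.
    have -> : \sumR_(p <- ps) (c1 / 2 * Rpower X b * Rpower t (1 - b)) = INR (size ps) * (c1 / 2 * Rpower X b * Rpower t (1 - b)).
      elim: (ps) => [|p s IH]; first by rewrite big_nil /=; ring.
      by rewrite big_cons IH -[size (p :: s)]/(size s).+1 S_INR -[LHS]/(_ + _); ring.
    apply: Rmult_le_compat_r; first by lra.
    by apply: (Rle_trans _ _ _ Hpi); apply: large_primes_size.
  rewrite big_seq [X in _ <= X]big_seq; apply: Rsum_le => p; exact: hp.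
have I0 : 0 <= I.
  apply: RInt_ge_0; [lra | | by move=> x _; apply: Cmod_ge_0].
  by apply: (ex_RInt_continuous (V := R_CompleteNormedModule)) => x _; apply: continuous_Cmod_expsum.
have lnN : 0 <= ln (INR N) <= ln X.
  by split; [apply: ln_INR_ge0 | apply: ln_le].
have S2 : INR Q * (10 * D * INR N * (1 + ln (INR N)) ^ 2) * I <= A * X * L ^ 3 * I.
  apply: Rmult_le_compat_r => //.
  have h3 : (1 + ln (INR N)) ^ 2 <= L ^ 2 by apply: pow_incr; rewrite /L; lra.
  have h4 : INR N * (1 + ln (INR N)) ^ 2 <= X * L ^ 2.
    by apply: Rmult_le_compat => //; [lra | apply: pow2_ge_0].
  have h5 : 0 <= INR Q * (10 * D) by apply: Rmult_le_pos; lra.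
  have := Rmult_le_compat_l _ _ _ h5 h4; rewrite /A /D => h6.
  have -> : INR Q * (10 * (CA * C')) * X * L ^ 3 = INR Q * (10 * (CA * C' * L)) * (X * L ^ 2) by ring.
  by apply: Rle_trans h6; right; ring.
(* The power (16 L)^(2 - b) is rounded up to (16 L)^2 = 256 L^2. *)
have T2 : Rpower X (1 - b / 2) / (256 * L ^ 2) <= t * Rpower t (1 - b).
  have -> : t * Rpower t (1 - b) = Rpower t (2 - b).
    by rewrite -{1}(Rpower_1 t) // -Rpower_plus; congr Rpower; ring.
  have -> : t = Rpower X (/ 2) * / (16 * L) by rewrite /t Rpower_sqrt.
  have i0 : 0 < / (16 * L) by apply: Rinv_0_lt_compat; lra.
  rewrite -Rpower_mult_distr //; last by apply: exp_pos.
  rewrite Rpower_mult.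
  have -> : / 2 * (2 - b) = 1 - b / 2 by field.
  apply: Rmult_le_compat_l; first by left; apply: exp_pos.
  have -> : 256 * L ^ 2 = Rpower (16 * L) 2.
    have -> : 2 = INR 2 by rewrite /=; ring.
    by rewrite Rpower_pow; [rewrite /=; ring | lra].
  have -> : Rpower (/ (16 * L)) (2 - b) = / Rpower (16 * L) (2 - b).
    by rewrite -Rpower_Ropp /Rpower ln_Rinv; [congr exp; ring | lra].
  apply: Rinv_le_contravar; first by apply: exp_pos.
  by apply: Rle_Rpower; lra.
have XB : 0 < Rpower X b by apply: exp_pos.
have EX : Rpower X b * Rpower X (1 - b / 2) = Rpower X (b / 2) * X.
  by rewrite -{4}(Rpower_1 X) // -!Rpower_plus; congr Rpower; field.
have F : c1 / 2 * Rpower X b * (Rpower X (1 - b / 2) / (256 * L ^ 2)) <= A * X * L ^ 3 * I.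
  apply: Rle_trans S2; apply: Rle_trans S.
  have -> : t * (c1 / 2 * Rpower X b * Rpower t (1 - b)) = c1 / 2 * Rpower X b * (t * Rpower t (1 - b)) by ring.
  by apply: Rmult_le_compat_l => //; apply: Rmult_le_pos; lra.
have L2 : 0 < L ^ 2 by apply: pow_lt; lra.
have G : c1 / 2 * (Rpower X (b / 2) * X) / 256 <= A * X * L ^ 5 * I.
  have := Rmult_le_compat_r _ _ _ (Rlt_le _ _ L2) F.
  have -> : A * X * L ^ 3 * I * L ^ 2 = A * X * L ^ 5 * I by ring.
  rewrite -EX; apply: Rle_trans; right; field; lra.
have -> : c1 / 2 / 256 / A * Rpower X (b / 2) = c1 / 2 * (Rpower X (b / 2) * X) / 256 / (A * X) by field; lra.
apply/Rle_div_l; first by apply: Rmult_lt_0_compat.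
lra.
Qed.

Lemma L1_lower (Q : nat) (f eta : nat -> C) (rho : C) (CA b eps : R) :
  nat_character Q f -> 0 < CA -> 0 <= Re rho < 1 ->
  (forall j, (0 < j)%N -> Cmod (dser eta rho j) <= CA * Rpower (INR j) (- Re rho)) ->
  0 < b < 1 -> M_growth f eta rho b -> 0 < eps ->
  exists c X0, 0 < c /\ 1 <= X0 /\ forall X, X0 <= X ->
    c * Rpower X (b / 2 - eps) <= RInt (fun x => Cmod (liouville_sum X x)) 0 1.
Proof.
move=> hf CA0 hrho HA hb HM he.
have [c [X0 [c0 [X01 H]]]] := L1_lower_log Q f eta rho CA b hf CA0 hrho HA hb HM.
(* An exponent eps / 5 for each of the five logarithms. *)
pose K := 1 + / (eps / 5).
have K0 : 0 < K by rewrite /K; have : 0 < / (eps / 5); [apply: Rinv_0_lt_compat; lra | lra].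
have K5 : 0 < K ^ 5 by apply: pow_lt.
exists (c / K ^ 5), X0; split; first by apply: Rdiv_lt_0_compat.
split => // X hX; have := H X hX; set I := RInt _ 0 1 => h.
have X1 : 1 <= X by lra.
have l0 : 0 <= ln X by rewrite -ln_1; apply: ln_le; lra.
have p0 : 0 < Rpower X (b / 2) by apply: exp_pos.
have q0 : 0 < Rpower X eps by apply: exp_pos.
have l5 : 0 < (1 + ln X) ^ 5 by apply: pow_lt; lra.
have I0 : 0 <= I.
  apply: Rnot_lt_le => In.
  have : (1 + ln X) ^ 5 * I < 0 by nra.
  have : 0 < c * Rpower X (b / 2) by apply: Rmult_lt_0_compat.
  lra.
have hl : (1 + ln X) ^ 5 <= K ^ 5 * Rpower X eps.
  have -> : Rpower X eps = Rpower X (eps / 5) ^ 5.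
    rewrite -Rpower_pow; last by apply: exp_pos.
    by rewrite Rpower_mult; congr Rpower; rewrite /=; field.
  rewrite -Rpow_mult_distr; apply: pow_incr; split; first by lra.
  by apply: one_plus_ln_le; lra.
have -> : c / K ^ 5 * Rpower X (b / 2 - eps) = c * Rpower X (b / 2) / (K ^ 5 * Rpower X eps).
  by rewrite /Rminus Rpower_plus Rpower_Ropp; field; lra.
apply/Rle_div_l; first by apply: Rmult_lt_0_compat.
by have := Rmult_le_compat_r _ _ _ I0 hl; lra.
Qed.

(** The twisted coefficients are 1, -1, 1, -1, ..., those of the alternating zeta series; their
    partial sums are n modulo 2. *)
Lemma bounded_twist2_one (f : nat -> C) : (forall n, f n = RtoC 1) ->
  bounded_sums (twist2 (RtoC 2) f) 1.
Proof.
move=> hf n.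
have -> : \sumC_(1 <= d < n.+1) twist2 (RtoC 2) f d = RtoC (INR (n %% 2)).
  rewrite (eq_bigr (fun d => twist2 (RtoC 2) f d * RtoC 1)%C); last by move=> d _; ring.
  rewrite (sum_twist2 (RtoC 2) f (fun _ => RtoC 1)).
  rewrite (eq_bigr (fun _ => RtoC 1)); last by move=> d _; rewrite hf; ring.
  rewrite [\sumC_(1 <= d < (n %/ 2).+1) _](eq_bigr (fun _ => RtoC 1)); last by move=> d _; rewrite hf; ring.
  rewrite !Csum_const !subn1 ![_.-1]/= {1}(divn_eq n 2) -plusE -multE plus_INR mult_INR [INR 2]/= RtoC_plus RtoC_mult.
  by have -> : 1 + 1 = 2 by [ring]; ring.
rewrite Cmod_R Rabs_pos_eq; last exact: pos_INR.
by apply: (le_INR _ 1); apply/leP; rewrite -ltnS ltn_pmod.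
Qed.

(** A series with sum 0 has partial sums equal to minus its tails, and the Dirichlet test bounds
    those. The summand 1 makes the constant positive, as [L1_lower] asks. *)
Lemma dser_zero_bound (eta : nat -> C) (rho : C) (C0 : R) (j : nat) : bounded_sums eta C0 -> 0 < Re rho ->
  Clim (dser eta rho) = RtoC 0 -> (0 < j)%N ->
  Cmod (dser eta rho j) <= (2 * C0 * (Cmod rho / Re rho) + 1) * Rpower (INR j) (- Re rho).
Proof.
move=> HB hr H0 j0; have jp := INR_pos j j0.
have [_ /(_ j)] := dser_cv eta C0 rho HB hr; rewrite H0.
have -> : (0 - dser eta rho j = - dser eta rho j)%C by ring.
rewrite Cmod_opp => h; apply: (Rle_trans _ _ _ h).
have C0p := bounded_sums_ge0 _ _ HB.
have p0 : 0 < Rpower (INR j) (- Re rho) by apply: exp_pos.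
have d0 : 0 <= Cmod rho / Re rho by apply: Rdiv_le_0_compat; [exact: Cmod_ge_0 |].
have : Rpower (INR j.+1) (- Re rho) <= Rpower (INR j) (- Re rho).
  by apply: Rpower_le_neg; [split=> //; rewrite S_INR; lra | lra].
have : 0 <= 2 * C0 * (Cmod rho / Re rho) by apply: Rmult_le_pos; lra.
nra.
Qed.

(** At rho = 0 the required decay j^(-Re rho) is mere boundedness, which the alternating
    coefficients have. The exponent is half of the 1/2 supplied by counting squares. *)
Lemma L1_lower_quarter (eps : R) : 0 < eps ->
  exists c X0, 0 < c /\ 1 <= X0 /\ forall X, X0 <= X ->
    c * Rpower X (1 / 4 - eps) <= RInt (fun x => Cmod (liouville_sum X x)) 0 1.
Proof.
move=> he.
have hf : nat_character 1 Cone.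
  by split => //; move=> m n; rewrite /Cone Cmult_1_l.
have HA j : (0 < j)%N -> Cmod (dser (twist2 (RtoC 2) Cone) (RtoC 0) j) <= 1 * Rpower (INR j) (- Re (RtoC 0)).
  move=> j0; rewrite /= Ropp_0 Rpower_O; last exact: INR_pos.
  rewrite Rmult_1_l; have := bounded_twist2_one Cone (fun _ => erefl) j; congr (Cmod _ <= _).
  by apply: eq_bigr => d _; have -> : (- RtoC 0)%C = RtoC 0 by [ring]; rewrite cpow_0 Cmult_1_r.
have := L1_lower 1 Cone (twist2 (RtoC 2) Cone) (RtoC 0) 1 (1 / 2) eps hf ltac:(lra) ltac:(rewrite /=; lra) HA ltac:(lra) M_growth_trivial he.
by have -> : 1 / 2 / 2 = 1 / 4 by field.
Qed.

Theorem theorem1p2 (q : Z) (chi : Z -> C) (L : C -> C) (rho : C) (eps : R)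
    (Hchi : primitive_character q chi)
    (HL : is_dirichlet_L q chi L)
    (Hdom : L_domain q chi rho)
    (Hzero : L rho = RtoC 0)
    (Heps : 0 < eps) :
  exists c : R, 0 < c /\
    exists X0 : R, forall X : R, X0 <= X ->
      RInt (fun alpha : R => Cmod (liouville_sum X alpha)) 0 1
        >= c * Rpower X (Re rho / 2 - eps).
Proof.
suff [b [hb [c [X0 [c0 [X01 H]]]]]] : exists b, Re rho / 2 <= b /\
  exists c X0, 0 < c /\ 1 <= X0 /\ forall X, X0 <= X ->
    c * Rpower X (b - eps) <= RInt (fun x => Cmod (liouville_sum X x)) 0 1.
  exists c; split => //; exists X0 => X hX; apply: Rle_ge; apply: Rle_trans (H X hX).
  by apply: Rmult_le_compat_l; [lra | apply: Rle_Rpower; lra].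
(* For zeros with Re rho <= 1/2 the unconditional exponent 1/4 is at least Re rho / 2. *)
case: (Rle_lt_dec (Re rho) (1 / 2)) => hr.
  by exists (1 / 4); split; [lra | apply: L1_lower_quarter].
exists (Re rho / 2); split; first by lra.
have hchi := proj1 Hchi.
have hr1 : Re rho < 1.
  apply: Rnot_le_lt => h; exact: (no_zero_right q chi L rho hchi HL Hdom h Hzero).
have hf := dirichlet_nat_character q chi hchi; set f := fun n => chi (Z.of_nat n) in hf.
have [kappa [C0 [hk hB]]] : exists kappa C0, (1 - kappa * cpow 2 (- rho))%C <> RtoC 0 /\
   bounded_sums (twist2 kappa f) C0.
  case: (classic (principal_character q chi)) => hp; last first.
    exists (RtoC 0), (1 * INR (Z.to_nat q) + 1); split.
      by have -> : (1 - 0 * cpow 2 (- rho))%C = RtoC 1 by [ring]; move=> /RtoC_inj; lra.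
    move=> n; have := nonprincipal_bounded q chi hchi hp n; congr (Cmod _ <= _).
    by apply: eq_bigr => d _; rewrite twist2_0.
  have [_ h1] := primitive_principal q chi Hchi hp.
  exists (RtoC 2), 1; split; last by apply: bounded_twist2_one => n; apply: h1.
  (* The factor 1 - 2^(1 - rho) can only vanish on Re rho = 1, since |2^(1 - rho)| = 2^(1 - Re rho)
     > 1 here. *)
  move=> E; have := f_equal Cmod (_ : RtoC 2 * cpow 2 (- rho) = RtoC 1)%C.
  rewrite Cmod_mult Cmod_cpow Cmod_1 Cmod_R Rabs_pos_eq; last by lra.
  have -> : 2 * Rpower 2 (Re (- rho)%C) = Rpower 2 (1 - Re rho).
    by rewrite -{1}(Rpower_1 2) -?Rpower_plus; [congr Rpower; rewrite /Re /=; ring | lra].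
  move=> H; have : 1 < Rpower 2 (1 - Re rho).
    apply: (Rle_lt_trans _ (Rpower 2 0)); first by right; rewrite Rpower_O; lra.
    by apply: Rpower_lt; lra.
  rewrite H; first by lra.
  have -> : (RtoC 2 * cpow 2 (- rho) = 1 - (1 - RtoC 2 * cpow 2 (- rho)))%C by ring.
  by rewrite E; ring.
have C0p := bounded_sums_ge0 _ _ hB.
have EL := L_continuation q chi L rho kappa C0 HL Hdom ltac:(lra) hB.
rewrite Hzero Cmult_0_r in EL.
apply: (L1_lower (Z.to_nat q) f (twist2 kappa f) rho (2 * C0 * (Cmod rho / Re rho) + 1)) => //.
- have : 0 <= Cmod rho / Re rho by apply: Rdiv_le_0_compat; [exact: Cmod_ge_0 | lra].
  by move=> h; have := Rmult_le_pos _ _ C0p h; lra.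
- by lra.
- by move=> j; apply: dser_zero_bound => //; lra.
- by lra.
- by apply: M_growth_zero => //; exact: nc_cmult hf.
Qed.
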